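(* Let $K$ be a knot which is the closure of a positive braid $\beta\in B_N$, i.e. $\beta$ is a word in the generators $\sigma_1,\dots,\sigma_{N-1}$ only, with no inverses. Then: (1) The reduced quantum trace $\mathrm{Tr}'_q(\boldsymbol\beta)$ (defined in the context) converges absolutely: for each fixed monomial $x^{a}q^{b}$ only finitely many states contribute to it, so the sum is independent of the order of summation. Moreover $\mathrm{Tr}'_q(\boldsymbol\beta)\in\mathbb{Z}[q][[x^{-1}]]$. (2) $\mathrm{Tr}'_q(\boldsymbol\beta)$ depends only on $K$ and not on the choice of positive braid $\beta$ with closure $K$. (3) Define $F_K^-(x,q):=(x^{1/2}-x^{-1/2})\,\mathrm{Tr}'_q(\boldsymbol\beta)$. Then $F_K^-(x,q)=-x^{-1/2}\sum_{m\ge0}f^K_m(q)x^{-m}$ with every $f^K_m(q)$ a polynomial in $q$ with integer coefficients. (4) $F_K^-$ has the large color (Melvin–Morton–Rozansky) expansion. Substitute $q=e^\hbar$ in each coefficient of $\mathrm{Tr}'_q(\boldsymbol\beta)=\frac{F_K^-(x,q)}{x^{1/2}-x^{-1/2}}$, expand in $\hbar$, and collect the coefficient of $\hbar^j$ as a series in $x^{-1}$. For every $j\ge0$ this series equals $\frac{1}{j!}\frac{P_K(j;x)}{\Delta_K(x)^{2j+1}}$ expanded as a Laurent series in $x^{-1}$. Consequently $F_K:=F_K^-$ is a series in $x$ and $q$ with integer coefficients whose $\hbar$-expansion satisfies $\frac{F_K(x,e^\hbar)}{x^{1/2}-x^{-1/2}}=\sum_{j\ge0}\frac{P_K(j;x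)}{\Delta_K(x)^{2j+1}}\frac{\hbar^j}{j!}$.
   Context: Quantum integers: $[n]=\frac{q^{n/2}-q^{-n/2}}{q^{1/2}-q^{-1/2}}$, $[k]!=[1][2]\cdots[k]$, and $\begin{bmatrix} i\\ k\end{bmatrix}=\frac{[i]!}{[k]![i-k]!}$. Large color $R$-matrix. Let $V$ be the free module with basis $v^0,v^1,v^2,\dots$ over Laurent polynomials in $q^{1/2},x^{1/2}$. This is the highest weight Verma module of $U_q(\mathfrak{sl}_2)$ with highest weight $\log_q x-1$. Define $\check R:V\otimes V\to V\otimes V$ by $\check R(v^i\otimes v^j)=x^{-1/2}\sum_{k=0}^{i}\begin{bmatrix} i\\ k\end{bmatrix}\prod_{l=1}^{k}(1-x^{-1}q^{j+l})\,x^{-\frac{(i-k)+j}{2}}q^{(i-k)j+\frac{(i-k)k}{2}+\frac{(i-k)+j+1}{2}}\,v^{j+k}\otimes v^{i-k}$. This is the framing-corrected version, with the factor $q^{(n^2-1)/4}$, $x=q^n$, removed. Its inverse is $\check R^{-1}=P\,\check R|_{x\to x^{-1},q\to q^{-1}}\,P$, where $P(a\otimes b)=b\otimes a$. A braid $\beta\in B_N$, read from bottom to top, acts on $V^{\otimes N}$ by letting $\sigma_i$ act as $\check R$ on tensor factors $i,i+1$; denote the resulting operator by $\boldsymbol\beta$. Reduced quantum trace (right closure, leftmost strand open). Let $\boldsymbol\beta'$ be the operator on the span of $v^0\otimes v^{i_2}\otimes\cdots\otimes v^{i_N}$ obtained by keeping the first factor fixed at $v^0$: its matrix entries are those of $\boldsymbol\beta$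 between such vectors. The total weight $i_2+\cdots+i_N=w$ is preserved; let $\boldsymbol\beta'(w)$ be the finite-dimensional block of weight $w$. Then $\mathrm{Tr}'_q(\boldsymbol\beta):=x^{\frac{N-1}{2}}q^{-\frac{N-1}{2}}\sum_{w\ge0}\mathrm{Tr}(\boldsymbol\beta'(w))\,q^{-w}$. This is the state sum in which each closed strand carrying $v^i$ receives weight $x^{1/2}q^{-1/2}q^{-i}$. Colored Jones and MMR expansion. $J_K(n;q)$ denotes the reduced colored Jones polynomial of the $0$-framed knot $K$ for the $n$-dimensional irreducible representation of $U_q(\mathfrak{sl}_2)$, normalized to be $1$ on the unknot. $\Delta_K(x)$ denotes the Alexander polynomial, normalized so that $\Delta_K(x)=\Delta_K(x^{-1})$ and $\Delta_K(1)=1$. The Melvin–Morton–Rozansky expansion (Rozansky's theorem) states that there are Laurent polynomials $P_K(j;x)\in\mathbb{Z}[x^{\pm1}]$ such that, expanding $J_K(n;e^\hbar)$ in $\hbar$ with $x=e^{n\hbar}$ held fixed, $J_K(n;e^\hbar)=\sum_{j\ge0}\frac{P_K(j;x)}{\Delta_K(x)^{2j+1}}\frac{\hbar^j}{j!}$.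
   Formalization: Part (3) is stated only for K not the unknot: for the unknot Tr'_q = 1 and F_K^- = x^{1/2} - x^{-1/2}, which is not of the claimed form. Two braids are taken to have the same closure K when they are Markov equivalent. *)

(* Defs.v *)
From HB Require Import structures.
From Stdlib Require Import Relations.
From mathcomp Require Import all_boot all_order all_algebra.
Set Implicit Arguments. Unset Strict Implicit. Unset Printing Implicit Defensive.
Import Order.TTheory GRing.Theory Num.Theory.
Local Open Scope ring_scope.

(* Laurent polynomials in s = q^{1/2} and t = x^{1/2} over Z, given   *)
(* as formal sums of terms (c, (a, b)) meaning c * s^a * t^b.          *)
(* Only the coefficient functional [lcoef] is ever used, so the        *)
(* (non-canonical) list representation is irrelevant.                  *)
Definition lpoly := seq (int * (int * int)).
Definition lmono (c a b : int) : lpoly := [:: (c, (a, b))].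
Definition lone : lpoly := lmono 1 0 0.
Definition ladd (p r : lpoly) : lpoly := p ++ r.
Definition lmul (p r : lpoly) : lpoly :=
  [seq (m1.1 * m2.1, (m1.2.1 + m2.2.1, m1.2.2 + m2.2.2)) | m1 <- p, m2 <- r].
Definition lprod (ps : seq lpoly) : lpoly := foldr lmul lone ps.
Definition lcoef (p : lpoly) (a b : int) : int :=
  \sum_(m <- p | m.2 == (a, b)) m.1.

(* Gaussian binomial G(n,k) in q = s^2 (q-Pascal recursion). *)
Fixpoint gauss (n k : nat) : lpoly :=
  match n, k with
  | _, 0%N => lone
  | 0%N, _.+1 => [::]
  | n'.+1, k'.+1 =>
      ladd (gauss n' k') (lmul (lmono 1 (Posz (2 * k'.+1)%N) 0) (gauss n' k'.+1))
  end.
(* symmetric quantum binomial [n k] = [n]!/([k]![n-k]!) = q^{-k(n-k)/2} G(n,k) *)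
Definition qbin (n k : nat) : lpoly :=
  lmul (lmono 1 (- Posz (k * (n - k))%N) 0) (gauss n k).

(* Coefficient of v^{j+k} (x) v^{i-k} in Rcheck (v^i (x) v^j), k <= i. *)
Definition Rcoef (i j k : nat) : lpoly :=
  lprod [:: lmono 1 (Posz (2 * (i - k) * j + (i - k) * k + (i - k) + j + 1)%N)
                   (- Posz (1 + (i - k) + j)%N);
            qbin i k;
            lprod [seq ladd lone (lmono (-1) (Posz (2 * (j + l))%N) (-2)) | l <- iota 1 k]].

(* A braid word on N strands is a list of generator indices g (0-based;*)
(* g stands for sigma_{g+1}, acting on tensor factors g, g+1); letters *)
(* act in list order (bottom to top).  Basis vectors of V^{(x)N} are   *)
(* lists of N naturals (the exponents of v).                           *)
Definition step (g : nat) (c : seq nat) (k : nat) : seq nat :=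
  set_nth 0%N (set_nth 0%N c g (nth 0%N c g.+1 + k)%N) g.+1 (nth 0%N c g - k)%N.

Fixpoint kseqs (w : seq nat) (c : seq nat) : seq (seq nat) :=
  match w with
  | [::] => [:: [::]]
  | g :: w' => flatten [seq [seq k :: ks | ks <- kseqs w' (step g c k)]
                       | k <- iota 0 (nth 0%N c g).+1]
  end.

Fixpoint pathw (w : seq nat) (c : seq nat) (ks : seq nat) : lpoly :=
  match w, ks with
  | g :: w', k :: ks' =>
      lmul (Rcoef (nth 0%N c g) (nth 0%N c g.+1) k) (pathw w' (step g c k) ks')
  | _, _ => lone
  end.

Fixpoint pathvecs (w : seq nat) (c : seq nat) (ks : seq nat) : seq (seq nat) :=
  match w, ks with
  | g :: w', k :: ks' => c :: pathvecs w' (step g c k) ks'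
  | _, _ => [:: c]
  end.

Definition pathend (w : seq nat) (c : seq nat) (ks : seq nat) : seq nat :=
  last c (pathvecs w c ks).

Fixpoint comps (n s : nat) : seq (seq nat) :=
  match n with
  | 0%N => if s == 0%N then [:: [::]] else [::]
  | n'.+1 => flatten [seq [seq a :: c | c <- comps n' (s - a)%N] | a <- iota 0 s.+1]
  end.

Definition states (N : nat) (word : seq nat) (w : nat) : seq (seq nat * seq nat) :=
  [seq (c0, ks) | c0 <- [seq 0%N :: c | c <- comps N.-1 w],
                  ks <- [seq ks <- kseqs word c0 | pathend word c0 ks == c0]].

(* contribution of a state, including the factor x^{(N-1)/2} q^{-(N-1)/2} q^{-w} *)
Definition contrib (N : nat) (word : seq nat) (St : seq nat * seq nat) : lpoly :=
  lmul (lmono 1 (- Posz (N.-1 + 2 * sumn St.1)%N) (Posz N.-1)) (pathw word St.1 St.2).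

Definition blocksum (N : nat) (word : seq nat) (w : nat) (a b : int) : int :=
  \sum_(St <- states N word w) lcoef (contrib N word St) a b.

(* T (as a function of exponents (a,b) of s^a t^b) is the reduced quantum trace
   Tr'_q of the braid, the defining sum converging absolutely: for every monomial,
   all states of large enough weight (hence all but finitely many states) have zero
   coefficient at that monomial. *)
Definition IsTrace (N : nat) (word : seq nat) (T : int -> int -> int) : Prop :=
  forall a b, exists W : nat,
    (forall w, (W <= w)%N -> forall St, St \in states N word w ->
        lcoef (contrib N word St) a b = 0) /\
    T a b = \sum_(w < W) blocksum N word w a b.

Definition InZqx (T : int -> int -> int) : Prop :=
  (forall a b, T a b != 0 -> [/\ 0 <= a, b <= 0, (2 %| a)%Z & (2 %| b)%Z]) /\
  (forall b, exists A : int, forall a, A < a -> T a b = 0).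

(* F^- = (x^{1/2} - x^{-1/2}) Tr' has the form -x^{-1/2} sum_{m>=0} f_m(q) x^{-m}
   with f_m in Z[q]. *)
Definition Fminus (T : int -> int -> int) (a b : int) : int := T a (b - 1) - T a (b + 1).
Definition FminusForm (T : int -> int -> int) : Prop :=
  (forall a b, Fminus T a b != 0 ->
     [/\ 0 <= a, b <= -1, (2 %| a)%Z & (2 %| (b + 1))%Z]) /\
  (forall b, exists A : int, forall a, A < a -> Fminus T a b = 0).

Definition swapg (g p : nat) : nat :=
  if p == g then g.+1 else if p == g.+1 then g else p.
Definition bperm (w : seq nat) (p : nat) : nat := foldl (fun p g => swapg g p) p w.
Definition is_knot (N : nat) (w : seq nat) : Prop :=
  forall p, (p < N)%N -> exists k, iter k (bperm w) 0%N = p.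
Definition positive_knot (N : nat) (w : seq nat) : Prop :=
  [/\ (0 < N)%N, all (fun g => g.+1 < N)%N w & is_knot N w].

(* general braid words: (true, g) = sigma_{g+1}, (false, g) = its inverse *)
Definition sword := seq (bool * nat).
Definition posw (w : seq nat) : sword := [seq (true, g) | g <- w].
Definition wfw (N : nat) (u : sword) : bool := all (fun x => x.2.+1 < N)%N u.

Inductive mstep : nat * sword -> nat * sword -> Prop :=
| ms_free N u1 u2 e i : wfw N (u1 ++ u2) -> (i.+1 < N)%N ->
    mstep (N, u1 ++ (e, i) :: (~~ e, i) :: u2) (N, u1 ++ u2)
| ms_far N u1 u2 e e' i j : wfw N (u1 ++ u2) -> (j.+1 < N)%N -> (i.+1 < j)%N ->
    mstep (N, u1 ++ (e, i) :: (e', j) :: u2) (N, u1 ++ (e', j) :: (e, i) :: u2)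
| ms_braid N u1 u2 i : wfw N (u1 ++ u2) -> (i.+2 < N)%N ->
    mstep (N, u1 ++ [:: (true, i); (true, i.+1); (true, i)] ++ u2)
          (N, u1 ++ [:: (true, i.+1); (true, i); (true, i.+1)] ++ u2)
| ms_conj N u e i : wfw N u -> (i.+1 < N)%N ->
    mstep (N, u) (N, (e, i) :: rcons u (~~ e, i))
| ms_stab N u e : (0 < N)%N -> wfw N u ->
    mstep (N, u) (N.+1, rcons u (e, N.-1)).

(* closures are isotopic (oriented) links, via Markov's theorem *)
Definition markov_equiv : nat * sword -> nat * sword -> Prop :=
  clos_refl_sym_trans _ mstep.

(* Colored Jones polynomial J_K(n;q): the same reduced quantum trace   *)
(* for the n-dimensional irreducible quotient of V at x = q^n, i.e.    *)
(* t = s^n and all indices < n.  Result is a Laurent poly in s.        *)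
Definition jones (N : nat) (word : seq nat) (n : nat) : lpoly :=
  [seq (m.1, (m.2.1 + Posz n * m.2.2, 0)) |
     m <- flatten [seq contrib N word St |
                    St <- flatten [seq states N word w | w <- iota 0 (N * n)%N]
                    & all (all (fun i => i < n)%N) (pathvecs word St.1 St.2)]].

(* coefficient of hbar^m in the expansion of a Laurent poly in s at q = e^hbar *)
Definition hcoef (p : lpoly) (m : nat) : rat :=
  \sum_(mo <- p) (mo.1)%:~R * ((mo.2.1)%:~R / 2) ^+ m / (m`!)%:R.

(* Laurent polynomials in x: terms (c, e) meaning c x^e *)
Definition xpoly := seq (int * int).
Definition xcoef (p : xpoly) (e : int) : int := \sum_(m <- p | m.2 == e) m.1.
Definition xmul (p r : xpoly) : xpoly := [seq (m1.1 * m2.1, m1.2 + m2.2) | m1 <- p, m2 <- r].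
Definition xpow (p : xpoly) (k : nat) : xpoly := iter k (xmul p) [:: (1, 0)].
(* coefficient of u^r in p(e^u) *)
Definition xser (p : xpoly) (r : nat) : rat :=
  \sum_(m <- p) (m.1)%:~R * (m.2)%:~R ^+ r / (r`!)%:R.

(* D is the Alexander polynomial of the closure, normalized by D(x)=D(1/x), D(1)=1.
   The unnormalized one is the (1,1)-minor of I - Burau(beta). *)
Definition burau (n g : nat) : 'M[{poly int}]_n :=
  \matrix_(r, c)
    (if (r == g :> nat) && (c == g :> nat) then 1 - 'X
     else if (r == g :> nat) && (c == g.+1 :> nat) then 'X
     else if (r == g.+1 :> nat) && (c == g :> nat) then 1
     else if (r == g.+1 :> nat) && (c == g.+1 :> nat) then 0
     else if r == c then 1 else 0).
Definition burau_word (n : nat) (w : seq nat) : 'M[{poly int}]_n :=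
  foldr (fun g M => burau n g *m M) 1%:M w.
Definition alex_minor (n : nat) (w : seq nat) : {poly int} :=
  \det (row' ord0 (col' ord0 (1%:M - burau_word n.+1 w))).
Definition IsAlexander (N : nat) (w : seq nat) (D : xpoly) : Prop :=
  [/\ exists (eps : bool) (k : int), forall e,
        xcoef D e = (-1) ^+ eps *
          (if 0 <= e + k then (alex_minor N.-1 w)`_(absz (e + k)) else 0),
      forall e, xcoef D e = xcoef D (- e) &
      \sum_(m <- D) m.1 = 1].

(* Melvin-Morton-Rozansky expansion (Rozansky's theorem) for J:
   J(n;e^hbar) = sum_j P(j;x)/D(x)^{2j+1} hbar^j/j!  with x = e^{n hbar} fixed.
   Precisely: the hbar^m coefficient of J(n;e^hbar) is sum_{i<=m} b m i n^i, and
   for each j, P(j;e^u)/D(e^u)^{2j+1} = j! sum_i b (i+j) i u^i in Q[[u]]. *)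
Definition MMR (N : nat) (w : seq nat) (P : nat -> xpoly) (D : xpoly) : Prop :=
  exists b : nat -> nat -> rat,
    (forall n m, (0 < n)%N -> hcoef (jones N w n) m = \sum_(i < m.+1) b m i * (n%:R) ^+ i) /\
    (forall j i, \sum_(k < i.+1) (b (k + j)%N k * (j`!)%:R) * xser (xpow D (2 * j).+1) (i - k)
                 = xser (P j) i).

(* h (indexed by x-exponent) is the coefficient of hbar^j in T after q = e^hbar *)
Definition HbarCoeff (T : int -> int -> int) (j : nat) (e : int) (h : rat) : Prop :=
  exists A : nat,
    (forall a, (A <= absz a)%N -> T a (2 * e) = 0) /\
    h = \sum_(x <- iota 0 (2 * A)) (T (Posz x - Posz A) (2 * e))%:~R
          * ((Posz x - Posz A)%:~R / 2) ^+ j / (j`!)%:R.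

(* h is the Laurent expansion in x^{-1} of P/(j! D^{2j+1}) *)
Definition LaurentExp (h : int -> rat) (P : xpoly) (j : nat) (D : xpoly) : Prop :=
  (exists E : int, forall e, E < e -> h e = 0) /\
  (forall e, \sum_(d <- xpow D (2 * j).+1) (d.1)%:~R * h (e - d.2)
             = (xcoef P e)%:~R / (j`!)%:R).

(* Main.v *)
(** Put [y = x^(-1/2)].  In a closed state of a positive braid, each particle that moves
    at a crossing costs a factor [y], and a flux argument shows that a state of weight [W]
    only contributes monomials of degree at most [-W] in [x]; this gives the absolute
    convergence and the shape of the trace.

    At [q = exp h] the coefficient of [h^j] of an [R]-matrix entry is a polynomial in the
    numbers of particles that move or stay, times the weight of a free particle system.  By
    MacMahon's master theorem the state sum of free particles is the inverse of a
    determinant, and polynomial insertions amount to applying Euler operators to it.  Hence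
    the coefficient of [h^j] in the trace is the expansion at [y = 0] of a rational function
    of [y].  Its expansion at [y = 1] is read off the colored Jones polynomials: at [x = q^n]
    the weights that leave the [n]-dimensional quotient vanish, so that the same state sum,
    expanded in [h] and [u = log x], has [J(n; exp h)] as its restriction to [u = n h].  The
    Melvin-Morton-Rozansky expansion determines the latter expansion, hence the rational
    function, hence the former.

    The colored Jones polynomials are Markov invariant; the reduced trace is a scalar because
    the [R]-matrix commutes with the raising operator.  So they, then the rational functions
    for all [j], and finally the trace itself only depend on the knot. *)
Require Import Defs.
From HB Require Import structures.
From Stdlib Require Import Relations.
From mathcomp Require Import all_boot all_order all_algebra all_fingroup.
From mathcomp Require Import mpoly.
From mathcomp Require Import ring lra zify.
Set Implicit Arguments. Unset Strict Implicit. Unset Printing Implicit Defensive.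
Import Order.TTheory GRing.Theory Num.Theory.
Local Open Scope ring_scope.

(** * Laurent polynomials *)

(** The state sum converges at [y = 0] and at [y = 1] for unrelated reasons, so the two expansions
    cannot be compared term by term. Near [y = 0] the flux bound makes the part of weight [W]
    divisible by [y^(2W)]. At [y = 1] the only small factors are the [k] factors
    [1 - x^(-1) q^(j+l)] of each crossing, which vanish at [u = h = 0]; since every strand of a knot
    is joined to the open one, which is empty, a large weight forces many staying particles and
    hence a high order of vanishing. Both sums come from one series graded by weight, with
    coefficients in [rat[y]], and from one polynomial [d] in the weight variable that clears its
    denominators. Setting that variable to 1 is legitimate for either grading once [d] is nonzero
    there, which order [h^0] forces. The weight [1 - y^2] of a staying particle at [h = 0] is split
    into two kinds of weight [1] and [- y^2], whence four variables per crossing. The trace is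
    recovered from its [h]-expansion because each power of [x] carries a polynomial in [q]. *)

Section LaurentFunctionals.
Variable R : comNzRingType.
Implicit Types (f g : int -> int -> R) (p r : lpoly).

(** Coefficients, evaluations, Taylor coefficients and restrictions to [t = s^m] are all of this
    form, so that an identity checked by evaluation passes to each of them through [lpoly_ext]. *)
Definition lsum f p : R := \sum_(m <- p) f m.2.1 m.2.2 *~ m.1.

Lemma lsum_ladd f p r : lsum f (ladd p r) = lsum f p + lsum f r.
Proof. by rewrite /lsum /ladd big_cat. Qed.

Lemma lsum_lmono f c a b : lsum f (lmono c a b) = f a b *~ c.
Proof. by rewrite /lsum /lmono big_seq1. Qed.

Lemma lsum_eq f g p :
  (forall m, m \in p -> f m.2.1 m.2.2 = g m.2.1 m.2.2) -> lsum f p = lsum g p.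
Proof. by move=> fg; rewrite /lsum; apply: eq_big_seq => m /fg ->. Qed.

(** The hypothesis is a coproduct of [f] on exponents: one term for characters, several for Taylor
    coefficients, where it is the Leibniz rule. *)
Lemma lsum_lmul (I : finType) f (g h : I -> int -> int -> R) p r :
  (forall m1 m2, m1 \in p -> m2 \in r ->
     f (m1.2.1 + m2.2.1) (m1.2.2 + m2.2.2) =
     \sum_i g i m1.2.1 m1.2.2 * h i m2.2.1 m2.2.2) ->
  lsum f (lmul p r) = \sum_i lsum (g i) p * lsum (h i) r.
Proof.
move=> fgh; rewrite /lsum /lmul big_allpairs_dep.
under [RHS]eq_bigr => i _ do rewrite big_distrlr /=.
rewrite [RHS]exchange_big /=; apply: eq_big_seq => m1 m1p.
rewrite exchange_big /=; apply: eq_big_seq => m2 m2r /=.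
rewrite fgh // mulrz_suml; apply: eq_bigr => i _.
by rewrite mulrzAl mulrzAr -mulrzA [m2.1 * _]mulrC.
Qed.

Lemma lsum_lmul1 f p r :
  (forall a b a' b', f (a + a') (b + b') = f a b * f a' b') ->
  lsum f (lmul p r) = lsum f p * lsum f r.
Proof.
move=> fM; rewrite (@lsum_lmul 'I_1 f (fun=> f) (fun=> f)) ?big_ord1 //.
by move=> m1 m2 _ _; rewrite big_ord1 fM.
Qed.

Lemma lsum_mull c f p : lsum (fun a b => c * f a b) p = c * lsum f p.
Proof. by rewrite /lsum mulr_sumr; apply: eq_bigr => m _; rewrite mulrzAr. Qed.

Lemma lsum_sum (I : Type) (s : seq I) (F : I -> int -> int -> R) p :
  lsum (fun a b => \sum_(i <- s) F i a b) p = \sum_(i <- s) lsum (F i) p.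
Proof.
rewrite /lsum exchange_big /=; apply: eq_bigr => m _.
by rewrite mulrz_suml.
Qed.

End LaurentFunctionals.

Lemma lcoef_lsum p a b :
  lcoef p a b = lsum (fun a' b' => ((a', b') == (a, b))%:R : int) p.
Proof.
rewrite /lcoef /lsum big_mkcond; apply: eq_bigr => -[c [a' b']] _ /=.
by case: eqP => _; rewrite ?mul0rz // -mulrzr mul1r intz.
Qed.

Lemma mem_lmul (P Q S : int * int -> Prop) p r :
  (forall m, m \in p -> P m.2) -> (forall m, m \in r -> Q m.2) ->
  (forall u v, P u -> Q v -> S (u.1 + v.1, u.2 + v.2)) ->
  forall m, m \in lmul p r -> S m.2.
Proof.
by move=> Pp Qr PQ m /allpairsP[[m1 m2] [/= /Pp P1 /Qr Q2 ->]] /=; apply: (PQ _ _ P1 Q2).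
Qed.

(** Taylor coefficients: [ehalf a j] is the coefficient of [h^j] in [exp (a h / 2)]. *)
Definition ehalf (a : int) (j : nat) : rat := (a%:~R / 2) ^+ j / j`!%:R.

Lemma ehalf0 a : ehalf a 0 = 1.
Proof. by rewrite /ehalf expr0 fact0 divr1. Qed.

Lemma ehalf00 j : ehalf 0 j = (j == 0%N)%:R.
Proof. by rewrite /ehalf mul0r expr0n; case: eqP => [->|]; rewrite ?mul0r // fact0 divr1. Qed.

Lemma fact_rat_neq0 n : (n`!)%:R != 0 :> rat.
Proof. by rewrite pnatr_eq0 -lt0n fact_gt0. Qed.

Lemma expD_fact (x y : rat) n :
  (x + y) ^+ n / n`!%:R =
  \sum_(i < n.+1) (x ^+ i / i`!%:R) * (y ^+ (n - i) / (n - i)`!%:R).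
Proof.
rewrite addrC exprDn mulr_suml; apply: eq_bigr => -[i ltin] _ /=.
have lein : (i <= n)%N by [].
rewrite -mulr_natr; have /(congr1 (fun k => k%:R : rat)) := bin_fact lein.
rewrite !natrM => <-.
have h1 := fact_rat_neq0 i; have h2 := fact_rat_neq0 (n - i).
have h3 : ('C(n, i))%:R != 0 :> rat by rewrite pnatr_eq0 -lt0n bin_gt0.
by field; rewrite h1 h2 h3.
Qed.

Lemma ehalfD a b j : ehalf (a + b) j = \sum_(i < j.+1) ehalf a i * ehalf b (j - i).
Proof. by rewrite /ehalf -expD_fact intrD mulrDl. Qed.

Section Determination.

Definition lev (s t : rat) : lpoly -> rat := lsum (fun a b => s ^ a * t ^ b).

Lemma lev_ladd s t p r : lev s t (ladd p r) = lev s t p + lev s t r.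
Proof. exact: lsum_ladd. Qed.

Lemma lev_lmono s t c a b : lev s t (lmono c a b) = c%:~R * s ^ a * t ^ b.
Proof. by rewrite /lev lsum_lmono -mulrzl mulrA. Qed.

Lemma lev_lmul s t p r : s != 0 -> t != 0 -> lev s t (lmul p r) = lev s t p * lev s t r.
Proof.
move=> s0 t0; apply: lsum_lmul1 => a b a' b'; rewrite !expfzDr //; ring.
Qed.

Definition lbound (p : lpoly) : nat := sumn [seq (absz m.2.1 + absz m.2.2)%N | m <- p].

Lemma lboundP p m : m \in p -> (absz m.2.1 <= lbound p)%N /\ (absz m.2.2 <= lbound p)%N.
Proof.
rewrite /lbound; elim: p => //= m' p IH; rewrite inE => /predU1P[->|/IH[? ?]]; split; lia.
Qed.

Lemma poly_vanish_geq2 (P : {poly rat}) : (forall n : nat, (1 < n)%N -> P.[n%:R] = 0) -> P = 0.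
Proof.
move=> P0; apply/eqP/negPn/negP => Pn0.
pose rs := [seq (i%:R : rat) | i <- iota 2 (size P)].
have rs_root : all (root P) rs.
  by apply/allP => x /mapP[i]; rewrite mem_iota => /andP[i2 _] ->; rewrite /root P0.
have rs_uniq : uniq rs.
  by rewrite map_inj_uniq ?iota_uniq // => i j ij; apply/eqP; rewrite -(eqr_nat rat) ij.
by have := max_poly_roots Pn0 rs_root rs_uniq; rewrite size_map size_iota ltnn.
Qed.

(** Substituting [t = s ^ B] with [B] large separates all the exponents that occur. *)
Lemma lpoly_ext (R : comNzRingType) (f : int -> int -> R) p r :
  (forall s t : rat, 1 < s -> 1 < t -> lev s t p = lev s t r) -> lsum f p = lsum f r.
Proof.
move=> E; set d := p ++ [seq (- m.1, m.2) | m <- r].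
have lsum_d (S : comNzRingType) (h : int -> int -> S) : lsum h d = lsum h p - lsum h r.
  rewrite /lsum /d big_cat big_map /= -sumrN; congr (_ + _).
  by apply: eq_bigr => m _; rewrite mulrNz.
apply/eqP; rewrite -subr_eq0 -lsum_d; apply/eqP.
pose N := lbound d; pose B := N.*2.+1.
pose e (m : int * (int * int)) : nat := (absz (m.2.1 + N%:Z)%R + B * absz (m.2.2 + N%:Z)%R)%N.
have ab_e m : m \in d -> m.2.1 = Posz (e m %% B)%N - N%:Z /\ m.2.2 = Posz (e m %/ B)%N - N%:Z.
  move=> /lboundP[]; rewrite -/N => aN bN.
  have ltB (a : int) (n : nat) : (absz a <= n)%N -> (absz (a + n%:Z)%R < n.*2.+1)%N by lia.
  have absK (a : int) (n : nat) : (absz a <= n)%N -> a = Posz (absz (a + n%:Z)%R) - n%:Z by lia.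
  have lt := ltB _ _ aN.
  rewrite /e mulnC addnC modnMDl divnMDl // modn_small // divn_small // addn0; by split; apply: absK.
pose D : {poly rat} := \sum_(m <- d) (m.1)%:~R *: 'X^(e m).
have D0 : D = 0.
  apply: poly_vanish_geq2 => n n1.
  have n0 : n%:R != 0 :> rat by rewrite pnatr_eq0; lia.
  transitivity ((n%:R) ^ (N%:Z + B%:Z * N%:Z) * lev n%:R (n%:R ^ B%:Z) d).
    rewrite /D horner_sum /lev /lsum mulr_sumr; apply: eq_big_seq => mo md.
    rewrite hornerZ hornerXn mulrzl mulrzAr; congr (_ *~ _).
    rewrite exprz_exp -!expfzDr // exprnP; congr (_ ^ _).
    have absD (a : int) (k : nat) : (absz a <= k)%N -> Posz (absz (a + k%:Z)%R) = a + k%:Z by lia.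
    have [aN bN] := lboundP md.
    by rewrite /e PoszD PoszM !absD //; ring.
  rewrite /lev lsum_d -/(lev _ _ _) -/(lev _ _ _) E ?subrr ?mulr0 //.
    by rewrite ltr1n.
  by rewrite -exprnP exprn_egt1 // ltr1n.
have coefD m0 : \sum_(m <- d | e m == m0) m.1 = 0.
  have /eqP := congr1 (fun P : {poly rat} => P`_m0) D0.
  rewrite coef0 /D coef_sum; under eq_bigr => m _ do rewrite coefZ coefXn.
  rewrite (bigID (fun m => e m == m0)) /= [X in _ + X]big1 ?addr0 => [|m]; last first.
    by rewrite eq_sym => /negPf ->; rewrite mulr0.
  under eq_bigr => m /eqP -> do rewrite eqxx mulr1.
  by rewrite -rmorph_sum intr_eq0 => /eqP.
pose h (k : nat) := f (Posz (k %% B)%N - N%:Z) (Posz (k %/ B)%N - N%:Z).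
transitivity (\sum_(m <- d) h (e m) *~ m.1).
  by apply: eq_big_seq => m /ab_e[ma mb]; rewrite /h -ma -mb.
have [M Mb] : exists M, forall m, m \in d -> (e m < M)%N.
  exists (\max_(m <- d) (e m)).+1 => m md; rewrite ltnS.
  by rewrite (big_rem m) //= leq_maxl.
transitivity (\sum_(k < M) \sum_(m <- d | e m == k) h k *~ m.1); last first.
  by rewrite big1 // => k _; rewrite -mulrz_sumr coefD mulr0z.
rewrite (exchange_big_dep xpredT) //= big_seq [RHS]big_seq; apply: eq_bigr => m md.
by rewrite (big_pred1 (Ordinal (Mb _ md))) // => k /=; rewrite eq_sym.
Qed.

End Determination.

(** * The R-matrix in terms of q and s/t *)

Section QBinomial.
Variables (R : comNzRingType) (q : R).

Fixpoint gbin n k : R :=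
  match n, k with
  | _, 0%N => 1
  | 0%N, _.+1 => 0
  | n'.+1, k'.+1 => gbin n' k' + q ^+ k'.+1 * gbin n' k'.+1
  end.

Definition qfact n : R := \prod_(i < n) (1 - q ^+ i.+1).

Definition qpoch (a : R) k : R := \prod_(l < k) (1 - a * q ^+ l).

Lemma gbin0 n : gbin n 0 = 1. Proof. by case: n. Qed.

Lemma gbinS n k : gbin n.+1 k.+1 = gbin n k + q ^+ k.+1 * gbin n k.+1.
Proof. by []. Qed.

Lemma gbin_small n k : (n < k)%N -> gbin n k = 0.
Proof.
elim: n k => [|n IH] [|k] //= nk; rewrite !IH ?mulr0 ?addr0 //; exact: ltnW.
Qed.

Lemma gbinn n : gbin n n = 1.
Proof. by elim: n => //= n ->; rewrite gbin_small // mulr0 addr0. Qed.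

Lemma qfactS n : qfact n.+1 = qfact n * (1 - q ^+ n.+1).
Proof. by rewrite /qfact big_ord_recr. Qed.

Lemma qpochS a k : qpoch a k.+1 = qpoch a k * (1 - a * q ^+ k).
Proof. by rewrite /qpoch big_ord_recr. Qed.

Lemma qpochSl a k : qpoch a k.+1 = (1 - a) * qpoch (a * q) k.
Proof.
rewrite /qpoch big_ord_recl expr0 mulr1; congr (_ * _); apply: eq_bigr => l _.
by rewrite exprS mulrA.
Qed.

Lemma qpochD a k m : qpoch a (k + m) = qpoch a k * qpoch (a * q ^+ k) m.
Proof.
elim: m => [|m IH]; first by rewrite addn0 /qpoch big_ord0 mulr1.
by rewrite addnS !qpochS IH exprD; ring.
Qed.

Lemma qpoch0 a : qpoch a 0 = 1. Proof. by rewrite /qpoch big_ord0. Qed.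

Lemma qfact0 : qfact 0 = 1. Proof. by rewrite /qfact big_ord0. Qed.

Lemma gbin_fact m k : gbin (m + k) k * (qfact k * qfact m) = qfact (m + k).
Proof.
elim: m k => [|m IHm] k.
  by rewrite add0n gbinn qfact0 mulr1 mul1r.
elim: k => [|k IHk]; first by rewrite addn0 gbin0 qfact0 !mul1r.
rewrite addnS gbinS mulrDl.
have -> : q ^+ k.+1 * gbin (m.+1 + k) k.+1 * (qfact k.+1 * qfact m.+1) =
  q ^+ k.+1 * (1 - q ^+ m.+1) * qfact (m.+1 + k).
  by rewrite addSnnS -IHm (qfactS m); ring.
have -> : gbin (m.+1 + k) k * (qfact k.+1 * qfact m.+1) =
  (1 - q ^+ k.+1) * qfact (m.+1 + k).
  by rewrite -IHk (qfactS k); ring.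
by rewrite (qfactS (m.+1 + k)) -addnS exprD; ring.
Qed.

Lemma gbinS' n k : gbin n.+1 k.+1 = q ^+ (n - k) * gbin n k + gbin n k.+1.
Proof.
elim: n k => [|n IH] [|k].
- by rewrite gbinS gbin0 expr0 !(@gbin_small 0 1) // mulr0 mul1r.
- by rewrite !gbin_small // mulr0 addr0.
- have E1 := gbinS n.+1 0; have E2 := IH 0%N; have E3 := gbinS n 0.
  rewrite !gbin0 !subn0 expr1 in E1 E2 E3 *.
  by rewrite E1 {1}E2 E3 exprS; ring.
rewrite subSS gbinS {1}(IH k) {1}(IH k.+1) (gbinS n k) (gbinS n k.+1).
have [nk|kn] := leqP n k.
  by rewrite (@gbin_small n k.+1) //; ring.
by rewrite (_ : (n - k)%N = (n - k.+1).+1) ?exprS; [ring | lia].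
Qed.

(** The induction removes the first factor [1 - a], which turns [a] into [a * q]; the two resulting
    sums recombine by the [q]-Pascal rule. *)
Lemma qbinomial_theorem a k :
  qpoch a k = \sum_(m < k.+1) (-1) ^+ m * q ^+ 'C(m, 2) * gbin k m * a ^+ m.
Proof.
elim: k a => [|k IH] a; first by rewrite qpoch0 big_ord1 /= !mulr1.
rewrite qpochSl IH [RHS]big_ord_recl /= expr0 !mulr1.
under [X in _ = _ + X]eq_bigr => m _.
  rewrite /bump /= add1n binS bin1 mulrDr mulrDl; over.
rewrite big_split /= addrCA addrC mulrBl mul1r; congr (_ + _).
  transitivity (\sum_(m < k.+2) (-1) ^+ m * q ^+ 'C(m, 2) * gbin k m * (a * q) ^+ m).
    by rewrite [RHS]big_ord_recr /= gbin_small ?mulr0 ?mul0r ?addr0.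
  rewrite big_ord_recl /= gbin0 !mulr1; congr (_ + _); apply: eq_bigr => m _.
  by rewrite /bump /= add1n binS bin1 exprMn; ring.
rewrite mulr_sumr -sumrN; apply: eq_bigr => m _.
by rewrite exprMn exprS exprS exprD; ring.
Qed.

End QBinomial.

Lemma lev_gauss s t n k : s != 0 -> t != 0 -> lev s t (gauss n k) = gbin (s ^+ 2) n k.
Proof.
move=> s0 t0; elim: n k => [|n IH] [|k].
- by rewrite /= /lone lev_lmono !expr0z !mulr1.
- by rewrite /= /lev /lsum big_nil.
- by rewrite /= /lone lev_lmono !expr0z !mulr1.
rewrite [gauss _ _]/= lev_ladd lev_lmul // lev_lmono !IH expr0z mul1r mulr1.
by rewrite -exprnP exprM.
Qed.

Lemma lev_lprod s t ps : s != 0 -> t != 0 -> lev s t (lprod ps) = \prod_(p <- ps) lev s t p.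
Proof.
move=> s0 t0; elim: ps => [|p ps IH]; first by rewrite big_nil /= /lone lev_lmono !expr0z !mulr1.
by rewrite big_cons /= lev_lmul // IH.
Qed.

(** In terms of [q = s^2] and [z = s/t] the [R]-matrix has no half-integral powers. *)
Definition rmx (R : comNzRingType) (q z : R) i j k : R :=
  gbin q i k * q ^+ ((i - k) * j) * z ^+ (1 + (i - k) + j) * qpoch q (z ^+ 2 * q ^+ j) k.

Lemma lev_Rcoef s t i j k : s != 0 -> t != 0 ->
  lev s t (Rcoef i j k) = rmx (s ^+ 2) (s / t) i j k.
Proof.
move=> s0 t0; rewrite /Rcoef lev_lprod // !big_cons big_nil mulr1 lev_lmono /qbin lev_lmul //.
rewrite lev_lmono lev_gauss // lev_lprod // big_map.
have -> : \prod_(l <- iota 1 k) lev s t (ladd lone (lmono (-1) (Posz (2 * (j + l))) (-2))) =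
   qpoch (s ^+ 2) ((s / t) ^+ 2 * (s ^+ 2) ^+ j) k.
  rewrite /qpoch -[1%N]/(1 + 0)%N iotaDl big_map.
  rewrite -(big_mkord xpredT (fun l => 1 - (s / t) ^+ 2 * (s ^+ 2) ^+ j * (s ^+ 2) ^+ l)).
  rewrite /index_iota subn0; apply: eq_bigr => l _; rewrite lev_ladd /lone !lev_lmono !expr0z !mulr1; congr (_ + _).
  rewrite -exprnP -[t ^ (-2)]/(t ^- 2) mulN1r mulNr; congr (- _).
  rewrite (_ : (2 * (j + (1 + l)) = 2 + 2 * j + 2 * l)%N); last lia.
  by rewrite exprMn exprVn (exprD s (2 + 2 * j)) (exprD s 2) (exprM s 2 j) (exprM s 2 l); ring.
rewrite /rmx mulrA; congr (_ * _); rewrite !mul1r expr0z mulr1.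
rewrite (_ : (2 * (i - k) * j + (i - k) * k + (i - k) + j + 1 =
  2 * ((i - k) * j) + (1 + (i - k) + j) + k * (i - k))%N); last lia.
rewrite -exprnP -!exprnN [s ^+ (_ + k * _)]exprD (exprD s (2 * _)) (exprM s 2) (exprMn _ s t^-1) exprVn.
have h1 : s ^+ (k * (i - k)) != 0 by rewrite expf_neq0.
have h2 : t ^+ (1 + (i - k) + j) != 0 by rewrite expf_neq0.
by field; rewrite h1 h2.
Qed.

(** * Free state sums *)

Lemma compsS n s :
  comps n.+1 s = [seq x :: c | x <- iota 0 s.+1, c <- comps n (s - x)%N].
Proof. by []. Qed.

Lemma mem_comps n s c : (c \in comps n s) = (size c == n) && (sumn c == s).
Proof.
elim: n s c => [|n IH] s c; first by case: s c => [|s] [|a c].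
rewrite compsS; apply/allpairsPdep/andP => [[a [d []]]|].
  rewrite mem_iota add0n ltnS => /= les; rewrite IH => /andP[/eqP <- /eqP ds] ->.
  by rewrite /= ds subnKC ?eqxx.
case: c => [|a c] [] /eqP // [sc] /eqP <-.
exists a, c; split=> //; first by rewrite mem_iota /=; lia.
by rewrite IH sc /= addKn !eqxx.
Qed.

Lemma uniq_comps n s : uniq (comps n s).
Proof.
elim: n s => [|n IH] s; first by rewrite /=; case: ifP.
rewrite compsS; apply: allpairs_uniq_dep; rewrite ?iota_uniq //.
by move=> [a c] [b d] _ _ /= [-> ->].
Qed.

Lemma sumn_incr_nth c i : sumn (incr_nth c i) = (sumn c).+1.
Proof.
elim: c i => [|a c IH] [|i] //=; rewrite ?IH ?addnS //.
by elim: i => //= i ->.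
Qed.

Lemma nth_inj_size (c d : seq nat) :
  size c = size d -> (forall i, nth 0%N c i = nth 0%N d i) -> c = d.
Proof. by move=> sz h; apply: (@eq_from_nth _ 0%N). Qed.

Lemma incr_nth_pred n s c d : (d < n)%N -> c \in comps n s.+1 -> (0 < nth 0%N c d)%N ->
  exists2 c', c' \in comps n s & c = incr_nth c' d.
Proof.
rewrite mem_comps => dn /andP[/eqP sc /eqP sumc] c0.
have E : c = incr_nth (set_nth 0%N c d (nth 0%N c d).-1) d.
  apply: nth_inj_size => [|i].
    by rewrite size_incr_nth size_set_nth sc (maxn_idPr dn) dn.
  by rewrite nth_incr_nth nth_set_nth /= eq_sym; case: eqP => [->|]; lia.
exists (set_nth 0%N c d (nth 0%N c d).-1) => //.
rewrite mem_comps size_set_nth sc (maxn_idPr dn) eqxx /=.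
by rewrite E sumn_incr_nth in sumc; apply/eqP; lia.
Qed.

(** Adding a particle at [d] is a bijection onto the configurations occupied at [d]; annihilation is
    reindexed this way below. *)
Lemma big_comps_incr (V : nmodType) n s d (F : seq nat -> V) : (d < n)%N ->
  \sum_(c <- comps n s.+1 | (0 < nth 0%N c d)%N) F c =
  \sum_(c <- comps n s) F (incr_nth c d).
Proof.
move=> dn; rewrite -big_filter -[RHS](big_map (incr_nth ^~ d) xpredT).
apply: perm_big; apply: uniq_perm; rewrite ?filter_uniq ?uniq_comps //.
  rewrite map_inj_in_uniq ?uniq_comps // => x y.
  rewrite !mem_comps => /andP[/eqP sx _] /andP[/eqP sy _] /(congr1 (nth 0%N)) exy.
  apply: nth_inj_size => [|i]; first by rewrite sx.
  by have := congr1 (@^~ i) exy; rewrite !nth_incr_nth => /addnI.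
move=> c; rewrite mem_filter; apply/andP/mapP => [[c0 cc]|[c' cc' ->]].
  by have [c' ? ?] := incr_nth_pred dn cc c0; exists c'.
rewrite nth_incr_nth eqxx; split=> //.
move: cc'; rewrite !mem_comps size_incr_nth sumn_incr_nth => /andP[/eqP -> /eqP ->].
by rewrite dn !eqxx.
Qed.

Lemma size_step g c k : (g.+1 < size c)%N -> size (step g c k) = size c.
Proof. by move=> h; rewrite /step !size_set_nth; lia. Qed.

Lemma nth_step g c k i : nth 0%N (step g c k) i =
  if i == g.+1 then (nth 0%N c g - k)%N else
  if i == g then (nth 0%N c g.+1 + k)%N else nth 0%N c i.
Proof. by rewrite /step !nth_set_nth /= !nth_set_nth. Qed.

Lemma size_incr_lt c i : (i < size c)%N -> size (incr_nth c i) = size c.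
Proof. by rewrite size_incr_nth => ->. Qed.

Lemma step_incr_far g c k a : (g.+1 < size c)%N -> (a < size c)%N ->
  a != g -> a != g.+1 -> step g (incr_nth c a) k = incr_nth (step g c k) a.
Proof.
move=> gc ac /negPf ag /negPf ag1; apply: nth_inj_size => [|i].
  by rewrite size_step !size_incr_lt ?size_step.
rewrite nth_incr_nth !nth_step !nth_incr_nth ag ag1 !add0n.
by case: eqP => [->|_]; [rewrite ag1|case: eqP => [->|_] //; rewrite ag].
Qed.

(** Here and in the next two lemmas: an added right particle crosses to [g]; an added left one stays
    at [g] if the number of staying particles grows with it, and otherwise crosses to [g.+1]. *)
Lemma step_incr_right g c k : (g.+1 < size c)%N ->
  step g (incr_nth c g.+1) k = incr_nth (step g c k) g.
Proof.
move=> gc; apply: nth_inj_size => [|i].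
  by rewrite size_step !size_incr_lt ?size_step //; apply: ltnW.
rewrite nth_incr_nth !nth_step !nth_incr_nth eqxx.
by do !case: eqP => //; lia.
Qed.

Lemma step_incr_stay g c k : (g.+1 < size c)%N ->
  step g (incr_nth c g) k.+1 = incr_nth (step g c k) g.
Proof.
move=> gc; apply: nth_inj_size => [|i].
  by rewrite size_step !size_incr_lt ?size_step //; apply: ltnW.
rewrite nth_incr_nth !nth_step !nth_incr_nth eqxx.
by do !case: eqP => //; lia.
Qed.

Lemma step_incr_cross g c k : (g.+1 < size c)%N -> (k <= nth 0%N c g)%N ->
  step g (incr_nth c g) k = incr_nth (step g c k) g.+1.
Proof.
move=> gc kc; apply: nth_inj_size => [|i].
  by rewrite size_step !size_incr_lt ?size_step //; apply: ltnW.
rewrite nth_incr_nth !nth_step !nth_incr_nth eqxx.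
by do !case: eqP => //; lia.
Qed.

(** [wt o i j k] is the local weight at the [o]-th crossing. *)
Fixpoint gop (A : pzRingType) (wt : nat -> nat -> nat -> nat -> A) (w : seq nat)
    (f : seq nat -> A) (c : seq nat) : A :=
  match w with
  | [::] => f c
  | g :: w' => \sum_(k < (nth 0%N c g).+1)
      wt 0%N (nth 0%N c g) (nth 0%N c g.+1) k * gop (fun o => wt o.+1) w' f (step g c k)
  end.

Lemma eq_gop (A : pzRingType) (wt : nat -> nat -> nat -> nat -> A) w f h c :
  all (fun g => g.+1 < size c)%N w ->
  (forall e, size e = size c -> f e = h e) -> gop wt w f c = gop wt w h c.
Proof.
elim: w wt c => [|g w IH] wt c /= => [_ -> //|/andP[gc wc] fh].
apply: eq_bigr => k _; congr (_ * _).
by apply: IH => [|e]; rewrite size_step // => /fh.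
Qed.

Lemma gop_eq0 (A : pzRingType) (wt : nat -> nat -> nat -> nat -> A) w f c :
  all (fun g => g.+1 < size c)%N w ->
  (forall e, size e = size c -> f e = 0) -> gop wt w f c = 0.
Proof.
elim: w wt c => [|g w IH] wt c /= => [_ -> //|/andP[gc wc] f0].
by rewrite big1 // => k _; rewrite IH ?mulr0 // => [|e]; rewrite size_step // => /f0.
Qed.

(** A local weight of this shape lets each of the [i] left particles stay ([ga]) or cross
    ([al]), and makes each of the [j] right ones cross ([be]). *)
Definition freewt (A : pzRingType) (al be ga : nat -> A) o i j k : A :=
  'C(i, k)%:R * (al o ^+ (i - k) * be o ^+ j * ga o ^+ k).

Lemma sum_binS (A : pzRingType) i (F : nat -> A) :
  \sum_(k < i.+2) 'C(i.+1, k)%:R * F k =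
  \sum_(k < i.+1) 'C(i, k)%:R * F k.+1 + \sum_(k < i.+1) 'C(i, k)%:R * F k.
Proof.
rewrite big_ord_recl bin0 /= [X in _ = _ + X]big_ord_recl bin0 addrCA; congr (_ + _).
under eq_bigr => k _ do rewrite /bump /= add1n binS natrD mulrDl addrC.
rewrite big_split /=; congr (_ + _); rewrite big_ord_recr /= bin_small // mul0r addr0.
by apply: eq_bigr => k _; rewrite /bump /= add1n.
Qed.

Section FreeParticles.
Variable A : comNzRingType.
Variable n : nat.
Implicit Types (al be ga : nat -> A).

(** One-particle transfer matrix of a crossing, from the incoming position (row) to the outgoing one
    (column). *)
Definition hopmx (a b g' : A) (g : nat) : 'M[A]_n.+1 :=
  \matrix_(r, c) (if (r == g :> nat) then
                    (if c == g :> nat then g' else if c == g.+1 :> nat then a else 0)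
                  else if r == g.+1 :> nat then (if c == g :> nat then b else 0)
                  else (r == c)%:R).

Fixpoint hopword al be ga (w : seq nat) : 'M[A]_n.+1 :=
  match w with
  | [::] => 1%:M
  | g :: w' => hopmx (al 0%N) (be 0%N) (ga 0%N) g *m
      hopword (fun o => al o.+1) (fun o => be o.+1) (fun o => ga o.+1) w'
  end.

(** Free particles do not interact, so an extra incoming particle amounts to a sum over its own
    outgoing position. For a particle at [g] this is Pascal's rule, whose two terms are staying and
    crossing. *)
Lemma cross_incr al be ga g (f : seq nat -> A) c (a : 'I_n.+1) :
  (g < n)%N -> size c = n.+1 ->
  let X h d := \sum_(k < (nth 0%N d g).+1)
      freewt al be ga 0%N (nth 0%N d g) (nth 0%N d g.+1) k * h (step g d k) in
  X f (incr_nth c a) =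
  \sum_(b < n.+1) hopmx (al 0%N) (be 0%N) (ga 0%N) g a b * X (fun e => f (incr_nth e b)) c.
Proof.
move=> gn sc X.
have gc : (g.+1 < size c)%N by rewrite sc.
have ac : (a < size c)%N by rewrite sc.
have e1 : (g == g.+1) = false by lia.
have e2 : (g.+1 == g) = false by lia.
pose g0 : 'I_n.+1 := Ordinal (ltnW gn : g < n.+1)%N.
pose g1 : 'I_n.+1 := @Ordinal n.+1 g.+1 gn.
have [ag|ag] := eqVneq (a : nat) g.
  rewrite (bigD1 g0) //= (bigD1 g1) /=; last by rewrite -val_eqE /=; lia.
  rewrite big1 ?addr0; last first.
    move=> b /andP[]; rewrite -!val_eqE /= => /negPf b0 /negPf b1.
    by rewrite mxE ag eqxx b0 b1 mul0r.
  rewrite !mxE /= ag !eqxx e2 /X !nth_incr_nth eqxx e1 add0n add1n.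
  set i := nth 0%N c g; set j := nth 0%N c g.+1.
  rewrite /freewt; under eq_bigr => k _ do rewrite -mulrA.
  rewrite (sum_binS i (fun k => al 0%N ^+ (i.+1 - k) * be 0%N ^+ j * ga 0%N ^+ k *
                                f (step g (incr_nth c g) k))) !mulr_sumr.
  congr (_ + _); apply: eq_bigr => -[k /= ki] _.
    by rewrite step_incr_stay // subSS exprS; ring.
  by rewrite step_incr_cross // subSn // exprS; ring.
have [ag1|ag1] := eqVneq (a : nat) g.+1.
  rewrite (bigD1 g0) //= big1 ?addr0; last first.
    move=> b; rewrite -!val_eqE /= => /negPf b0.
    by rewrite mxE ag1 eqxx b0 e2 mul0r.
  rewrite mxE ag1 /= !eqxx e2 /X !nth_incr_nth eqxx e2.
  rewrite add0n add1n mulr_sumr; apply: eq_bigr => -[k /= ki] _.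
  by rewrite step_incr_right // /freewt exprS; ring.
rewrite (bigD1 a) //= big1 ?addr0; last first.
  move=> b; rewrite eq_sym -!val_eqE /= => /negPf ba.
  by rewrite mxE (negPf ag) (negPf ag1) -val_eqE /= ba mul0r.
rewrite mxE (negPf ag) (negPf ag1) eqxx mul1r /X !nth_incr_nth (negPf ag) (negPf ag1) !add0n.
by apply: eq_bigr => k _; rewrite step_incr_far.
Qed.

Lemma gop_incr al be ga (w : seq nat) (f : seq nat -> A) c (a : 'I_n.+1) :
  all (fun g => g < n)%N w -> size c = n.+1 ->
  gop (freewt al be ga) w f (incr_nth c a) =
  \sum_(b < n.+1) hopword al be ga w a b *
    gop (freewt al be ga) w (fun e => f (incr_nth e b)) c.
Proof.
elim: w al be ga c a => [|g w IH] al be ga c a /=.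
  move=> _ _; rewrite (bigD1 a) //= mxE eqxx mul1r big1 ?addr0 // => b.
  by rewrite eq_sym mxE => /negPf ->; rewrite mul0r.
case/andP=> gn wn sc; have gc : (g.+1 < size c)%N by rewrite sc.
rewrite (cross_incr al be ga (gop (freewt (fun o => al o.+1) (fun o => be o.+1)
  (fun o => ga o.+1)) w f) a gn sc).
under [RHS]eq_bigr => b _ do rewrite mxE mulr_suml.
rewrite [RHS]exchange_big /=; apply: eq_bigr => d _.
under [RHS]eq_bigr => b _ do rewrite -mulrA.
rewrite -mulr_sumr; congr (_ * _).
under [RHS]eq_bigr => b _ do rewrite mulr_sumr.
rewrite [RHS]exchange_big /=; apply: eq_bigr => k _.
rewrite IH ?size_step // mulr_sumr; apply: eq_bigr => b _.
by rewrite mulrCA.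
Qed.

End FreeParticles.

(** * Power series as coefficient sequences, and MacMahon's master theorem *)

Section SeriesAction.
Variable A : comNzRingType.
Implicit Types (p q : {poly A}) (S T : nat -> A).

Definition smul p S w : A := \sum_(i < w.+1) p`_i * S (w - i)%N.

Lemma smul_trunc p S m w : (w < m)%N -> smul p S w = (p * \poly_(i < m) S i)`_w.
Proof.
move=> wm; rewrite coefM; apply: eq_bigr => -[i iw] _ /=.
by rewrite coef_poly ifT //; lia.
Qed.

Lemma smulM p q S w : smul (p * q) S w = smul p (smul q S) w.
Proof.
rewrite (smul_trunc _ _ (ltnSn w)) -mulrA coefM; apply: eq_bigr => -[i iw] _ /=.
by rewrite -smul_trunc //; lia.
Qed.

Lemma eq_smul p S T w : (forall i, (i <= w)%N -> S i = T i) -> smul p S w = smul p T w.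
Proof. by move=> ST; apply: eq_bigr => i _; rewrite ST // leq_subr. Qed.

Lemma smulDl p q S w : smul (p + q) S w = smul p S w + smul q S w.
Proof. by rewrite /smul -big_split; apply: eq_bigr => i _; rewrite coefD mulrDl. Qed.

Lemma smulNl p S w : smul (- p) S w = - smul p S w.
Proof. by rewrite /smul -sumrN; apply: eq_bigr => i _; rewrite coefN mulNr. Qed.

Lemma smul_suml (I : Type) (r : seq I) (F : I -> {poly A}) S w :
  smul (\sum_(i <- r) F i) S w = \sum_(i <- r) smul (F i) S w.
Proof.
rewrite /smul exchange_big; apply: eq_bigr => i _ /=.
by rewrite coef_sum mulr_suml.
Qed.

Lemma smulDr p S T w : smul p (fun i => S i + T i) w = smul p S w + smul p T w.
Proof. by rewrite /smul -big_split; apply: eq_bigr => i _; rewrite mulrDr. Qed.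

Lemma smul_sumr (I : Type) (r : seq I) p (F : I -> nat -> A) w :
  smul p (fun v => \sum_(i <- r) F i v) w = \sum_(i <- r) smul p (F i) w.
Proof.
rewrite /smul exchange_big; apply: eq_bigr => i _ /=.
by rewrite mulr_sumr.
Qed.

Lemma smulZr p a S w : smul p (fun i => a * S i) w = a * smul p S w.
Proof. by rewrite /smul mulr_sumr; apply: eq_bigr => i _; rewrite mulrCA. Qed.

Lemma smulC a S w : smul a%:P S w = a * S w.
Proof.
rewrite /smul big_ord_recl coefC eqxx subn0 big1 ?addr0 // => i _.
by rewrite coefC mul0r.
Qed.

Lemma smulX0 p S : smul ('X * p) S 0 = 0.
Proof. by rewrite /smul big_ord1 coefXM mul0r. Qed.

Lemma smulXS p S w : smul ('X * p) S w.+1 = smul p S w.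
Proof.
rewrite /smul big_ord_recl coefXM eqxx mul0r add0r; apply: eq_bigr => i _.
by rewrite coefXM /= /bump add1n subSS.
Qed.

Lemma smul_derive p S w :
  smul ('X * p^`()) S w + smul p (fun i => i%:R * S i) w = w%:R * smul p S w.
Proof.
rewrite /smul mulr_sumr -big_split; apply: eq_bigr => -[i iw] _ /=.
have -> : ('X * p^`())`_i = i%:R * p`_i.
  by rewrite coefXM; case: i iw => [|i] _; rewrite ?mul0r // coef_deriv mulr_natl.
have -> : w%:R = i%:R + (w - i)%:R :> A by rewrite -natrD subnKC.
by ring.
Qed.

End SeriesAction.

Lemma deriv_prod (A : comNzRingType) (I : finType) (F : I -> {poly A}) :
  (\prod_i F i)^`() = \sum_i (F i)^`() * \prod_(j | j != i) F j.
Proof.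
suff gen (s : seq I) : uniq s -> (\prod_(i <- s) F i)^`() =
    \sum_(i <- s) (F i)^`() * \prod_(j <- s | j != i) F j.
  by rewrite -big_enum gen ?enum_uniq // big_enum; apply: eq_bigr => i _; rewrite big_enum_cond.
elim: s => [|a s IH] /=; first by rewrite !big_nil derivC.
case/andP=> as_ us; rewrite !big_cons derivM IH // eqxx /= mulr_sumr.
congr (_ * _ + _).
  rewrite [LHS]big_seq [RHS]big_seq_cond; apply: eq_bigl => j.
  by case: eqP => [->|]; rewrite ?andbT // (negPf as_).
apply: eq_big_seq => i si; rewrite big_cons ifT; first by rewrite mulrCA.
by apply: contraNneq as_ => ->.
Qed.

(** Jacobi's formula: differentiating the determinant row by row and expanding along the
    differentiated row of [R i] produces the cofactors. *)
Lemma deriv_det (A : comNzRingType) n (M : 'M[{poly A}]_n) :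
  (\det M)^`() = \tr (\adj M *m map_mx (@deriv A) M).
Proof.
pose R i := \matrix_(a, b) (if a == i then (M i b)^`() else M a b) : 'M[{poly A}]_n.
have Rdet i : \det (R i) = \sum_j (M i j)^`() * cofactor M i j.
  rewrite (expand_det_row _ i); apply: eq_bigr => j _; rewrite mxE eqxx; congr (_ * _).
  rewrite /cofactor; congr (_ * \det _); apply/matrixP => a b.
  by rewrite !mxE eq_sym (negPf (neq_lift i a)).
have -> : (\det M)^`() = \sum_i \det (R i).
  rewrite /determinant linear_sum exchange_big /=; apply: eq_bigr => s _.
  rewrite -signr_odd -!mulr_sumr.
  have -> : ((-1) ^+ (odd s) * \prod_i M i (s i))^`() = (-1) ^+ (odd s) * (\prod_i M i (s i))^`().
    by case: odd; rewrite ?expr1 ?expr0 ?mul1r // mulN1r derivN mulN1r.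
  congr (_ * _); rewrite deriv_prod; apply: eq_bigr => i _.
  rewrite [RHS](bigD1 i) //= mxE eqxx; congr (_ * _).
  by apply: eq_bigr => j /negPf ji; rewrite mxE ji.
rewrite /mxtrace (eq_bigr _ (fun i _ => Rdet i)) exchange_big /=.
apply: eq_bigr => j _; rewrite mxE; apply: eq_bigr => i _.
by rewrite !mxE mulrC.
Qed.

Lemma nth_le_sumn c i : (nth 0%N c i <= sumn c)%N.
Proof.
elim: c i => [|a c IH] [|i] //=; first exact: leq_addr.
exact: leq_trans (IH i) (leq_addl _ _).
Qed.

Section MacMahon.
Variables (A : comNzRingType) (n : nat) (al be ga : nat -> A) (x : A) (w : seq nat).
Hypothesis w_lt : all (fun g => g < n)%N w.

Let B := hopword n al be ga w.
Let M (c d : seq nat) := gop (freewt al be ga) w (fun e => (e == 0%N :: d)%:R) (0%N :: c).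

Definition closemx : 'M[A]_n := \matrix_(a, b) (x * B (lift ord0 a) (lift ord0 b)).

Definition freetrace W : A := x ^+ W * \sum_(c <- comps n W) M c c.

(** Trace with an inserted operator that moves one particle between two closed strands; [c] records
    the remaining particles, and weight 0 leaves nothing to move. *)
Let U W : 'M[A]_n := \matrix_(a, b)
  if W is W'.+1 then x ^+ W * \sum_(c <- comps n W')
     (nth 0%N c b).+1%:R * M (incr_nth c a) (incr_nth c b)
  else 0.

Let w_size (c : seq nat) : size c = n.+1 -> all (fun g => g.+1 < size c)%N w.
Proof. by move=> ->. Qed.

Lemma M_incr c (a : 'I_n) d : size c = n ->
  M (incr_nth c a) d = \sum_(b < n) B (lift ord0 a) (lift ord0 b) *
    gop (freewt al be ga) w (fun e => (incr_nth e b.+1 == 0%N :: d)%:R) (0%N :: c).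
Proof.
move=> sc; rewrite /M -[_ :: incr_nth c a]/(incr_nth (0%N :: c) (lift ord0 a)).
rewrite (gop_incr al be ga _ _ w_lt) /= ?sc // big_ord_recl.
rewrite gop_eq0 ?mulr0 ?add0r //=; first by rewrite sc.
by case.
Qed.

Lemma incr_nth_eq (c d : seq nat) i : size c = size d -> (i < size c)%N ->
  (incr_nth c i == incr_nth d i) = (c == d).
Proof.
move=> sz ic; apply/eqP/eqP => [E|-> //]; apply: nth_inj_size => // j.
by have := congr1 (nth 0%N ^~ j) E; rewrite /= !nth_incr_nth => /addnI.
Qed.

(** The canonical commutation relation: annihilation at [d] after creation at [b] is the normally
    ordered product, which gives [U], plus the identity if [d = b]. *)
Lemma inner_sum W (b d : 'I_n) :
  x ^+ W * (\sum_(c <- comps n W) (nth 0%N c b).+1%:R *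
    gop (freewt al be ga) w (fun e => (incr_nth e d.+1 == 0%N :: incr_nth c b)%:R) (0%N :: c)) =
  U W d b + (d == b)%:R * freetrace W.
Proof.
have [->|db] := eqVneq d b.
  rewrite mul1r /freetrace.
  have -> : \sum_(c <- comps n W) (nth 0%N c b).+1%:R *
    gop (freewt al be ga) w (fun e => (incr_nth e b.+1 == 0%N :: incr_nth c b)%:R) (0%N :: c)
    = \sum_(c <- comps n W) ((nth 0%N c b)%:R * M c c + M c c).
    apply: eq_big_seq => c; rewrite mem_comps => /andP[/eqP sc _].
    rewrite -natr1 mulrDl mul1r.
    have -> // : gop (freewt al be ga) w
        (fun e => (incr_nth e b.+1 == 0%N :: incr_nth c b)%:R) (0%N :: c) = M c c.
    apply: eq_gop => [|e /= se]; first by apply: w_size; rewrite /= sc.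
    rewrite -[_ :: incr_nth c b]/(incr_nth (0%N :: c) b.+1) incr_nth_eq //.
    by rewrite se /= sc ltnS.
  rewrite big_split /= mulrDr; congr (_ + _); rewrite mxE.
  rewrite (bigID (fun c => 0 < nth 0%N c b)%N) /= addrC big1 ?add0r; last first.
    by move=> c; rewrite -eqn0Ngt => /eqP ->; rewrite mul0r.
  case: W => [|W].
    rewrite big_seq_cond big1 ?mulr0 // => c /andP[]; rewrite mem_comps.
    case/andP=> [/eqP sc /eqP s0] cb; have := nth_le_sumn c b; lia.
  rewrite big_comps_incr //; congr (_ * _); apply: eq_bigr => c _.
  by rewrite nth_incr_nth eqxx add1n.
have bd : (b == d :> nat) = false by apply/negbTE; rewrite eq_sym.
rewrite mul0r addr0 mxE (bigID (fun c => 0 < nth 0%N c d)%N) /= addrC big1_seq ?add0r; last first.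
  move=> c /andP[]; rewrite -eqn0Ngt mem_comps => /eqP cd /andP[/eqP sc _].
  rewrite gop_eq0 ?mulr0 //; first by rewrite /= sc.
  move=> e /= se; case: eqP => // /(congr1 (nth 0%N ^~ d.+1)) /=.
  by rewrite !nth_incr_nth eqxx cd bd.
case: W => [|W].
  rewrite big_seq_cond big1 ?mulr0 // => c /andP[]; rewrite mem_comps.
  case/andP=> [/eqP sc /eqP s0] cb; have := nth_le_sumn c d; lia.
rewrite big_comps_incr //; congr (_ * _).
apply: eq_big_seq => c; rewrite mem_comps => /andP[/eqP sc _].
rewrite nth_incr_nth [d == b :> nat]eq_sym bd add0n; congr (_ * _).
apply: eq_gop => [|e /= se]; first by rewrite /= size_incr_lt sc.
rewrite incr_nthC -[_ :: incr_nth _ d]/(incr_nth (0%N :: incr_nth c b) d.+1) incr_nth_eq //.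
  by rewrite se /= !size_incr_lt ?sc.
by rewrite se /= size_incr_lt sc // ltnS.
Qed.

Lemma U_rec W (a b : 'I_n) :
  U W.+1 a b = \sum_d closemx a d * (U W d b + (d == b)%:R * freetrace W).
Proof.
rewrite mxE exprS -mulrA mulr_sumr.
under eq_big_seq => c.
  rewrite mem_comps => /andP[/eqP sc _]; rewrite M_incr // mulr_sumr mulr_sumr; over.
rewrite exchange_big mulr_sumr /=; apply: eq_bigr => d _.
rewrite -inner_sum mxE -mulrA mulr_sumr mulr_sumr mulr_sumr mulr_sumr.
by apply: eq_bigr => c _; ring.
Qed.

Lemma U_trace W : \sum_b U W b b = W%:R * freetrace W.
Proof.
case: W => [|W]; first by rewrite mul0r big1 // => b _; rewrite mxE.
under eq_bigr => b _ do rewrite mxE.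
rewrite -mulr_sumr mulrCA; congr (_ * _).
transitivity (\sum_(b < n) \sum_(c <- comps n W.+1) (nth 0%N c b)%:R * M c c).
  apply: eq_bigr => b _; rewrite [RHS](bigID (fun c => 0 < nth 0%N c b)%N) /=.
  rewrite [X in _ = _ + X]big1 ?addr0; last first.
    by move=> c; rewrite -eqn0Ngt => /eqP ->; rewrite mul0r.
  by rewrite big_comps_incr //; apply: eq_bigr => c _; rewrite nth_incr_nth eqxx add1n.
rewrite exchange_big mulr_sumr; apply: eq_big_seq => c; rewrite mem_comps.
case/andP=> /eqP sc /eqP <-; rewrite -mulr_suml -natr_sum; congr (_%:R * _).
by rewrite sumnE (big_nth 0%N) big_mkord sc.
Qed.

Definition closedet : {poly A} := \det (1%:M - 'X *: map_mx polyC closemx).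

Let C : 'M[{poly A}]_n := 1%:M - 'X *: map_mx polyC closemx.

Lemma CE (a b : 'I_n) : C a b = (a == b)%:R%:P - 'X * (closemx a b)%:P.
Proof. by rewrite !mxE -polyC_natr. Qed.

(** [U_rec] as a linear system over power series, with matrix [C]; the next lemma solves it by the
    adjugate. *)
Lemma C_U (a b : 'I_n) W :
  \sum_e smul (C a e) (fun V => U V e b) W = smul ('X * (closemx a b)%:P) freetrace W.
Proof.
under eq_bigr => e _.
  rewrite CE smulDl smulNl smulC; over.
rewrite sumrB; have -> : \sum_e (a == e)%:R * U W e b = U W a b.
  rewrite (bigD1 a) //= eqxx mul1r big1 ?addr0 // => e.
  by rewrite eq_sym => /negPf ->; rewrite mul0r.
case: W => [|W].
  by rewrite smulX0 big1 ?subr0 ?[LHS]mxE // => e _; rewrite smulX0.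
rewrite smulXS smulC U_rec -sumrB (bigD1 b) //= smulXS smulC eqxx mul1r.
rewrite big1 ?addr0 => [|e /negPf eb]; first by ring.
by rewrite smulXS smulC eb mul0r addr0 subrr.
Qed.

Lemma smul_closedet_U (a b : 'I_n) W :
  smul closedet (fun V => U V a b) W =
  smul (\sum_c (\adj C) a c * ('X * (closemx c b)%:P)) freetrace W.
Proof.
rewrite [RHS]smul_suml; under [RHS]eq_bigr => c _.
  rewrite smulM; under (eq_smul _) => i _ do rewrite -C_U.
  rewrite smul_sumr; under eq_bigr => e _ do rewrite -smulM.
  over.
rewrite exchange_big /=; under [RHS]eq_bigr => e _.
  rewrite -smul_suml.
  have -> : \sum_i (\adj C) a i * C i e = (\adj C *m C) a e by rewrite mxE.
  rewrite mul_adj_mx mxE; over.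
rewrite (bigD1 a) //= eqxx mulr1n big1 ?addr0 // => e.
rewrite eq_sym => /negPf ->; rewrite mulr0n.
by rewrite /smul big1 // => i _; rewrite coef0 mul0r.
Qed.

(** The diagonal insertions count particles, so this is the trace of the solved system; as [C] has
    derivative [- closemx], Jacobi's formula identifies the right-hand side. *)
Lemma smul_closedet_weight W :
  smul closedet (fun V => V%:R * freetrace V) W = - smul ('X * closedet^`()) freetrace W.
Proof.
under (eq_smul _) => V _ do rewrite -U_trace.
rewrite smul_sumr; under eq_bigr => b _ do rewrite smul_closedet_U.
rewrite -smul_suml -smulNl; congr (smul _ _ _).
rewrite deriv_det -/C /mxtrace mulr_sumr -sumrN; apply: eq_bigr => b _.
rewrite mxE mulr_sumr -sumrN; apply: eq_bigr => c _.
have -> : (map_mx (@deriv A) C) c b = - (closemx c b)%:P.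
  by rewrite mxE CE derivB derivM derivX !derivC mul1r mulr0 addr0 sub0r.
by rewrite !mulrN opprK mulrCA.
Qed.

Lemma comps0 m : comps m 0 = [:: nseq m 0%N].
Proof. by elim: m => //= m ->. Qed.

Lemma gop_vacuum (wt : nat -> nat -> nat -> nat -> A) f m v :
  (forall o, wt o 0%N 0%N 0%N = 1) ->
  all (fun g => g.+1 < m)%N v -> gop wt v f (nseq m 0%N) = f (nseq m 0%N).
Proof.
move=> wt0; elim: v wt wt0 => [|g v IH] wt wt0 //= /andP[gm vm].
rewrite !nth_nseq !if_same big_ord1 wt0 mul1r -[RHS](IH (fun o => wt o.+1)) //.
congr (gop _ _ _ _); apply: nth_inj_size => [|i]; rewrite ?size_step ?size_nseq //.
by rewrite nth_step !nth_nseq !if_same.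
Qed.

Lemma freetrace0 : freetrace 0 = 1.
Proof.
rewrite /freetrace expr0 mul1r comps0 big_seq1 /M -[_ :: nseq n _]/(nseq n.+1 0%N).
rewrite gop_vacuum ?eqxx // => o.
by rewrite /freewt bin0 !mulr1.
Qed.

(** MacMahon's master theorem. Both sides satisfy the same first order differential
    equation: the weight operator is a sum of the operators "create at [a], annihilate
    at [b]", whose traces [U W a b] obey the linear recursion [U_rec], and Jacobi's
    formula identifies the logarithmic derivative. *)
Theorem macmahon W : (forall k (a : A), a *+ k.+1 = 0 -> a = 0) ->
  smul closedet freetrace W = (W == 0%N)%:R.
Proof.
move=> tf; case: W => [|W].
  rewrite /smul big_ord1 freetrace0 mulr1 -horner_coef0 /closedet.
  rewrite -horner_evalE -det_map_mx -[RHS](det1 A n); congr (\det _).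
  by apply/matrixP => a b; rewrite [LHS]mxE CE /= /horner_eval !hornerE ?mul0r subr0 mxE.
apply: (tf W); rewrite -mulr_natl -smul_derive smul_closedet_weight subrr //.
Qed.

End MacMahon.

(** Summation over the histories of a configuration in which, at each crossing, the [k]
    staying particles are split into two kinds ([k - m] and [m] of them); the log records
    [i - k], [j], [k - m], [m] at every crossing. *)
Fixpoint rsum (V : nmodType) (w : seq nat) (c : seq nat) (F : seq nat -> seq nat -> V) : V :=
  match w with
  | [::] => F [::] c
  | g :: w' => \sum_(k < (nth 0%N c g).+1) \sum_(m < k.+1)
      rsum w' (step g c k) (fun l e =>
        F [:: (nth 0%N c g - k)%N, nth 0%N c g.+1, (k - m)%N, m : nat & l] e)
        *+ ('C(nth 0%N c g, k) * 'C(k, m))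
  end.

Lemma eq_rsum (V : nmodType) w c (F G : seq nat -> seq nat -> V) :
  (forall l e, size l = (4 * size w)%N -> F l e = G l e) -> rsum w c F = rsum w c G.
Proof.
elim: w c F G => [|g w IH] c F G FG /=; first exact: FG.
apply: eq_bigr => k _; apply: eq_bigr => m _; congr (_ *+ _).
by apply: IH => l e sl; apply: FG; rewrite /= sl; lia.
Qed.

Lemma rsum_morph (V V' : nmodType) (h : V -> V') w c F :
  h 0 = 0 -> {morph h : x y / x + y} ->
  h (rsum w c F) = rsum w c (fun l e => h (F l e)).
Proof.
move=> h0 hD; elim: w c F => [|g w IH] c F //=.
rewrite (big_morph h hD h0); apply: eq_bigr => k _.
rewrite (big_morph h hD h0); apply: eq_bigr => m _.
rewrite -IH; elim: ('C(_, _) * _)%N => [|r IHr]; first by rewrite !mulr0n.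
by rewrite !mulrS hD IHr.
Qed.

Lemma rsumD (V : nmodType) w c (F G : seq nat -> seq nat -> V) :
  rsum w c (fun l e => F l e + G l e) = rsum w c F + rsum w c G.
Proof.
elim: w c F G => [|g w IH] c F G //=.
rewrite -big_split; apply: eq_bigr => k _; rewrite -big_split; apply: eq_bigr => m _.
by rewrite IH mulrnDl.
Qed.

Fixpoint mval (A : pzRingType) (v : nat -> A) (l : seq nat) : A :=
  if l is a :: l' then v 0%N ^+ a * mval (fun i => v i.+1) l' else 1.

Lemma eq_gop_wt (A : pzRingType) (wt wt' : nat -> nat -> nat -> nat -> A) w f c :
  (forall o i j k, wt o i j k = wt' o i j k) -> gop wt w f c = gop wt' w f c.
Proof.
elim: w wt wt' c => [|g w IH] wt wt' c E //=.
by apply: eq_bigr => k _; rewrite E; congr (_ * _); apply: IH => o.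
Qed.

Lemma eq_mval (A : pzRingType) (v v' : nat -> A) l :
  (forall i, (i < size l)%N -> v i = v' i) -> mval v l = mval v' l.
Proof. by elim: l v v' => //= a l IH v v' E; rewrite E // (IH _ (fun i => v' i.+1)) // => i il; apply: E. Qed.

(** With the staying weight a sum of two variables, all four numbers of the log become exponents of
    independent variables. *)
Lemma gop_rsum (A : comNzRingType) (v : nat -> A) w c f :
  gop (freewt (fun o => v (4 * o)%N) (fun o => v (4 * o).+1)
              (fun o => v (4 * o).+2 + v (4 * o).+3)) w f c =
  rsum w c (fun l e => f e * mval v l).
Proof.
elim: w v c => [|g w IH] v c; first by rewrite /= mulr1.
rewrite [LHS]/= [RHS]/=; apply: eq_bigr => k _.
pose v4 i := v i.+4.
rewrite (@eq_gop_wt _ _ (freewt (fun o => v4 (4 * o)%N) (fun o => v4 (4 * o).+1)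
              (fun o => v4 (4 * o).+2 + v4 (4 * o).+3))); last first.
  by move=> o i j k'; rewrite /freewt /v4 !mulnS.
rewrite IH /freewt muln0 [(_ + _) ^+ k]exprDn !mulr_sumr mulr_suml.
apply: eq_bigr => m _.
set i := nth 0%N c g; set j := nth 0%N c g.+1.
set X := v 0%N ^+ (i - k) * (v 1%N ^+ j * (v 2%N ^+ (k - m) * v 3%N ^+ m)).
have -> : rsum w (step g c k) (fun l e => f e * mval v [:: (i - k)%N, j, (k - m)%N, m : nat & l])
  = X * rsum w (step g c k) (fun l e => f e * mval v4 l).
  rewrite (@rsum_morph _ _ (fun z => X * z)) ?mulr0 //; last exact: mulrDr.
  by apply: eq_rsum => l e _; rewrite /= /X -/v4; ring.
by rewrite !mulrnAr mulrnAl -[LHS]mulr_natl -[RHS]mulr_natl natrM /X; ring.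
Qed.

(** * Polynomial insertions by Euler operators *)

Inductive pfun (K : nat) : (seq nat -> rat) -> Prop :=
| pfun_const c : pfun K (fun=> c)
| pfun_var i : (i < K)%N -> pfun K (fun l => (nth 0%N l i)%:R)
| pfun_add f g : pfun K f -> pfun K g -> pfun K (fun l => f l + g l)
| pfun_mul f g : pfun K f -> pfun K g -> pfun K (fun l => f l * g l)
| pfun_ext f g : f =1 g -> pfun K f -> pfun K g.

Section EulerOperators.
Variables (A : comAlgType rat) (v : nat -> A) (K : nat) (th : nat -> A -> A).
Hypothesis thD : forall i, {morph th i : a b / a + b}.
Hypothesis thM : forall i a b, th i (a * b) = th i a * b + a * th i b.
Hypothesis thZ : forall i (c : rat) a, th i (c *: a) = c *: th i a.
Hypothesis thv : forall i j, (i < K)%N -> th i (v j) = (j == i)%:R * v j.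

Let th0 i : th i 0 = 0.
Proof. by apply: (addIr (th i 0)); rewrite -thD !add0r. Qed.

Let th1 i : th i 1 = 0.
Proof. by apply: (addIr (th i 1)); rewrite add0r -[in RHS](mulr1 1) thM mulr1 mul1r. Qed.

Lemma th_exp i j e k : th i (v j) = e * v j -> th i (v j ^+ k) = (e *+ k) * v j ^+ k.
Proof.
move=> E; elim: k => [|k IH]; first by rewrite !expr0 th1 mulr0n mul0r.
by rewrite exprS thM E IH mulrS; ring.
Qed.

Lemma th_mval i l : (i < K)%N -> th i (mval v l) = (nth 0%N l i)%:R * mval v l.
Proof.
move=> iK.
have gen : forall l r, th i (mval (fun k => v (k + r)%N) l) =
   (if (r <= i)%N then nth 0%N l (i - r) else 0%N)%:R * mval (fun k => v (k + r)%N) l.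
  elim=> [|a l' IH] r; first by rewrite /= th1 nth_nil if_same mul0r.
  rewrite /= thM (th_exp _ (thv _ iK)) add0n.
  have -> : mval (fun k => v (k.+1 + r)%N) l' = mval (fun k => v (k + r.+1)%N) l'.
    by apply: eq_mval => k _; rewrite addSnnS.
  rewrite IH; case: (ltngtP r i) => ri.
  - by rewrite (_ : (i - r)%N = (i - r.+1).+1) /=; [ring | lia].
  - by rewrite /=; ring.
  - by rewrite ri subnn /=; ring.
have := gen l 0%N; rewrite subn0 /= (@eq_mval _ _ v) // => k _; first by rewrite addn0.
Qed.

Variables (n : nat) (w : seq nat).
Hypothesis w_lt : all (fun g => g < n)%N w.

(** The weight [W] is put in front of the log, so that insertions may depend on it and [u 0] counts
    it. *)
Definition logtrace (B : lalgType rat) (u : nat -> B) (f : seq nat -> rat) W : B :=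
  \sum_(c <- comps n W) rsum w (0%N :: c) (fun l e =>
     if e == 0%N :: c then f (W :: l) *: mval u (W :: l) else 0).

Lemma logtrace_morph (B C : lalgType rat) (u : nat -> B) (u' : nat -> C) (h : B -> C) f f' W :
  h 0 = 0 -> {morph h : a b / a + b} ->
  (forall l, (size l <= (4 * size w).+1)%N ->
     h (f l *: mval u l) = f' l *: mval u' l) ->
  h (logtrace u f W) = logtrace u' f' W.
Proof.
move=> h0 hD E; rewrite (big_morph h hD h0); apply: eq_bigr => c _.
rewrite rsum_morph //; apply: eq_rsum => l e sl.
by case: ifP => // _; apply: E; rewrite /= sl.
Qed.

Lemma eq_logtrace (B : lalgType rat) (u : nat -> B) f f' W :
  (forall l, f l = f' l) -> logtrace u f W = logtrace u f' W.
Proof. by move=> E; apply: (@logtrace_morph _ _ _ _ id) => // l _; rewrite E. Qed.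

Lemma logtraceD (B : lalgType rat) (u : nat -> B) f f' W :
  logtrace u (fun l => f l + f' l) W = logtrace u f W + logtrace u f' W.
Proof.
rewrite /logtrace -big_split /=; apply: eq_bigr => c _; rewrite -rsumD.
by apply: eq_rsum => l e _; case: ifP => _; rewrite ?addr0 // scalerDl.
Qed.

Let v1 i := v i.+1.

Lemma freetrace_logtrace W :
  freetrace n (fun o => v1 (4 * o)%N) (fun o => v1 (4 * o).+1)
    (fun o => v1 (4 * o).+2 + v1 (4 * o).+3) (v 0%N) w W = logtrace v (fun=> 1) W.
Proof.
rewrite /freetrace mulr_sumr; apply: eq_bigr => c _; rewrite gop_rsum.
rewrite (@rsum_morph _ _ (fun z => v 0%N ^+ W * z)) ?mulr0 //; last exact: mulrDr.
by apply: eq_rsum => l e _; case: eqP; rewrite ?mul0r ?mulr0 // scale1r mul1r.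
Qed.

Definition logdet : {poly A} := closedet n (fun o => v1 (4 * o)%N) (fun o => v1 (4 * o).+1)
    (fun o => v1 (4 * o).+2 + v1 (4 * o).+3) (v 0%N) w.

Lemma smul_logdet W : smul logdet (logtrace v (fun=> 1)) W = (W == 0%N)%:R.
Proof.
under (eq_smul _) => V _ do rewrite -freetrace_logtrace.
rewrite macmahon // => k a; rewrite -scaler_nat => /eqP; rewrite scaler_eq0 pnatr_eq0 /=.
by move/eqP.
Qed.

Definition rational_series (B : comNzRingType) (d : {poly B}) (T : nat -> B) :=
  exists M (p : {poly B}), forall W, smul (d ^+ M) T W = p`_W.

Lemma th_logtrace i f W : (i < K)%N ->
  th i (logtrace v f W) = logtrace v (fun l => (nth 0%N l i)%:R * f l) W.
Proof.
move=> iK; apply: logtrace_morph => [||l _]; [exact: th0|exact: thD|].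
by rewrite thZ th_mval // -scalerA mulr_natl scaler_nat scalerMnr.
Qed.

(** Generalised over a further insertion [h] so that products of insertions compose. A log entry is
    inserted by the Euler operator of its variable, at the price of squaring the denominator. *)
Lemma logtrace_rational f : pfun K f -> forall h,
  rational_series logdet (logtrace v h) -> rational_series logdet (logtrace v (fun l => f l * h l)).
Proof.
elim=> {f} [c|i iK|f g _ IHf _ IHg|f g _ IHf _ IHg|f g fg _ IH] h Rh.
- have [M [p E]] := Rh; exists M, (c%:A *: p) => W.
  rewrite coefZ -E -smulZr; apply: eq_smul => V _; rewrite mulr_algl.
  apply/esym; apply: logtrace_morph => [|a b|l _]; rewrite ?scaler0 ?scalerDr //.
  by rewrite scalerA.
- have [M [p E]] := Rh; set Q := logdet ^+ M in E.
  pose thp (q : {poly A}) := \poly_(j < size q) th i q`_j.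
  have cthp q j : (thp q)`_j = th i q`_j.
    by rewrite coef_poly; case: ltnP => // sq; rewrite nth_default // th0.
  (* Quotient rule: [Q T = p] gives [Q^2 th(T) = Q th(p) - th(Q) p], with [th i] applied to
     coefficients. *)
  exists (M + M)%N, (Q * thp p - thp Q * p) => W.
  have Qp (q r : {poly A}) V : smul q (fun i => r`_i) V = (q * r)`_V.
    by rewrite coefM.
  have thE V : smul Q (logtrace v (fun l => (nth 0%N l i)%:R * h l)) V =
      th i (p`_V) - smul (thp Q) (logtrace v h) V.
    rewrite -E /smul (big_morph (th i) (@thD i) (@th0 i)) -sumrB; apply: eq_bigr => j _.
    by rewrite thM cthp th_logtrace //; ring.
  rewrite exprD smulM -/Q (eq_smul _ (fun V _ => thE V)).
  under (eq_smul _) => V _ do rewrite -cthp -mulN1r.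
  rewrite smulDr smulZr Qp -smulM mulrC [Q * thp Q]mulrC.
  rewrite smulM (eq_smul _ (fun V _ => E V)) Qp coefB mulN1r.
  by [].
- have [M [p E]] := IHf _ Rh; have [M' [p' E']] := IHg _ Rh.
  exists (M + M')%N, (logdet ^+ M' * p + logdet ^+ M * p') => W.
  have Qp (q r : {poly A}) V : smul q (fun i => r`_i) V = (q * r)`_V by rewrite coefM.
  under (eq_smul _) => V _.
    rewrite (eq_logtrace _ _ (fun l => mulrDl (f l) (g l) (h l))) logtraceD; over.
  rewrite smulDr exprD coefD {1}[_ * logdet ^+ M']mulrC !smulM.
  by congr (_ + _); rewrite -Qp; apply: eq_smul => V _.
- have [M [p E]] := IHf _ (IHg _ Rh); exists M, p => W; rewrite -E.
  by apply: eq_smul => V _; apply: eq_logtrace => l; rewrite mulrA.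
have [M [p E]] := IH _ Rh; exists M, p => W; rewrite -E.
by apply: eq_smul => V _; apply: eq_logtrace => l; rewrite fg.
Qed.

End EulerOperators.

(** Insertion of a polynomial in the log into a free state sum: generically these insertions
    are Euler operators applied to the inverse of a determinant, and the general case
    follows by specialising the weights [u]. *)
Theorem insertion_rational (B : comAlgType rat) (u : nat -> B) n w :
  all (fun g => g < n)%N w ->
  exists d : {poly B},
    (forall W, smul d (logtrace n w u (fun=> 1)) W = (W == 0%N)%:R) /\
    (forall f, pfun (4 * size w).+1 f -> rational_series d (logtrace n w u f)).
Proof.
move=> w_lt; set K := (4 * size w).+1.
pose A := {mpoly rat[K]}.
pose v j : A := if insub j is Some i then 'X_(i : 'I_K) else 1.
pose th i (a : A) : A := if insub i is Some i' then 'X_(i' : 'I_K) * a^`M(i') else 0.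
have thD i : {morph th i : a b / a + b}.
  by move=> a b; rewrite /th; case: insubP => [i' _ _|_]; rewrite ?addr0 // mderivD mulrDr.
have thM i (a b : A) : th i (a * b) = th i a * b + a * th i b.
  rewrite /th; case: insubP => [i' _ _|_]; last by rewrite mul0r mulr0 addr0.
  by rewrite mderivM; ring.
have thZ i (c : rat) (a : A) : th i (c *: a) = c *: th i a.
  rewrite /th; case: insubP => [i' _ _|_]; last by rewrite scaler0.
  by rewrite mderivZ scalerAr.
have thv i j : (i < K)%N -> th i (v j) = (j == i)%:R * v j.
  move=> iK; rewrite /th (insubT (fun m => (m < K)%N) iK) /v.
  case: insubP => [j' _ j'j|jK].
    rewrite mderivX mnm1E -j'j -val_eqE /=; case: eqP => [E|_]; last first.
      by rewrite scale0r mulr0 mul0r.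
    have -> : j' = Sub i iK by apply: val_inj.
    rewrite scale1r mul1r (_ : (_ - _)%MM = 0%MM) ?mpolyX0 ?mulr1 //.
    by apply/mnmP => k; rewrite mnmBE subnn mnm0E.
  rewrite -[1]/(1%:MP) mderivC mulr0; case: eqP jK => [->|]; last by rewrite mul0r.
  by rewrite iK.
pose ev : {rmorphism A -> B} := mmap (in_alg B) (fun i => u i).
have evZ c a : ev (c *: a) = c *: ev a by rewrite /ev /= mmapZ /= mulr_algl.
have evv j : (j < K)%N -> ev (v j) = u j.
  move=> jK; rewrite /v (insubT (fun m => (m < K)%N) jK).
  by rewrite /ev /= mmapX mmap1U.
clearbody ev.
have ev_mval l (v' : nat -> A) u' : (forall i, (i < size l)%N -> ev (v' i) = u' i) ->
    ev (mval v' l) = mval u' l.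
  elim: l v' u' => [|a l IH] v' u' E /=; first exact: rmorph1.
  rewrite rmorphM rmorphXn E // (IH _ (fun i => u' i.+1)) // => i il.
  exact: E.
have ev_logtrace f W : ev (logtrace n w v f W) = logtrace n w u f W.
  apply: logtrace_morph => [||l sl]; [exact: raddf0|exact: raddfD|].
  rewrite evZ (ev_mval _ _ u) // => i il; apply: evv.
  exact: leq_trans il sl.
have ev_smul (p : {poly A}) T W : ev (smul p T W) = smul (map_poly ev p) (fun V => ev (T V)) W.
  rewrite /smul rmorph_sum; apply: eq_bigr => i _.
  by rewrite rmorphM coef_map.
exists (map_poly ev (logdet v n w)); split=> [W|f pf].
  under (eq_smul _) => V _ do rewrite -ev_logtrace.
  by rewrite -ev_smul (smul_logdet v w_lt) rmorph_nat.
have R1 : rational_series (logdet v n w) (logtrace n w v (fun=> 1)).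
  exists 1%N, 1 => W; rewrite expr1 (smul_logdet v w_lt) coef1.
  by [].
have [M [p E]] := logtrace_rational thD thM thZ thv pf R1.
exists M, (map_poly ev p) => W.
under (eq_smul _) => V _ do rewrite -ev_logtrace.
rewrite -rmorphXn -ev_smul coef_map -E; congr (ev _); apply: eq_smul => V _.
by apply: eq_logtrace => l; rewrite mulr1.
Qed.

(** * Degrees of closed states *)

Fixpoint cost (w c ks : seq nat) : nat :=
  match w, ks with
  | g :: w', k :: ks' =>
      (1 + (nth 0 c g - k) + nth 0 c g.+1 + cost w' (step g c k) ks')%N
  | _, _ => 0%N
  end.

(** Bounds the exponents of [s] from below and those of [t] from above, and fixes both parities; the
    parities are what removes all square roots of [q] and [x] from the trace. *)
Definition expo_from (x y : int) (u : int * int) :=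
  exists a b : nat, u.1 = x + Posz (2 * a)%N /\ u.2 = - (y + Posz (2 * b)%N).

Lemma expo_from_lmul x y x' y' p r :
  (forall m, m \in p -> expo_from x y m.2) -> (forall m, m \in r -> expo_from x' y' m.2) ->
  forall m, m \in lmul p r -> expo_from (x + x') (y + y') m.2.
Proof.
move=> Pp Pr; apply: (mem_lmul Pp Pr) => u v [a [b [-> ->]]] [a' [b' [-> ->]]].
by exists (a + a')%N, (b + b')%N; split=> /=; rewrite mulnDr PoszD; ring.
Qed.

Lemma expo_from_lmono c x y m : m \in lmono c x (- y) -> expo_from x y m.2.
Proof.
by rewrite inE => /eqP -> /=; exists 0%N, 0%N; rewrite muln0 !addr0.
Qed.

Lemma gauss_term n k m : m \in gauss n k -> m.2.2 = 0 /\ exists a, m.2.1 = Posz (2 * a)%N.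
Proof.
elim: n k m => [|n IH] [|k] m //=; rewrite ?inE //; try by move/eqP => ->; split=> //; exists 0%N.
rewrite /ladd mem_cat => /orP[/IH //|].
pose P (u : int * int) := u.2 = 0 /\ exists a, u.1 = Posz (2 * a)%N.
move: m; apply: (@mem_lmul P P P); rewrite /P.
- by move=> x; rewrite inE => /eqP -> /=; split=> //; exists k.+1.
- exact: IH.
- move=> u v [-> [a ->]] [-> [b ->]] /=; rewrite addr0; split=> //.
  by exists (a + b)%N; rewrite mulnDr PoszD.
Qed.

Lemma Rcoef_term i j k m : m \in Rcoef i j k ->
  expo_from (Posz (1 + (i - k) + j)%N) (Posz (1 + (i - k) + j)%N) m.2.
Proof.
pose d := (i - k)%N; rewrite /Rcoef -/d /= => mR.
set x0 : nat := (2 * d * j + d * k + d + j + 1)%N in mR.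
have H0 u : u \in lmono 1 x0 (- Posz (1 + d + j)%N) -> expo_from x0 (Posz (1 + d + j)%N) u.2.
  exact: expo_from_lmono.
have H1 u : u \in qbin i k -> expo_from (- Posz (k * d)%N) 0 u.2.
  rewrite /qbin -[X in expo_from X]addr0 -[X in expo_from _ X]addr0.
  apply: expo_from_lmul => [z|z /gauss_term[z2 [a z1]]].
    by rewrite -[X in lmono 1 _ X]oppr0; apply: expo_from_lmono.
  by exists a, 0%N; rewrite z1 z2 add0r muln0 addr0 oppr0.
have H2 u : u \in lprod [seq ladd lone (lmono (-1) (Posz (2 * (j + l))) (-2)) | l <- iota 1 k] ->
    expo_from 0 0 u.2.
  elim: (iota 1 k) u => [|l r IH] u /=.
    by rewrite inE => /eqP ->; exists 0%N, 0%N.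
  move=> ur; suff : expo_from (0 + 0) (0 + 0) u.2 by rewrite !addr0.
  apply: expo_from_lmul IH u ur => u.
  rewrite inE => /orP[/eqP ->|]; first by exists 0%N, 0%N.
  by rewrite inE => /eqP -> /=; exists (j + l)%N, 1%N; rewrite !add0r.
have H3 u : u \in lone -> expo_from 0 0 u.2 by rewrite inE => /eqP ->; exists 0%N, 0%N.
have := expo_from_lmul H0 (expo_from_lmul H1 (expo_from_lmul H2 H3)) mR.
(* The negative power of [s] in [qbin] cancels the term [d * k] of the prefactor, and [2 * d * j] is
   left as surplus. *)
rewrite !addr0 => -[a [b [ea eb]]]; exists (a + d * j)%N, b; split=> //.
rewrite ea /x0 -/d -mulnA (mulnC k d); move: (d * j)%N (d * k)%N => dj dk; lia.
Qed.

Lemma pathw_term w c ks m : m \in pathw w c ks ->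
  expo_from (Posz (cost w c ks)) (Posz (cost w c ks)) m.2.
Proof.
elim: w c ks m => [|g w IH] c [|k ks] m /=; try by rewrite inE => /eqP ->; exists 0%N, 0%N.
by move: m; rewrite PoszD; apply: expo_from_lmul; [exact: Rcoef_term|exact: IH].
Qed.

Lemma expo_from_le0 (x y : nat) u : expo_from x y u -> u.2 <= 0.
Proof. by case=> a [b [_ ->]]; rewrite oppr_le0. Qed.

Fixpoint kval (w c ks : seq nat) : bool :=
  match w, ks with
  | [::], [::] => true
  | g :: w', k :: ks' => (k <= nth 0 c g)%N && kval w' (step g c k) ks'
  | _, _ => false
  end.

Lemma kseqsS g w c : kseqs (g :: w) c =
  [seq k :: ks | k <- iota 0 (nth 0%N c g).+1, ks <- kseqs w (step g c k)].
Proof. by []. Qed.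

Lemma kseqs_kval w c ks : ks \in kseqs w c -> kval w c ks.
Proof.
elim: w c ks => [|g w IH] c ks; first by rewrite inE => /eqP ->.
rewrite kseqsS => /allpairsPdep[k [ks' [kc /IH h ->]]] /=; rewrite h andbT.
by move: kc; rewrite mem_iota add0n ltnS.
Qed.

Lemma pathend_cons g w c k ks : pathend (g :: w) c (k :: ks) = pathend w (step g c k) ks.
Proof. by rewrite /pathend /=; case: w => [|g' w] //=; case: ks. Qed.

(** Particles that pass the gap between positions [h] and [h.+1] to the left; [rflux] counts those
    that pass to the right. *)
Fixpoint lflux h (w c ks : seq nat) : nat :=
  match w, ks with
  | g :: w', k :: ks' => ((g == h) * nth 0 c g.+1 + lflux h w' (step g c k) ks')%N
  | _, _ => 0%N
  end.

Fixpoint rflux h (w c ks : seq nat) : nat :=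
  match w, ks with
  | g :: w', k :: ks' => ((g == h) * (nth 0 c g - k) + rflux h w' (step g c k) ks')%N
  | _, _ => 0%N
  end.

Lemma sum_pick n g x : (g < n)%N -> (\sum_(h < n) (g == h) * x = x)%N.
Proof.
move=> gn; rewrite (bigD1 (Ordinal gn)) //= eqxx mul1n big1 ?addn0 // => h.
by rewrite -val_eqE /= eq_sym => /negPf ->.
Qed.

Lemma cost_flux n w c ks : all (fun g => g < n)%N w -> kval w c ks ->
  cost w c ks = (size w + \sum_(h < n) (lflux h w c ks + rflux h w c ks))%N.
Proof.
elim: w c ks => [|g w IH] c [|k ks] //=; first by rewrite big1.
case/andP=> gn wn /andP[kc kv]; rewrite (IH _ _ wn kv).
under [in RHS]eq_bigr => h _ do rewrite addnACA -mulnDr.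
rewrite [in RHS]big_split /= (sum_pick _ gn).
by move: (\sum_(h < n) _)%N => S; lia.
Qed.

Definition lowsum h (c : seq nat) : nat := \sum_(p < h.+1) nth 0%N c p.

Lemma lowsum_step h g c k : (k <= nth 0 c g)%N ->
  (lowsum h (step g c k) + (g == h) * (nth 0 c g - k) = lowsum h c + (g == h) * nth 0 c g.+1)%N.
Proof.
move=> kc; rewrite /lowsum; elim: h => [|h IH].
  rewrite !big_ord1 nth_step; case: g kc => [|g] kc //=; lia.
rewrite big_ord_recr [in RHS]big_ord_recr /= nth_step; move: IH.
set X := (\sum_(p < h.+1) nth _ (step _ _ _) _)%N; set Y := (\sum_(p < h.+1) nth _ c _)%N.
case: (eqVneq g h) => [->|gh] /=; first by rewrite eqxx (ltn_eqF (ltnSn h)); lia.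
rewrite eqSS [h == g]eq_sym (negPf gh) [h.+1 == g]eq_sym.
case: (eqVneq g h.+1) => [gE|_] /=; last by lia.
by move: kc; rewrite gE; lia.
Qed.

Lemma flux_balance h w c ks : kval w c ks ->
  (lowsum h (pathend w c ks) + rflux h w c ks = lowsum h c + lflux h w c ks)%N.
Proof.
elim: w c ks => [|g w IH] c [|k ks] //= /andP[kc kv].
by rewrite pathend_cons; have := IH _ _ kv; have := lowsum_step h kc; lia.
Qed.

(** The flux through a curve that follows, at each strand [p], the first crossing of that
    strand with its left neighbour: its value at the horizontal line is the weight of the
    state, and at the curve it is bounded by the number of left moves. *)
Definition unseen n (S c : seq nat) : nat :=
  (\sum_(p < n) ((p : nat) \notin S) * nth 0 c p.+1)%N.

Fixpoint cutflux h (S : seq nat) (w c ks : seq nat) : int :=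
  match w, ks with
  | g :: w', k :: ks' => (g == h)%:R * ((h \notin S)%:R * (nth 0%N c g.+1)%:R -
      ((0 < h)%N && (h.-1 \notin S))%:R * ((nth 0%N c g.+1)%:R - (nth 0%N c g - k)%N%:R)) +
      cutflux h (g :: S) w' (step g c k) ks'
  | _, _ => 0
  end.

(** The crossing marks gap [g] as seen, which drops the particles at [g.+1]; the change at position
    [g] only enters the term of gap [g.-1]. *)
Lemma unseen_step n S g c k : (g < n)%N -> (k <= nth 0 c g)%N ->
  (unseen n S c)%:R = (unseen n (g :: S) (step g c k))%:R +
    ((g \notin S)%:R * (nth 0%N c g.+1)%:R - ((0 < g)%N && (g.-1 \notin S))%:R *
     ((nth 0%N c g.+1)%:R - (nth 0%N c g - k)%N%:R)) :> int.
Proof.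
move=> gn kc; apply/eqP; rewrite -subr_eq0 opprD addrA subr_eq0; apply/eqP.
rewrite /unseen !natr_sum -sumrB.
rewrite (bigD1 (Ordinal gn)) //= inE eqxx /= !nth_step eqxx mul0n subr0 natrM; congr (_ + _).
case: g gn kc => [|g] gn kc.
  rewrite mul0r oppr0 big1 // => p; rewrite -val_eqE /= => p0.
  by rewrite inE (negPf p0) /= nth_step eqSS (negPf p0) /= subrr.
rewrite (bigD1 (Ordinal (ltnW gn))) /=; last by rewrite -val_eqE /= ltn_eqF.
rewrite big1 ?addr0 => [|p]; last first.
  rewrite -!val_eqE /= => /andP[p1 p2].
  by rewrite inE (negPf p1) /= nth_step !eqSS (negPf p1) (negPf p2) subrr.
rewrite inE (ltn_eqF (ltnSn g)) /= nth_step eqxx (ltn_eqF (ltnSn g.+1)) !natrM natrD natrB //; ring.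
Qed.

Lemma unseen_cutflux n S w c ks : all (fun g => g < n)%N w -> kval w c ks ->
  (unseen n S c)%:R = (unseen n (rev w ++ S) (pathend w c ks))%:R +
     \sum_(h < n) cutflux h S w c ks :> int.
Proof.
elim: w S c ks => [|g w IH] S c [|k ks] //=; first by rewrite big1 // addr0.
case/andP=> gn wn /andP[kc kv].
rewrite (unseen_step S gn kc) (IH (g :: S) _ _ wn kv) pathend_cons rev_cons cat_rcons.
rewrite big_split /= -addrA [X in _ = _ + X]addrC; congr (_ + (_ + _)).
rewrite (bigD1 (Ordinal gn)) //= eqxx mul1r big1 ?addr0 // => h.
by rewrite -val_eqE /= eq_sym => /negPf ->; rewrite mul0r.
Qed.

Lemma cutflux_seen h S w c ks : h \in S -> cutflux h S w c ks <= (rflux h w c ks)%:R.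
Proof.
elim: w S c ks => [|g w IH] S c [|k ks] //= hS.
have := IH (g :: S) (step g c k) ks; rewrite inE hS orbT => /(_ isT).
rewrite natrD natrM; case: (g == h) => /=; case: (_ && _) => /=; lia.
Qed.

Lemma cutflux_both h S w c ks : h \in S -> (h == 0%N) || (h.-1 \in S) -> cutflux h S w c ks = 0.
Proof.
elim: w S c ks => [|g w IH] S c [|k ks] //= hS h1S.
rewrite IH ?inE ?hS ?orbT //; last by case/orP: h1S => ->; rewrite ?orbT.
have -> : (0 < h)%N && (h.-1 \notin S) = false.
  by case/orP: h1S => [/eqP -> //|->]; rewrite andbF.
by rewrite /= !mul0r subrr mulr0 addr0.
Qed.

(** If gap [h.-1] exists and is unseen at the first crossing in gap [h], that crossing contributes
    its right movers and later ones at most theirs. Otherwise it contributes its left movers, and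
    later ones nothing. *)
Lemma cutflux_le h S w c ks :
  cutflux h S w c ks <= (maxn (lflux h w c ks) (rflux h w c ks))%:R.
Proof.
case hS: (h \in S).
  by apply: le_trans (cutflux_seen _ _ _ hS) _; rewrite ler_nat leq_maxr.
elim: w S c ks hS => [|g w IH] S c [|k ks] //= hS.
case: (eqVneq g h) => [->|gh] /=; last first.
  by rewrite !mul0n !add0n mul0r add0r; apply: IH; rewrite inE eq_sym (negPf gh).
rewrite hS mul1r !mul1n.
have h1 : h \in h :: S by rewrite inE eqxx.
set L := nth 0%N c h.+1; set R := (nth 0%N c h - k)%N.
case E: ((0 < h)%N && (h.-1 \notin S)).
  apply: le_trans (_ : _ <= (R + rflux h w (step h c k) ks)%:R) _.
    rewrite mul1r natrD lerD ?(cutflux_seen _ _ _ h1) // !mul1r.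
    by have -> : L%:R - (L%:R - R%:R) = R%:R :> int by ring.
  by rewrite ler_nat leq_maxr.
rewrite (@cutflux_both h (h :: S) w (step h c k) ks h1).
  rewrite !mul1r mul0r subr0 addr0 ler_nat.
  exact: leq_trans (leq_addr _ _) (leq_maxl _ _).
rewrite inE; move: E; case: (h) => //= h' /negbFE ->; exact: orbT.
Qed.

(** Every generator occurs, so all gaps end up seen and the weight is the total [cutflux]. In a
    closed state the two fluxes through a gap agree, so each bounds its [cutflux] and together they
    make up the moving cost. *)
Lemma weight_le_cost n w c ks : all (fun g => g < n)%N w -> kval w (0%N :: c) ks ->
  size c = n -> pathend w (0%N :: c) ks = 0%N :: c -> (forall g, (g < n)%N -> g \in w) ->
  (exists l, cost w (0%N :: c) ks = size w + 2 * l /\ sumn c <= l)%N.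
Proof.
move=> wn kv sc pe occ; set c0 := 0%N :: c in kv pe *.
have bal h : rflux h w c0 ks = lflux h w c0 ks.
  by have := flux_balance h kv; rewrite pe => /addnI.
exists (\sum_(h < n) lflux h w c0 ks)%N; split.
  rewrite (cost_flux wn kv); congr (_ + _)%N; rewrite big_distrr /=.
  by apply: eq_bigr => h _; rewrite bal mul2n addnn.
have := unseen_cutflux [::] wn kv; rewrite pe.
have -> : unseen n (rev w ++ [::]) c0 = 0%N.
  by apply: big1 => p _; rewrite cats0 mem_rev occ.
have -> : unseen n [::] c0 = sumn c.
  rewrite /unseen sumnE (big_nth 0%N) big_mkord sc; apply: eq_bigr => p _ /=.
  by rewrite mul1n.
rewrite add0r => E; rewrite -(ler_nat int) E natr_sum; apply: ler_sum => h _.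
by apply: le_trans (cutflux_le _ _ _ _ _) _; rewrite bal maxnn.
Qed.

(** * Consequences of the closure being a knot *)

Lemma bperm_low g w p : g \notin w -> (p <= g)%N -> (bperm w p <= g)%N.
Proof.
elim: w p => [|g' w IH] p //=; rewrite inE negb_or => /andP[gg' gw] pg.
by apply: IH => //; rewrite /swapg; case: eqP => [?|_]; [lia | case: eqP => [?|_]; lia].
Qed.

Lemma knot_occurs n w g : is_knot n.+1 w -> (g < n)%N -> g \in w.
Proof.
move=> kn gn; apply/negPn/negP => gw.
have [k E] := kn n (ltnSn n).
have : (iter k (bperm w) 0 <= g)%N by elim: k {E} => //= k; apply: bperm_low.
by rewrite E leqNgt gn.
Qed.

(** The permutation is a cycle on [n + 1] points, which has the parity of [n], and every letter is a
    transposition. *)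
Lemma knot_parity n w : all (fun g => g < n)%N w -> is_knot n.+1 w -> odd (size w) = odd n.
Proof.
move=> wn kn.
pose sg g : 'S_n.+1 := tperm (inord g) (inord g.+1).
pose s := foldr (fun g (t : 'S_n.+1) => (sg g * t)%g) 1%g w.
have swE g (p : 'I_n.+1) : (g < n)%N -> swapg g p = sg g p :> nat.
  move=> gn; rewrite /sg /swapg permE /=.
  rewrite -!val_eqE /= !inordK; try lia.
  by case: eqP => // _; [rewrite inordK //; lia | case: eqP => // _; rewrite inordK //; lia].
have sE (p : 'I_n.+1) : bperm w p = s p :> nat.
  rewrite /s; elim: w wn p {kn s} => [|g w IH] /= wn p; first by rewrite perm1.
  by case/andP: wn => gn wn; rewrite permM -IH // swE.
have so : odd_perm s = odd (size w).
  rewrite /s; elim: w wn {kn s sE} => [|g w IH] /= wn; first by rewrite odd_perm1.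
  case/andP: wn => gn wn; rewrite odd_permM IH // /sg odd_tperm -val_eqE /= !inordK; lia.
rewrite -so /odd_perm card_ord.
have -> : porbits s = [set porbit s ord0].
  apply/setP => A; rewrite inE; apply/imsetP/eqP => [[p _ ->]|->]; last by exists ord0.
  have [k kp] := kn p (ltn_ord p).
  have -> : p = (s ^+ k)%g ord0.
    apply: val_inj; rewrite permX /= -kp; elim: k {kp} => //= k ->.
    by rewrite -sE.
  by apply/eqP; rewrite eq_porbit_mem mem_porbit.
by rewrite cards1 addbT /= negbK.
Qed.

(** Along a strand the occupation number grows only where the strand passes to the left, and then by
    the number [k] of particles staying there. *)
Lemma pathend_bperm w c ks p : kval w c ks ->
  (nth 0 (pathend w c ks) (bperm w p) <= nth 0 c p + sumn ks)%N.
Proof.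
elim: w c ks p => [|g w IH] c [|k ks] p //=; first by rewrite addn0.
case/andP=> kc kv; rewrite pathend_cons.
apply: leq_trans (IH _ _ (swapg g p) kv) _; rewrite addnA leq_add2r nth_step /swapg.
case: (eqVneq p g) => [->|pg]; first by rewrite eqxx; lia.
case: (eqVneq p g.+1) => [->|pg1]; first by rewrite eqxx (ltn_eqF (ltnSn g)).
by rewrite (negPf pg) (negPf pg1) leq_addr.
Qed.

(** Every position is reached from the empty open strand by iterating the permutation, so a large
    weight requires many staying particles. *)
Lemma knot_weight_bound n w : is_knot n.+1 w -> exists C, forall c ks,
  size c = n -> kval w (0%N :: c) ks -> pathend w (0%N :: c) ks = 0%N :: c ->
  (sumn c <= C * sumn ks)%N.
Proof.
move=> kn; have [r Hr] := fin_all_exists (fun p : 'I_n.+1 => kn p (ltn_ord p)).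
exists (\sum_(p < n.+1) r p)%N => c ks sc kv pe.
have it m : (nth 0 (0%N :: c) (iter m (bperm w) 0%N) <= m * sumn ks)%N.
  elim: m => [|m IH] //=; rewrite -[in X in nth 0%N X]pe.
  by apply: leq_trans (pathend_bperm _ kv) _; rewrite mulSn addnC leq_add2l.
have -> : sumn c = (\sum_(p < n.+1) nth 0 (0%N :: c) p)%N.
  rewrite big_ord_recl add0n sumnE (big_nth 0%N) big_mkord sc.
  by apply: eq_bigr => p _.
by rewrite big_distrl /=; apply: leq_sum => p _; rewrite -{1}(Hr p) it.
Qed.

(** Vanishing of the weights that would raise an occupation number from below [m] to at
    least [m], for any notion [Z] of vanishing compatible with products. *)
Section Vanishing.
Variables (m : nat) (Z : lpoly -> Prop).
Hypothesis Zl : forall p r, Z p -> Z (lmul p r).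
Hypothesis Zr : forall p r, Z r -> Z (lmul p r).
Hypothesis ZR : forall i j k, (j < m)%N -> (m <= j + k)%N -> Z (Rcoef i j k).

Lemma pathw_low w c ks p : kval w c ks -> (nth 0 c p < m)%N ->
  (nth 0 (pathend w c ks) (bperm w p) < m)%N \/ Z (pathw w c ks).
Proof.
elim: w c ks p => [|g w IH] c [|k ks] p //=; first by left.
case/andP=> kc kv pm; rewrite pathend_cons.
have [lt|ge] := boolP ((nth 0 (step g c k) (swapg g p) < m)%N).
  by case: (IH _ _ _ kv lt); [left | right; apply: Zr].
right; apply: Zl; move: ge; rewrite -leqNgt nth_step /swapg.
case: (eqVneq p g) => [pg|pg]; first by rewrite eqxx -pg; lia.
case: (eqVneq p g.+1) => [pg1|pg1].
  by rewrite eqxx (ltn_eqF (ltnSn g)) => ge; apply: ZR ge; rewrite -pg1.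
by rewrite (negPf pg) (negPf pg1); lia.
Qed.

Lemma pathw_all_low n w c ks : all (fun g => g < n)%N w -> size c = n.+1 -> kval w c ks ->
  all (fun i => i < m)%N c ->
  all (all (fun i => i < m)%N) (pathvecs w c ks) \/ Z (pathw w c ks).
Proof.
elim: w c ks => [|g w IH] c [|k ks] //=; first by move=> _ _ _ ->; left.
case/andP=> gn wn sc /andP[kc kv] cm; rewrite cm /=.
have gc : (g.+1 < size c)%N by rewrite sc.
have lt i : (i < size c)%N -> (nth 0 c i < m)%N by move=> ic; apply: (all_nthP 0%N cm).
have [ge|jk] := leqP m (nth 0 c g.+1 + k); first by right; apply: Zl; apply: ZR (lt _ gc) ge.
have sc' : size (step g c k) = n.+1 by rewrite size_step.
have cm' : all (fun i => i < m)%N (step g c k).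
  apply/(all_nthP 0%N) => i; rewrite size_step // => ic; rewrite nth_step.
  case: eqP => _; first by apply: leq_ltn_trans (leq_subr _ _) (lt _ (ltnW gc)).
  by case: eqP => // _; apply: lt.
by case: (IH _ _ wn sc' kv cm') => [->|]; [left | right; apply: Zr].
Qed.

(** The same walk around the knot from the empty open strand keeps all starting numbers below [m];
    [pathw_all_low] extends this to every height of the braid. *)
Lemma closed_low n w c ks : all (fun g => g < n)%N w -> is_knot n.+1 w -> (0 < m)%N ->
  size c = n -> kval w (0%N :: c) ks -> pathend w (0%N :: c) ks = 0%N :: c ->
  all (all (fun i => i < m)%N) (pathvecs w (0%N :: c) ks) \/ Z (pathw w (0%N :: c) ks).
Proof.
move=> wn kn m0 sc kv pe.
have it r : (nth 0 (0%N :: c) (iter r (bperm w) 0%N) < m)%N \/ Z (pathw w (0%N :: c) ks).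
  elim: r => [|r [lt|]]; [by left | | by right].
  by rewrite -[in X in nth 0%N X]pe /=; apply: pathw_low.
have [] : (forall p, (p < n.+1)%N -> (nth 0 (0%N :: c) p < m)%N) \/ Z (pathw w (0%N :: c) ks).
- suff : forall p, (p <= n.+1)%N -> (forall i, (i < p)%N -> (nth 0 (0%N :: c) i < m)%N) \/
      Z (pathw w (0%N :: c) ks) by move/(_ n.+1 (leqnn _)).
  elim=> [|p IH] pn; first by left.
  have [r rp] := kn _ pn; case: (IH (ltnW pn)) => [lt|]; last by right.
  case: (it r) => [|]; last by right.
  rewrite rp => ltp; left=> i; rewrite ltnS leq_eqVlt => /predU1P[-> //|]; exact: lt.
- move=> lt; apply: (pathw_all_low wn) => //; first by rewrite /= sc.
  by apply/(all_nthP 0%N) => i; rewrite /= sc; apply: lt.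
- by right.
Qed.

End Vanishing.

Lemma states_mem n w W St : St \in states n.+1 w W -> exists c ks,
  [/\ St = (0%N :: c, ks), size c = n, sumn c = W, kval w (0%N :: c) ks &
      pathend w (0%N :: c) ks = 0%N :: c].
Proof.
rewrite /states => /allpairsPdep[c0 [ks [/mapP[c cc ->]]]].
rewrite mem_filter => /andP[/eqP pe /kseqs_kval kv] ->; exists c, ks; split=> //.
  by move: cc; rewrite mem_comps => /andP[/eqP].
by move: cc; rewrite mem_comps => /andP[_ /eqP].
Qed.

Lemma knot_size n w : all (fun g => g < n)%N w -> is_knot n.+1 w ->
  exists e, size w = (n + 2 * e)%N.
Proof.
move=> wn kn; have le : (n <= size w)%N.
  rewrite -[X in (X <= _)%N](size_iota 0 n); apply: uniq_leq_size; first exact: iota_uniq.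
  by move=> g; rewrite mem_iota /= => gn; apply: knot_occurs kn gn.
have := knot_parity wn kn => par.
have : ~~ odd (size w - n) by rewrite oddB // par addbb.
by move=> ev; exists (size w - n)./2; rewrite mul2n even_halfK // subnKC.
Qed.

(** The prefactor cancels the cost of [n] crossings; what remains is the excess length [2 * e] and
    the moving cost, which is at least [2 * W]. The last clause will single out the unknot. *)
Lemma contrib_term n w W St m : all (fun g => g < n)%N w -> is_knot n.+1 w ->
  St \in states n.+1 w W -> m \in contrib n.+1 w St ->
  exists a b : nat, [/\ m.2.1 = Posz (2 * a)%N, m.2.2 = - Posz (2 * (W + b))%N &
    (W + b = 0)%N -> size w = n].
Proof.
move=> wn kn /states_mem[c [ks [-> sc sumc kv pe]]] /=; rewrite /contrib /= add0n sumc.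
have [l [cE lW]] := weight_le_cost wn kv sc pe (fun g gn => knot_occurs kn gn).
have [e eE] := knot_size wn kn.
pose P (u : int * int) := u = (- Posz (n + 2 * W)%N, Posz n).
move=> mm; have : exists x y : nat,
   m.2.1 = - Posz (n + 2 * W)%N + (Posz (cost w (0%N :: c) ks) + Posz (2 * x)%N) /\
   m.2.2 = Posz n - (Posz (cost w (0%N :: c) ks) + Posz (2 * y)%N).
  move: m mm; apply: (@mem_lmul P (expo_from (cost w (0%N :: c) ks) (cost w (0%N :: c) ks))
    (fun u => exists x y : nat, u.1 = - Posz (n + 2 * W)%N + (Posz (cost w (0%N :: c) ks) + Posz (2 * x)%N) /\
   u.2 = Posz n - (Posz (cost w (0%N :: c) ks) + Posz (2 * y)%N))).
  - by move=> m; rewrite inE => /eqP ->.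
  - by move=> m; apply: pathw_term.
  - by move=> u v -> [x [y [-> ->]]] /=; exists x, y.
case=> x [y [-> ->]]; exists (e + l - W + x)%N, (e + l - W + y)%N.
by rewrite cE eE; rewrite sumc in lW; split; lia.
Qed.

(** * Markov invariance of the colored Jones polynomials *)

Section Field.
Variable F : fieldType.
Implicit Types (q z : F).

Definition generic q := q != 0 /\ forall n, q ^+ n.+1 != 1.

Lemma qfactF_neq0 q n : generic q -> qfact q n != 0.
Proof. by case=> _ qn; apply/prodf_neq0 => i _; rewrite subr_eq0 eq_sym. Qed.

Lemma genericV q : generic q -> generic q^-1.
Proof.
case=> q0 qn; split=> [|n]; first by rewrite invr_eq0.
by rewrite exprVn -invr1 (inj_eq invr_inj).
Qed.

Lemma gbinE q m k : generic q -> gbin q (m + k) k = qfact q (m + k) / (qfact q k * qfact q m).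
Proof.
move=> gq; rewrite -(gbin_fact q m k) mulfK //.
by rewrite mulf_neq0 // qfactF_neq0.
Qed.

Lemma gbin_sym q m k : generic q -> gbin q (m + k) k = gbin q (m + k) m.
Proof. by move=> gq; rewrite gbinE // [in RHS]addnC gbinE // addnC [qfact q k * _]mulrC. Qed.

Lemma gbin_inv q n k : q != 0 -> gbin q^-1 n k = q ^- (k * (n - k)) * gbin q n k.
Proof.
move=> q0; elim: n k => [|n IH] [|k]; rewrite ?gbin0 ?mul0n ?expr0 ?invr1 ?mulr1 //.
  by rewrite !gbin_small // mulr0.
have [nk|kn] := ltnP n k; first by rewrite !gbin_small // mulr0.
rewrite gbinS gbinS' !IH subSS exprVn.
have [nk1|kn1] := ltnP n k.+1.
  have -> : n = k by lia.
  by rewrite (@gbin_small _ _ k k.+1) // !mulr0 !addr0 subnn !muln0 !expr0 !invr1 !mul1r.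
have E : (n - k = (n - k.+1).+1)%N by lia.
rewrite E !mulnS mulSn !exprD; set X := q ^+ (k * _); set Y := q ^+ (n - k.+1).
rewrite (exprS q k) (exprS q (n - k.+1)) -/Y.
have hX : X != 0 by rewrite expf_neq0.
have hY : Y != 0 by rewrite expf_neq0.
have hk : q ^+ k != 0 by rewrite expf_neq0.
by field; rewrite hX hY hk q0.
Qed.

Lemma qpoch_inv q a l : q != 0 -> a != 0 ->
  qpoch q^-1 a^-1 l = (-1) ^+ l * a ^- l * q ^- 'C(l, 2) * qpoch q a l.
Proof.
move=> q0 a0; elim: l => [|l IH]; first by rewrite !qpoch0 !expr0 !invr1 !mulr1.
rewrite !qpochS IH binS bin1 exprD !exprS exprVn.
have hq : q ^+ l != 0 by rewrite expf_neq0.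
have hc : q ^+ 'C(l, 2) != 0 by rewrite expf_neq0.
have ha : a ^+ l != 0 by rewrite expf_neq0.
move: (q ^+ l) hq (q ^+ 'C(l, 2)) hc (a ^+ l) ha ((-1) ^+ l) (qpoch q a l) => x hx y hy w hw e p.
by field; rewrite a0 hx hy hw.
Qed.

Lemma qpoch_vanish q k l : q != 0 -> (l < k)%N -> qpoch q (q ^- l) k = 0.
Proof.
move=> q0 lk; rewrite /qpoch (bigD1 (Ordinal lk)) //= mulVf ?expf_neq0 //.
by rewrite subrr mul0r.
Qed.

Lemma gbin_mul q i k l : generic q -> (k + l <= i)%N ->
  gbin q i k * gbin q (i - k) l = gbin q i (k + l) * gbin q (k + l) k.
Proof.
move=> gq kli; set d := (i - (k + l))%N.
have -> : i = (d + l + k)%N by rewrite /d; lia.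
have -> : (d + l + k - k = d + l)%N by lia.
have E3 := gbinE d (k + l) gq; have E4 := gbinE l k gq.
rewrite (_ : (d + (k + l) = d + l + k)%N) in E3; last by lia.
rewrite (addnC l k) in E4; rewrite E3 E4 !gbinE //.
have h1 := qfactF_neq0 k gq; have h2 := qfactF_neq0 (d + l) gq.
have h3 := qfactF_neq0 l gq; have h4 := qfactF_neq0 d gq.
have h5 := qfactF_neq0 (k + l) gq.
by field; rewrite h1 h2 h3 h4 h5.
Qed.

(** Up to a common factor the sum is, by the [q]-binomial theorem, the product of the
    [1 - q^(l-M+1)] over [l < M], whose last factor is zero when [M > 0]. *)
Lemma rmx_inv_sum q z i j M : generic q -> z != 0 -> (M <= i)%N ->
  \sum_(k < M.+1) rmx q z i j k * rmx q^-1 z^-1 (i - k) (j + k) (M - k) = (M == 0%N)%:R.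
Proof.
move=> gq z0 Mi; have [q0 _] := gq.
transitivity (qpoch q (z ^+ 2 * q ^+ j) M * z ^- M * gbin q i M * q ^- ((i - M) * M) *
  \sum_(k < M.+1) (-1) ^+ (M - k) * q ^+ 'C(M - k, 2) * gbin q M (M - k) * (q ^- M.-1) ^+ (M - k)).
  rewrite mulr_sumr; apply: eq_bigr => -[k /= kM] _; rewrite ltnS in kM.
  set l := (M - k)%N; have El : M = (k + l)%N by rewrite /l; lia.
  set d := (i - M)%N; have Ei : i = (d + l + k)%N by rewrite /d; lia.
  have e1 : (i - k = d + l)%N by lia.
  have e2 : (d + l - l = d)%N by rewrite addnK.
  pose a := z ^+ 2 * q ^+ j * q ^+ k.
  have a0 : a != 0 by rewrite !mulf_neq0 ?expf_neq0.
  have ea : z^-1 ^+ 2 * q^-1 ^+ (j + k) = a^-1 by rewrite !exprVn -invfM exprD mulrA.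
  rewrite /rmx e1 e2 gbin_inv // e2 ea qpoch_inv // -/l.
  have -> : gbin q M l = gbin q M k by rewrite {1 2}El gbin_sym.
  have EG : gbin q i M * gbin q M k = gbin q i k * gbin q (d + l) l.
    by rewrite El -gbin_mul // ?e1 // -El.
  rewrite [in RHS]El qpochD -El -/a.
  transitivity (qpoch q (z ^+ 2 * q ^+ j) k * qpoch q a l * (gbin q i M * gbin q M k) * (-1) ^+ l *
     (z ^- M * (q ^- (d * M) * (q ^+ 'C(l, 2) * (q ^- M.-1) ^+ l)))); last by ring.
  rewrite EG; have -> : z ^- M * (q ^- (d * M) * (q ^+ 'C(l, 2) * (q ^- M.-1) ^+ l)) =
    q ^+ ((d + l) * j) * z ^+ (1 + (d + l) + j) * (q ^- (l * d) * q^-1 ^+ (d * (j + k)) *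
      z^-1 ^+ (1 + d + (j + k)) * (a ^- l * q ^- 'C(l, 2))); last by ring.
  have hh : q ^+ (M.-1 * l) = q ^+ (k * l) * q ^+ 'C(l, 2) * q ^+ 'C(l, 2).
    rewrite -!exprD; congr (_ ^+ _); have := mul_bin_diag l 1; rewrite bin1 El.
    by case: (l) => [|l'] /= h2; rewrite ?muln0 // addnS /= mulnDl [(l' * _)%N]mulnC h2; lia.
  have zz : z ^+ (1 + (d + l) + j) * z ^+ M = z ^+ (1 + d + (j + k)) * (z ^+ 2) ^+ l.
    by rewrite -exprM -!exprD; congr (_ ^+ _); rewrite El; lia.
  have qq : q ^+ ((d + l) * j) * q ^+ (d * M) * q ^+ (k * l) =
     q ^+ (l * d) * q ^+ (d * (j + k)) * (q ^+ j * q ^+ k) ^+ l.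
    by rewrite -(exprD q j k) -exprM -!exprD; congr (_ ^+ _); rewrite El; ring.
  have hM : q ^+ (d * M) != 0 by rewrite expf_neq0.
  have hz : z ^+ M != 0 by rewrite expf_neq0.
  have hkl : q ^+ (k * l) != 0 by rewrite expf_neq0.
  have hc : q ^+ 'C(l, 2) != 0 by rewrite expf_neq0.
  have hld : q ^+ (l * d) != 0 by rewrite expf_neq0.
  have hdjk : q ^+ (d * (j + k)) != 0 by rewrite expf_neq0.
  have hz2 : z ^+ (1 + d + (j + k)) != 0 by rewrite expf_neq0.
  have hzl : (z ^+ 2) ^+ l != 0 by rewrite !expf_neq0.
  have hql : (q ^+ j * q ^+ k) ^+ l != 0 by rewrite expf_neq0 // mulf_neq0 // expf_neq0.
  have -> : a ^+ l = (z ^+ 2) ^+ l * (q ^+ j * q ^+ k) ^+ l by rewrite -exprMn mulrA.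
  rewrite !exprVn -(exprM q M.-1 l) hh.
  have -> : z ^+ (1 + (d + l) + j) = z ^+ (1 + d + (j + k)) * (z ^+ 2) ^+ l / z ^+ M.
    by rewrite -zz mulfK.
  have -> : q ^+ ((d + l) * j) = q ^+ (l * d) * q ^+ (d * (j + k)) * (q ^+ j * q ^+ k) ^+ l /
     (q ^+ (d * M) * q ^+ (k * l)).
    rewrite -qq; move: (q ^+ (d * M)) hM (q ^+ (k * l)) hkl => x1 y1 x2 y2.
    by field; rewrite y1 y2.
  move: hM hz hkl hc hld hdjk hz2 hzl hql.
  move: (q ^+ (d * M)) (z ^+ M) (q ^+ (k * l)) (q ^+ 'C(l, 2)) (q ^+ (l * d)) (q ^+ (d * (j + k)))
    (z ^+ (1 + d + (j + k))) ((z ^+ 2) ^+ l) ((q ^+ j * q ^+ k) ^+ l).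
  move=> x1 x2 x3 x4 x5 x6 x7 x8 x9 y1 y2 y3 y4 y5 y6 y7 y8 y9.
  by field; rewrite y1 y2 y3 y4 y5 y6 y7 y8 y9.
case: M Mi => [|M] Mi.
  by rewrite big_ord1 /= qpoch0 gbin0 !expr0 muln0 expr0 !invr1 !mulr1.
rewrite (reindex_inj rev_ord_inj) /=.
under eq_bigr => k _ do rewrite subSS subKn -1?ltnS //.
by rewrite -qbinomial_theorem qpoch_vanish // mulr0.
Qed.

End Field.

Lemma big_ord_ext0 (V : nmodType) n m (G : nat -> V) : (n <= m)%N ->
  (forall i, (n <= i < m)%N -> G i = 0) -> \sum_(i < m) G i = \sum_(i < n) G i.
Proof.
move=> nm G0; rewrite -!(big_mkord xpredT) (@big_cat_nat _ _ _ n) //=.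
by rewrite [X in _ + X]big_nat_cond [X in _ + X]big1 ?addr0 // => i /andP[/G0].
Qed.

Lemma big_ord_triangle (V : nmodType) n (G : nat -> nat -> V) :
  \sum_(k < n) \sum_(i < k.+1) G i (k - i)%N = \sum_(i < n) \sum_(j < n - i) G i j.
Proof.
elim: n => [|n IH]; first by rewrite !big_ord0.
rewrite big_ord_recr IH [RHS]big_ord_recr /= subSnn big_ord1.
rewrite big_ord_recr /= subnn addrA -big_split; congr (_ + _).
apply: eq_bigr => -[i ip] _ /=; rewrite subSn; last exact: ltnW.
by rewrite big_ord_recr.
Qed.

Section PairOperators.
Variable F : fieldType.
Implicit Types (q z : F) (kap : nat -> nat -> nat -> F) (f : nat -> nat -> F).

(** The weight is preserved, so the new left number [m] determines the output. Operators act on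
    functionals, hence the first letter of a word is applied outermost. *)
Definition pairop kap f i j : F := \sum_(m < (i + j).+1) kap i j m * f m (i + j - m)%N.

Definition kp q z i j m : F := if (j <= m)%N then rmx q z i j (m - j) else 0.

Definition kn q z i j m : F := kp q^-1 z^-1 j i (i + j - m).

Lemma eq_pairop kap f h i j :
  (forall m, (m <= i + j)%N -> f m (i + j - m)%N = h m (i + j - m)%N) ->
  pairop kap f i j = pairop kap h i j.
Proof. by move=> fh; apply: eq_bigr => -[m mi] _; rewrite fh. Qed.

Lemma big_kp q z i j (G : nat -> F) :
  \sum_(m < (i + j).+1) kp q z i j m * G m = \sum_(k < i.+1) rmx q z i j k * G (j + k)%N.
Proof.
rewrite -(big_mkord xpredT (fun m => kp q z i j m * G m)).
rewrite -(big_mkord xpredT (fun k => rmx q z i j k * G (j + k)%N)) (@big_cat_nat _ _ _ j) //=; last by rewrite ltnW // ltnS leq_addl.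
rewrite big_nat_cond big1 ?add0r => [|m /andP[/andP[_ mj] _]]; last first.
  by rewrite /kp leqNgt mj mul0r.
rewrite -{1}[j]add0n big_addn -addSn addnK; apply: eq_bigr => k _.
by rewrite /kp leq_addl addnK addnC.
Qed.

Lemma pairop_kp q z f i j :
  pairop (kp q z) f i j = \sum_(k < i.+1) rmx q z i j k * f (j + k)%N (i - k)%N.
Proof.
rewrite /pairop (big_kp q z i j (fun m => f m (i + j - m)%N)); apply: eq_bigr => k _; congr (_ * f _ _).
by rewrite addnC subnDl.
Qed.

Lemma kp_kn q z i j m' : generic q -> z != 0 -> (m' <= i + j)%N ->
  \sum_(m < (i + j).+1) kp q z i j m * kn q z m (i + j - m) m' = (m' == i)%:R.
Proof.
move=> gq z0 m'ij; rewrite (big_kp q z i j (fun m => kn q z m (i + j - m) m')).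
have E (k : 'I_i.+1) : kn q z (j + k) (i + j - (j + k)) m' =
    if (k + m' <= i)%N then rmx q^-1 z^-1 (i - k) (j + k) (i - m' - k) else 0.
  have ki : (k <= i)%N by rewrite -ltnS.
  have e1 : (i + j - (j + k) = i - k)%N by lia.
  have e2 : (j + k + (i - k) - m' = i + j - m')%N by lia.
  rewrite /kn /kp e1 e2.
  have -> : (j + k <= i + j - m')%N = (k + m' <= i)%N by lia.
  by have -> : (i + j - m' - (j + k) = i - m' - k)%N by lia.
under eq_bigr => k _ do rewrite E.
have [m'i|im'] := leqP m' i; last first.
  rewrite big1 => [|k _]; first by rewrite gtn_eqF.
  by rewrite ifF ?mulr0 //; lia.
rewrite (@big_ord_ext0 _ (i - m').+1 _ (fun k => rmx q z i j k * (if (k + m' <= i)%N then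
  rmx q^-1 z^-1 (i - k) (j + k) (i - m' - k) else 0))); last first.
- by move=> k hk; rewrite ifF ?mulr0 //; lia.
- by rewrite ltnS leq_subr.
rewrite -[RHS](_ : ((i - m')%N == 0%N)%:R = _); last first.
  by congr (_%:R); rewrite subn_eq0 eqn_leq m'i.
rewrite -(rmx_inv_sum j gq z0 (leq_subr m' i)); apply: eq_bigr => -[k /= hk] _.
by rewrite ifT //; lia.
Qed.

Lemma kn_kp q z i j m' : generic q -> z != 0 -> (m' <= i + j)%N ->
  \sum_(m < (i + j).+1) kn q z i j m * kp q z m (i + j - m) m' = (m' == i)%:R.
Proof.
move=> gq z0 m'ij; have zV : z^-1 != 0 by rewrite invr_eq0.
have <- : ((i + j - m')%N == j)%:R = (m' == i)%:R :> F by congr (_%:R); lia.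
rewrite -(@kp_kn q^-1 z^-1 j i (i + j - m') (genericV gq) zV); last by lia.
rewrite (addnC j i) (reindex_inj rev_ord_inj) /=; apply: eq_bigr => -[m /= mw] _.
rewrite /kn !invrK subSS.
have -> : (i + j - (i + j - m) = m)%N by lia.
by have -> : (m + (i + j - m) - (i + j - m') = m')%N by lia.
Qed.

Lemma pairop_inv kap kap' f i j :
  (forall m', (m' <= i + j)%N ->
     \sum_(m < (i + j).+1) kap i j m * kap' m (i + j - m)%N m' = (m' == i)%:R) ->
  pairop kap (pairop kap' f) i j = f i j.
Proof.
move=> H; rewrite /pairop.
transitivity (\sum_(m' < (i + j).+1) (\sum_(m < (i + j).+1) kap i j m * kap' m (i + j - m)%N m') *
   f m' (i + j - m')%N).
  under [RHS]eq_bigr => m' _ do rewrite mulr_suml.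
  rewrite [RHS]exchange_big; apply: eq_bigr => -[m mi] _ /=.
  rewrite subnKC // mulr_sumr; apply: eq_bigr => m' _; rewrite mulrA.
  by [].
have ij : (i < (i + j).+1)%N by rewrite ltnS leq_addr.
rewrite (bigD1 (Ordinal ij)) //= H ?leq_addr // eqxx mul1r addKn.
rewrite big1 ?addr0 // => m'; rewrite -val_eqE /= => /negPf m'i.
by rewrite H ?m'i ?mul0r // -ltnS.
Qed.

(** Coproduct of a rescaled raising operator, which sends the delta function at [i - 1] to [1 - q^i]
    times the one at [i]; [z * q ^+ i] is the group-like factor. *)
Definition Eop q z f i j : F :=
  (1 - q ^+ i) * f i.-1 j + z * q ^+ i * (1 - q ^+ j) * f i j.-1.

Lemma gbin_down q d k : generic q ->
  gbin q (d + k).+1 k.+1 * (1 - q ^+ k.+1) = gbin q (d + k).+1 k * (1 - q ^+ d.+1) /\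
  gbin q (d + k).+1 k.+1 * (1 - q ^+ k.+1) = gbin q (d + k) k * (1 - q ^+ (d + k).+1).
Proof.
move=> gq; have E1 := gbinE d k.+1 gq; have E2 := gbinE d.+1 k gq; have E3 := gbinE d k gq.
rewrite addnS in E1; rewrite addSn in E2.
have [_ qn] := gq; have n1 := qn k; have n2 := qn d.
have h1 := qfactF_neq0 k gq; have h2 := qfactF_neq0 d gq.
rewrite E1 E2 E3 !qfactS.
have m1 : 1 - q ^+ k.+1 != 0 by rewrite subr_eq0 eq_sym.
have m2 : 1 - q ^+ d.+1 != 0 by rewrite subr_eq0 eq_sym.
move: (1 - _) m1 (1 - _) m2 (1 - q ^+ (d + k).+1) (qfact q k) h1 (qfact q d) h2 (qfact q (d + k)).
by move=> x1 y1 x2 y2 x3 x4 y4 x5 y5 x6; split; field; rewrite y1 ?y2 y4 y5.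
Qed.

(** Once indices are shifted so that both sides are combinations of the same values of [f],
    [gbin_down] brings the coefficients to a common Gaussian binomial and a polynomial identity
    remains. *)
Lemma pairop_kp_Eop q z f i j : generic q ->
  pairop (kp q z) (Eop q z f) i j = Eop q z (pairop (kp q z) f) i j.
Proof.
move=> gq; rewrite /Eop !pairop_kp; case: i => [|i].
  rewrite !big_ord1 !addn0 !subn0 expr0 subrr !mul0r add0r mulr0 mul0r addr0 /rmx /= !qpoch0.
  case: j => [|j]; first by rewrite expr0 subrr !mul0r !mulr0 mul0r.
  have -> : (1 + (0 - 0) + j.+1 = (1 + (0 - 0) + j).+1)%N by lia.
  by rewrite sub0n !mul0n /= exprS; ring.
under eq_bigr => k _ do rewrite mulrDr.
rewrite big_split /=.
rewrite [X in X + _ = _]big_ord_recl [X in _ + X = _]big_ord_recr /=.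
rewrite addn0 subn0 subnn expr0 subrr mulr0 mul0r mulr0 addr0.
have D0 : z * q ^+ i.+1 * (1 - q ^+ j) * (\sum_(k < i.+2) rmx q z i.+1 j.-1 k * f (j.-1 + k)%N (i.+1 - k)%N) =
  rmx q z i.+1 j 0 * ((1 - q ^+ j) * f j.-1 i.+1) +
  z * q ^+ i.+1 * (1 - q ^+ j) * (\sum_(k < i.+1) rmx q z i.+1 j.-1 k.+1 * f (j + k)%N (i - k)%N).
  case: (j) => [|j']; first by rewrite expr0 subrr mulr0 !mul0r mulr0 addr0.
  rewrite big_ord_recl /= mulrDr addn0 subn0; congr (_ + _).
    rewrite /rmx !gbin0 !qpoch0 !subn0 mulnS (exprD q i.+1).
    by rewrite (addnS (1 + i.+1) j') (exprS z (1 + i.+1 + j')) /=; ring.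
  by congr (_ * _); apply: eq_bigr => k _; rewrite /bump /= add1n subSS addSnnS.
rewrite D0 -!addrA [RHS]addrCA; congr (_ + _).
rewrite !mulr_sumr -[LHS]big_split -[RHS]big_split /=; apply: eq_bigr => -[k /= ki] _; rewrite ltnS in ki.
rewrite /bump /= add1n addnS /= subSS.
have Ei : i = ((i - k) + k)%N by lia.
move: Ei; set d := (i - k)%N => Ei.
have ed : (i.+1 - k = d.+1)%N by lia.
have [G1 G2] := gbin_down d k gq.
rewrite /rmx subSS ed -/d Ei.
clear D0; clearbody d; set Fv := f _ d.
have G2' : gbin q (d + k).+1 k * (1 - q ^+ d.+1) = gbin q (d + k).+1 k.+1 * (1 - q ^+ k.+1) by [].
have G0' : (1 - q ^+ (d + k).+1) * gbin q (d + k) k = gbin q (d + k).+1 k.+1 * (1 - q ^+ k.+1).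
  by rewrite G2 mulrC.
rewrite qpochS.
transitivity (gbin q (d + k).+1 k.+1 * qpoch q (z ^+ 2 * q ^+ j) k * Fv * q ^+ (d * j) *
  z ^+ (1 + d + j) * ((1 - z ^+ 2 * q ^+ j * q ^+ k) * (1 - q ^+ (j + k).+1) +
    q ^+ j * z ^+ 2 * q ^+ (j + k) * (1 - q ^+ k.+1))).
  transitivity (gbin q (d + k).+1 k.+1 * q ^+ (d * j) * z ^+ (1 + d + j) *
    (qpoch q (z ^+ 2 * q ^+ j) k * (1 - z ^+ 2 * q ^+ j * q ^+ k)) * ((1 - q ^+ (j + k).+1) * Fv) +
    (gbin q (d + k).+1 k * (1 - q ^+ d.+1)) * q ^+ (d.+1 * j) * z ^+ (1 + d.+1 + j) *
      qpoch q (z ^+ 2 * q ^+ j) k * (z * q ^+ (j + k) * Fv)); first by ring.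
  by rewrite G2' mulSn (exprD q j) (addnS 1 d) addSn (exprS z (1 + d + j)); ring.
transitivity (((1 - q ^+ (d + k).+1) * gbin q (d + k) k) * q ^+ (d * j) * z ^+ (1 + d + j) *
   qpoch q (z ^+ 2 * q ^+ j) k * Fv +
   z * q ^+ (d + k).+1 * (1 - q ^+ j) * (gbin q (d + k).+1 k.+1 * q ^+ (d * j.-1) *
     z ^+ (1 + d + j.-1) * qpoch q (z ^+ 2 * q ^+ j.-1) k.+1 * Fv)); last by ring.
rewrite G0'; case: (j) => [|j'].
  rewrite expr0 subrr mulr0 mul0r addr0 add0n !mulr1 mul1r !exprS; ring.
rewrite /= qpochSl mulnS (addnS (1 + d) j') (exprS z (1 + d + j')) -(addnS d k) (exprD q d k.+1).
rewrite -[z ^+ 2 * q ^+ j' * q]mulrA -exprSr (exprD q d).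
rewrite (addSn j' k) !(exprS q) (exprD q j' k); ring.
Qed.

End PairOperators.

Section YangBaxter.
Variable F : fieldType.
Implicit Types (q z : F) (f : nat -> nat -> F).

Definition qdesc q a k : F := \prod_(l < k) (1 - q ^+ (a - l)).

Lemma qdescS q a k : qdesc q a k.+1 = qdesc q a k * (1 - q ^+ (a - k)).
Proof. by rewrite /qdesc big_ord_recr. Qed.

Lemma qdesc_small q a k : (a < k)%N -> qdesc q a k = 0.
Proof.
by move=> ak; rewrite /qdesc (bigD1 (Ordinal ak)) //= subnn expr0 subrr mul0r.
Qed.

Lemma gbin_qdesc q a k : generic q -> gbin q a k * qfact q k = qdesc q a k.
Proof.
move=> gq; have [ak|ka] := ltnP a k; first by rewrite gbin_small // mul0r qdesc_small.
elim: k ka => [|k IH] ka; first by rewrite gbin0 qfact0 mulr1 /qdesc big_ord0.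
have Ea : a = ((a - k.+1) + k).+1 by lia.
have ed : (a - k = (a - k.+1).+1)%N by lia.
have [G _] := gbin_down (a - k.+1) k gq; rewrite -Ea in G.
by rewrite qfactS [qfact q k * _]mulrC mulrA G mulrAC IH 1?ltnW // qdescS ed.
Qed.

Lemma sum_gbinS q k (G : nat -> F) :
  \sum_(i < k.+2) gbin q k.+1 i * G i =
  \sum_(i < k.+1) gbin q k i * (q ^+ (k - i) * G i.+1) + \sum_(i < k.+1) gbin q k i * G i.
Proof.
rewrite big_ord_recl gbin0 [X in _ = _ + X]big_ord_recl gbin0 addrCA; congr (_ + _).
under eq_bigr => i _ do rewrite gbinS' mulrDl.
rewrite big_split /=; congr (_ + _); first by apply: eq_bigr => i _; ring.
by rewrite big_ord_recr /= gbin_small // mul0r addr0.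
Qed.

(** The two summands of [Eop] commute up to a factor [q], so its powers are given by the
    noncommutative [q]-binomial theorem. *)
Lemma iter_Eop q z f a b k : iter k (Eop q z) f a b =
  \sum_(i < k.+1) gbin q k i * (qdesc q a i * qdesc q b (k - i) *
     (z * q ^+ (a - i)) ^+ (k - i) * f (a - i)%N (b - (k - i))%N).
Proof.
elim: k f a b => [|k IH] f a b.
  by rewrite big_ord1 /= /qdesc !big_ord0 expr0 !mul1r !subn0.
rewrite iterSr IH (sum_gbinS q k (fun i => qdesc q a i * qdesc q b (k.+1 - i) *
     (z * q ^+ (a - i)) ^+ (k.+1 - i) * f (a - i)%N (b - (k.+1 - i))%N)) -big_split /=.
apply: eq_bigr => -[i /= ik] _; rewrite ltnS in ik; rewrite -mulrDr; congr (_ * _).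
rewrite subSS subSn // /Eop; set k2 := (k - i)%N.
rewrite mulrDr; congr (_ + _); last by rewrite qdescS exprS -subnS; ring.
rewrite qdescS -subnS.
have [ai|ia] := leqP a i.
  have -> : (a - i = 0)%N by lia.
  by rewrite expr0 subrr !(mul0r, mulr0).
have -> : (a - i = (a - i.+1).+1)%N by lia.
by rewrite (exprS q (a - i.+1)) !exprMn; ring.
Qed.

(** Coefficient of the [k]-th power of [Eop] when a strand carrying [c] passes two strands of total
    weight [w]. Depending on these through [w] alone, it commutes with their crossing. *)
Definition hexc q z w c k : F :=
  q ^+ ((w - k) * c) * z ^+ (2 + (w - k) + 2 * c) * qpoch q (z ^+ 2 * q ^+ c) k / qfact q k.

(** Moving a strand past two others acts through the coproduct of the raising operator. *)
Lemma hexagon q z (h : nat -> nat -> nat -> F) a b c : generic q ->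
  \sum_(k2 < b.+1) rmx q z b c k2 *
    \sum_(k1 < a.+1) rmx q z a (c + k2) k1 * h (c + k2 + k1)%N (a - k1)%N (b - k2)%N =
  \sum_(k < (a + b).+1) hexc q z (a + b) c k * iter k (Eop q z) (h (c + k)%N) a b.
Proof.
move=> gq.
pose T k1 k2 := hexc q z (a + b) c (k1 + k2) * (gbin q (k1 + k2) k1 * (qdesc q a k1 * qdesc q b k2 *
     (z * q ^+ (a - k1)) ^+ k2 * h (c + (k1 + k2))%N (a - k1)%N (b - k2)%N)).
have -> : \sum_(k < (a + b).+1) hexc q z (a + b) c k * iter k (Eop q z) (h (c + k)%N) a b =
   \sum_(k < (a + b).+1) \sum_(i < k.+1) T i (k - i)%N.
  apply: eq_bigr => k _; rewrite iter_Eop mulr_sumr; apply: eq_bigr => -[i /= ik] _.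
  by rewrite /T subnKC.
rewrite big_ord_triangle (@big_ord_ext0 _ a.+1 _ (fun i => \sum_(j < (a + b).+1 - i) T i j)).
- rewrite (eq_bigr (fun k1 : 'I_a.+1 => \sum_(k2 < b.+1) T k1 k2)); last first.
    move=> -[i /= ia] _; rewrite ltnS in ia; apply: big_ord_ext0 => [|j bj]; first by lia.
    by rewrite /T (@qdesc_small _ b) ?mulr0 ?mul0r ?mulr0 //; lia.
  rewrite exchange_big /=; apply: eq_bigr => -[k2 /= k2b] _; rewrite ltnS in k2b.
  rewrite mulr_sumr; apply: eq_bigr => -[k1 /= k1a] _; rewrite ltnS in k1a.
  rewrite /T /hexc (_ : c + k2 + k1 = c + (k1 + k2))%N; last by lia.
  rewrite mulrA [RHS](_ : _ = hexc q z (a + b) c (k1 + k2) * gbin q (k1 + k2) k1 * qdesc q a k1 *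
    qdesc q b k2 * (z * q ^+ (a - k1)) ^+ k2 * h (c + (k1 + k2))%N (a - k1)%N (b - k2)%N).
    congr (_ * h _ _ _); rewrite -!gbin_qdesc // /hexc /rmx.
    have E := gbinE k2 k1 gq; rewrite (addnC k2 k1) in E; rewrite E.
    have h1 := qfactF_neq0 k1 gq; have h2 := qfactF_neq0 k2 gq; have h3 := qfactF_neq0 (k1 + k2) gq.
    have -> : qpoch q (z ^+ 2 * q ^+ c) (k1 + k2) =
       qpoch q (z ^+ 2 * q ^+ c) k2 * qpoch q (z ^+ 2 * q ^+ (c + k2)) k1.
      by rewrite addnC qpochD exprD mulrA.
    have -> : (2 + (a + b - (k1 + k2)) + 2 * c = (1 + (b - k2) + c) + (1 + (a - k1) + c))%N by lia.
    have -> : ((a + b - (k1 + k2)) * c = (b - k2) * c + (a - k1) * c)%N.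
      by rewrite -mulnDl; congr (_ * _)%N; lia.
    have -> : (1 + (a - k1) + (c + k2) = (1 + (a - k1) + c) + k2)%N by lia.
    rewrite mulnDr exprMn -(exprM q (a - k1)) !(exprD z (1 + (a - k1) + c)) (exprD z (1 + (b - k2) + c)).
    rewrite !(exprD q (_ * c)).
    move: (qfact q k1) h1 (qfact q k2) h2 (qfact q (k1 + k2)) h3 => x1 y1 x2 y2 x3 y3.
    move: (qpoch _ _ _) (qpoch _ _ _) (gbin q a k1) (gbin q b k2) => p1 p2 g1 g2.
    move: (q ^+ (_ * _)) (q ^+ (_ * _)) (q ^+ (_ * _)) (z ^+ (_ + _)) (z ^+ (_ + _)) (z ^+ k2).
    by move=> u1 u2 u3 u4 u5 u6; field; rewrite y1 y2 y3.
  by rewrite /hexc; ring.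
- by rewrite ltnS leq_addr.
move=> i ia; rewrite big1 // => j _.
by rewrite /T (@qdesc_small _ a) ?mul0r ?mulr0 //; lia.
Qed.

End YangBaxter.

Section Stabilisation.
Variable F : fieldType.
Implicit Types (q z : F).

Lemma stab_pos_sum q Z i :
  \sum_(m < i.+1) gbin q i m * (q ^+ (m * m.-1) * Z ^+ m * qpoch q (Z * q ^+ m) (i - m)) = 1.
Proof.
elim: i Z => [|i IH] Z; first by rewrite big_ord1 /= qpoch0 !mulr1.
rewrite (sum_gbinS q i (fun m => q ^+ (m * m.-1) * Z ^+ m * qpoch q (Z * q ^+ m) (i.+1 - m))).
transitivity (Z * q ^+ i * (\sum_(m < i.+1) gbin q i m * (q ^+ (m * m.-1) * (Z * q) ^+ m *
   qpoch q (Z * q * q ^+ m) (i - m))) + (1 - Z * q ^+ i) * (\sum_(m < i.+1) gbin q i m *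
   (q ^+ (m * m.-1) * Z ^+ m * qpoch q (Z * q ^+ m) (i - m)))); last by rewrite !IH; ring.
rewrite !mulr_sumr; congr (_ + _); apply: eq_bigr => -[m /= mi] _; rewrite ltnS in mi.
  rewrite subSS -[Z * q * q ^+ m]mulrA -exprS.
  have -> : q ^+ (m.+1 * m) = q ^+ (m * m.-1) * q ^+ m * q ^+ m.
    by rewrite -!exprD; congr (_ ^+ _); case: (m) => //= m'; rewrite mulSn mulnS; lia.
  have -> : q ^+ i = q ^+ (i - m) * q ^+ m by rewrite -exprD subnK.
  by rewrite exprMn (exprS Z m); ring.
rewrite subSn // qpochS -[Z * q ^+ m * q ^+ _]mulrA -exprD subnKC //; ring.
Qed.

(** Closing a positive kink: the terms with [j > i] vanish, so the sum does not depend on the cutoff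
    [n]. *)
Lemma stab_pos q z n i : generic q -> z != 0 -> (i < n)%N ->
  \sum_(j < n) z^-1 * q ^- j * kp q z i j i = 1.
Proof.
move=> gq z0 ni; have [q0 _] := gq.
rewrite (@big_ord_ext0 _ i.+1 _ (fun j => z^-1 * q ^- j * kp q z i j i)) => [||j /andP[ij _]] //; last first.
  by rewrite /kp leqNgt ij mulr0.
rewrite -[RHS](stab_pos_sum q (z ^+ 2) i); apply: eq_bigr => -[m /= mi] _; rewrite ltnS in mi.
rewrite /kp mi /rmx subKn //.
have -> : gbin q i (i - m) = gbin q i m by have := gbin_sym (i - m) m gq; rewrite subnK.
have -> : q ^+ (m * m) = q ^+ (m * m.-1) * q ^+ m.
  by rewrite -exprD; congr (_ ^+ _); case: (m) => //= m'; rewrite mulnS addnC.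
have -> : z ^+ (1 + m + m) = z * (z ^+ 2) ^+ m.
  by rewrite -exprM -exprS; congr (_ ^+ _); lia.
have qm : q ^+ m != 0 by rewrite expf_neq0.
by move: (q ^+ m) qm ((z ^+ 2) ^+ m) (qpoch _ _ _) => x x0 y p; field; rewrite z0 x0.
Qed.

Lemma stab_neg_sum q p M :
  \sum_(k < M.+1) gbin q M k * (p ^+ (M - k) * qpoch q p k) = 1.
Proof.
elim: M => [|M IH]; first by rewrite big_ord1 /= qpoch0 !mulr1.
rewrite big_ord_recl gbin0.
under eq_bigr => k _ do rewrite gbinS mulrDl.
rewrite big_split /= addrCA; set S2 := \sum_(i < M.+1) q ^+ i.+1 * _ * _.
have -> : 1 * (p ^+ (M.+1 - 0) * qpoch q p 0) + S2 =
    \sum_(k < M.+1) q ^+ k * gbin q M k * (p ^+ (M.+1 - k) * qpoch q p k).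
  rewrite [RHS]big_ord_recl gbin0 expr0 mulr1; congr (_ + _).
  rewrite /S2 big_ord_recr /= gbin_small // mulr0 mul0r addr0.
  by apply: eq_bigr => k _.
rewrite -big_split -[RHS]IH; apply: eq_bigr => -[k /= kM] _; rewrite ltnS in kM.
by rewrite subSS subSn // qpochS exprS; ring.
Qed.

Lemma qpoch_qfact q i k : generic q -> qpoch q (q ^+ i.+1) k = gbin q (i + k) k * qfact q k.
Proof.
move=> gq; rewrite gbinE //; elim: k => [|k IH].
  rewrite addn0 qpoch0 qfact0 mul1r mulr1 divff //; exact: qfactF_neq0.
rewrite qpochS IH addnS !qfactS -exprD addSn.
have h1 := qfactF_neq0 k gq; have h2 := qfactF_neq0 i gq; have [_ /(_ k)] := gq.
rewrite eq_sym -subr_eq0; move: (1 - q ^+ k.+1) (1 - _) => x y x0.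
by move: (qfact q k) h1 (qfact q i) h2 (qfact q (i + k)) => a a0 b b0 c; field; rewrite a0 b0 x0.
Qed.

(** For a negative kink the terms with [j >= i] survive, and only the cutoff makes the sum finite;
    the relation between [z] and [n] says [x = q^n], so that the cutoff is that of the
    [n]-dimensional quotient. *)
Lemma stab_neg q z n i : generic q -> z != 0 -> z ^+ 2 * q ^+ n = q -> (i < n)%N ->
  \sum_(j < n) z^-1 * q ^- j * kn q z i j i = 1.
Proof.
move=> gq z0 zn ni; have [q0 _] := gq; set M := (n - i.+1)%N.
have En : n = (i + M.+1)%N by rewrite /M; lia.
have zE : z^-1 ^+ 2 = q ^+ (i + M).
  rewrite exprVn; apply: (mulfI (expf_neq0 2 z0)); rewrite divff ?expf_neq0 //.
  by apply: (mulfI q0); rewrite mulr1 -[LHS]zn En addnS (exprS q); ring.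
rewrite -(big_mkord xpredT (fun j => z^-1 * q ^- j * kn q z i j i)) {1}En.
rewrite (@big_cat_nat _ _ _ i) ?leq_addr //= big_nat_cond big1 ?add0r; last first.
  by move=> j /andP[/andP[_ ji] _]; rewrite /kn addKn /kp leqNgt ji mulr0.
rewrite -{1}[i]add0n big_addn addKn big_mkord.
rewrite -[RHS](stab_neg_sum q (q ^+ i.+1) M); apply: eq_bigr => -[k /= kM] _; rewrite ltnS in kM.
rewrite /kn /kp (_ : (i + (k + i) - i)%N = (k + i)%N); last by lia.
rewrite leq_addl addnK /rmx addKn (addnC k i) gbin_inv // zE addnK.
have -> : qpoch q^-1 (q ^+ (i + M) * q^-1 ^+ i) k = qdesc q M k.
  rewrite /qpoch /qdesc; apply: eq_bigr => -[l /= lk] _; congr (1 - _).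
  have lM : (l <= M)%N by exact: leq_trans (ltnW lk) kM.
  rewrite !exprVn addnC exprD mulfK ?expf_neq0 // -{1}(subnK lM) exprD mulfK ?expf_neq0 //.
rewrite -gbin_qdesc // qpoch_qfact //.
have -> : z^-1 ^+ (1 + i + i) = z * (q ^+ (i + M)) ^+ i.+1.
  rewrite -zE -exprM; apply: (mulfI (invr_neq0 z0)); rewrite mulKf // -exprS.
  by congr (_ ^+ _); lia.
rewrite !exprVn.
have E : (q ^+ (i + M)) ^+ i.+1 = q ^+ (i + k) * q ^+ (k * i) * q ^+ (i * i) * (q ^+ i.+1) ^+ (M - k).
  rewrite -!exprM -!exprD; congr (_ ^+ _); have -> : M = ((M - k) + k)%N by lia.
  by rewrite addnK; ring.
rewrite E.
have h1 : q ^+ (i + k) != 0 by rewrite expf_neq0.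
have h2 : q ^+ (k * i) != 0 by rewrite expf_neq0.
have h3 : q ^+ (i * i) != 0 by rewrite expf_neq0.
move: (q ^+ (i + k)) h1 (q ^+ (k * i)) h2 (q ^+ (i * i)) h3 => a a0 b b0 c c0.
by field; rewrite a0 b0 c0 z0.
Qed.

End Stabilisation.

(** * Operators on all strands *)

Definition put g x y (c : seq nat) : seq nat := set_nth 0%N (set_nth 0%N c g x) g.+1 y.

Lemma size_put g x y c : (g.+1 < size c)%N -> size (put g x y c) = size c.
Proof. by move=> h; rewrite /put !size_set_nth; lia. Qed.

Lemma nth_put g x y c i : nth 0%N (put g x y c) i =
  if i == g.+1 then y else if i == g then x else nth 0%N c i.
Proof. by rewrite /put !nth_set_nth /= nth_set_nth. Qed.

Lemma put_id g c : (g.+1 < size c)%N -> put g (nth 0%N c g) (nth 0%N c g.+1) c = c.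
Proof.
move=> gc; apply: nth_inj_size => [|i]; first exact: size_put.
by rewrite nth_put; case: eqP => [->|_] //; case: eqP => [->|].
Qed.

Lemma put_put g x y x' y' c : (g.+1 < size c)%N -> put g x y (put g x' y' c) = put g x y c.
Proof.
move=> gc; apply: nth_inj_size => [|i]; first by rewrite !size_put.
by rewrite !nth_put; case: eqP => // _; case: eqP.
Qed.

Lemma put_far g h x y x' y' c : (h.+1 < size c)%N -> (g.+1 < h)%N ->
  put g x y (put h x' y' c) = put h x' y' (put g x y c).
Proof.
move=> hc gh; have gc : (g.+1 < size c)%N by lia.
apply: nth_inj_size => [|i]; first by rewrite !size_put ?size_put.
rewrite !nth_put; case: (eqVneq i g.+1) => [->|_].
  by rewrite !ifF //; lia.
by case: (eqVneq i g) => [->|_] //; rewrite !ifF //; lia.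
Qed.

Lemma sumn_put g x y c : (g.+1 < size c)%N ->
  (sumn (put g x y c) + (nth 0 c g + nth 0 c g.+1) = sumn c + (x + y))%N.
Proof.
elim: g c => [|g IH] [|a c] //=; first by case: c => //= b c _; lia.
by rewrite ltnS => /IH; rewrite /put /=; lia.
Qed.

Section SequenceOperators.
Variable F : fieldType.
Implicit Types (q z : F) (kap : nat -> nat -> nat -> F) (f : seq nat -> F).

Definition sop kap g f c : F :=
  pairop kap (fun x y => f (put g x y c)) (nth 0%N c g) (nth 0%N c g.+1).

Lemma eq_sop kap g f h c : (g.+1 < size c)%N ->
  (forall e, size e = size c -> f e = h e) -> sop kap g f c = sop kap g h c.
Proof. by move=> gc fh; apply: eq_pairop => m _; rewrite fh ?size_put. Qed.

Lemma sop_inv kap kap' g f c : (g.+1 < size c)%N ->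
  (forall h i j, pairop kap (pairop kap' h) i j = h i j) ->
  sop kap g (sop kap' g f) c = f c.
Proof.
move=> gc H; rewrite -[in RHS](put_id gc) -(H (fun x y => f (put g x y c))).
apply: eq_pairop => m mi; rewrite /sop !nth_put eqxx eqn_leq ltnn andbF eqxx.
by apply: eq_pairop => m' _; rewrite put_put.
Qed.

Lemma sop_far kap kap' g h f c : (h.+1 < size c)%N -> (g.+1 < h)%N ->
  sop kap g (sop kap' h f) c = sop kap' h (sop kap g f) c.
Proof.
move=> hc gh; have gc : (g.+1 < size c)%N by lia.
have n1 x y : nth 0%N (put g x y c) h = nth 0%N c h by rewrite nth_put !ifF //; lia.
have n2 x y : nth 0%N (put g x y c) h.+1 = nth 0%N c h.+1 by rewrite nth_put !ifF //; lia.
have n3 x y : nth 0%N (put h x y c) g = nth 0%N c g by rewrite nth_put !ifF //; lia.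
have n4 x y : nth 0%N (put h x y c) g.+1 = nth 0%N c g.+1 by rewrite nth_put !ifF //; lia.
rewrite /sop /pairop.
under eq_bigr => m _ do rewrite n1 n2 mulr_sumr.
under [RHS]eq_bigr => m _ do rewrite n3 n4 mulr_sumr.
rewrite exchange_big; apply: eq_bigr => m _; apply: eq_bigr => m' _ /=.
by rewrite mulrCA (put_far _ _ _ _ hc gh).
Qed.

(** By [hexagon], passing the third strand across the first two acts on these through powers of
    [Eop], with coefficients depending on their total weight; such an operator commutes with the
    crossing of the two. *)
Lemma sop_kp_braid q z g f c : generic q -> (g.+2 < size c)%N ->
  sop (kp q z) g (sop (kp q z) g.+1 (sop (kp q z) g f)) c =
  sop (kp q z) g.+1 (sop (kp q z) g (sop (kp q z) g.+1 f)) c.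
Proof.
move=> gq; elim: g f c => [|g IH] f [|a c] //=; last first.
  by move=> gc; apply: (IH (fun e => f (a :: e)) c gc).
case: c => [|b [|d c]] // _.
pose h (f' : seq nat -> F) u v x := f' [:: u, v, x & c].
have hex f' a' b' d' : sop (kp q z) 1 (sop (kp q z) 0 f') [:: a', b', d' & c] =
   \sum_(k < (a' + b').+1) hexc q z (a' + b') d' k * iter k (Eop q z) (h f' (d' + k)%N) a' b'.
  rewrite -hexagon // {1}/sop pairop_kp; apply: eq_bigr => k _; congr (_ * _).
  by rewrite /sop pairop_kp.
have iterE k (f1 f2 : nat -> nat -> F) i j : (forall x y, f1 x y = f2 x y) ->
    iter k (Eop q z) f1 i j = iter k (Eop q z) f2 i j.
  by elim: k i j => [|k IHk] i j E //=; rewrite /Eop !IHk.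
have pull k (f1 : nat -> nat -> F) i j : pairop (kp q z) (iter k (Eop q z) f1) i j =
    iter k (Eop q z) (pairop (kp q z) f1) i j.
  elim: k f1 i j => [|k IHk] f1 i j //; rewrite [in LHS]iterSr IHk [in RHS]iterSr.
  by apply: iterE => x y; apply: pairop_kp_Eop.
rewrite hex {1}/sop /=.
transitivity (pairop (kp q z) (fun x y =>
  \sum_(k < (x + y).+1) hexc q z (x + y) d k * iter k (Eop q z) (h f (d + k)%N) x y) a b).
  by apply: eq_pairop => m _; rewrite -hex.
rewrite /pairop.
transitivity (\sum_(m < (a + b).+1) \sum_(k < (a + b).+1) kp q z a b m *
   (hexc q z (a + b) d k * iter k (Eop q z) (h f (d + k)%N) m (a + b - m)%N)).
  by apply: eq_bigr => -[m /= mab] _; rewrite subnKC // mulr_sumr.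
rewrite exchange_big; apply: eq_bigr => k _ /=.
under eq_bigr => m _ do rewrite mulrCA.
rewrite -mulr_sumr; congr (_ * _).
have := pull k (h f (d + k)%N) a b; rewrite {1}/pairop => ->.
by apply: iterE => x y.
Qed.

Fixpoint Eseq q z f (c : seq nat) : F :=
  match c with
  | [::] => 0
  | a :: c' => (1 - q ^+ a) * f (a.-1 :: c') + z * q ^+ a * Eseq q z (fun e => f (a :: e)) c'
  end.

Lemma eq_Eseq q z f h c : (forall e, size e = size c -> f e = h e) ->
  Eseq q z f c = Eseq q z h c.
Proof.
elim: c f h => [|a c IH] f h fh //=; rewrite fh // (IH _ (fun e => h (a :: e))) // => e se.
by apply: fh; rewrite /= se.
Qed.

Lemma Eseq_sum q z (I : Type) (r : seq I) (x : I -> F) (f : I -> seq nat -> F) c :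
  Eseq q z (fun e => \sum_(i <- r) x i * f i e) c = \sum_(i <- r) x i * Eseq q z (f i) c.
Proof.
elim: c f => [|a c IH] f /=; first by rewrite big1 // => i _; rewrite mulr0.
rewrite (IH (fun i e => f i (a :: e))) !mulr_sumr -big_split; apply: eq_bigr => i _ /=; ring.
Qed.

Lemma sop_Eseq q z kap g f c : (g.+1 < size c)%N ->
  (forall h i j, pairop kap (Eop q z h) i j = Eop q z (pairop kap h) i j) ->
  sop kap g (Eseq q z f) c = Eseq q z (sop kap g f) c.
Proof.
move=> gc H; elim: g f c gc => [|g IH] f [|a c] //=; last first.
  move=> gc; have E := IH (fun e => f (a :: e)) c gc.
  transitivity ((1 - q ^+ a) * sop kap g (fun e => f (a.-1 :: e)) c +
     z * q ^+ a * Eseq q z (sop kap g (fun e => f (a :: e))) c); last by [].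
  rewrite -E /sop /pairop !mulr_sumr -big_split; apply: eq_bigr => m _ /=.
  by rewrite mulrDr; congr (_ + _); rewrite mulrCA.
case: c => [|b c] // _.
pose h x y := f [:: x, y & c].
pose T x y := Eseq q z (fun e => f [:: x, y & e]) c.
have E x y : Eseq q z f [:: x, y & c] = Eop q z h x y + z * q ^+ x * (z * q ^+ y) * T x y.
  by rewrite /= /Eop /h /T; ring.
transitivity (pairop kap (fun x y => Eop q z h x y + z * q ^+ x * (z * q ^+ y) * T x y) a b).
  by apply: eq_pairop => m _; rewrite -E.
transitivity (Eop q z (pairop kap h) a b + z * q ^+ a * (z * q ^+ b) * pairop kap T a b).
  rewrite -H /pairop mulr_sumr -big_split; apply: eq_bigr => -[m /= mab] _.
  rewrite mulrDr; congr (_ + _); rewrite [RHS]mulrCA; congr (_ * (_ * _)).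
  have -> : z * q ^+ m * (z * q ^+ (a + b - m)) = z * z * (q ^+ m * q ^+ (a + b - m)) by ring.
  by rewrite -exprD subnKC // exprD; ring.
have -> : pairop kap T a b = Eseq q z (fun e => sop kap 0 f [:: a, b & e]) c.
  rewrite /pairop -(Eseq_sum q z (index_enum 'I_(a + b).+1) (fun m => kap a b m)
    (fun m e => f [:: nat_of_ord m, (a + b - m)%N & e])).
  by [].
by rewrite /= /Eop /sop /= /h; ring.
Qed.

End SequenceOperators.

(** * The finite-dimensional quotient, its traces and the Markov moves *)

Fixpoint cfgs n N : seq (seq nat) :=
  if N is N'.+1 then [seq a :: c | a <- iota 0 n, c <- cfgs n N'] else [:: [::]].

Lemma mem_cfgs n N c : (c \in cfgs n N) = (size c == N) && all (fun a => a < n)%N c.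
Proof.
elim: N c => [|N IH] [|a c] //=.
  by apply/allpairsP => -[[x y] []].
apply/allpairsP/idP => [[[x y] /= [xn yc [-> ->]]]|].
  by move: yc; rewrite IH eqSS => /andP[-> ->]; move: xn; rewrite mem_iota /= => ->.
rewrite eqSS => /and3P[sc an ac]; exists (a, c); split=> //=; last by rewrite IH sc ac.
by rewrite mem_iota.
Qed.

Lemma uniq_cfgs n N : uniq (cfgs n N).
Proof.
elim: N => //= N IH; apply: allpairs_uniq; rewrite ?iota_uniq //.
by move=> [a c] [b d] _ _ /= [-> ->].
Qed.

Lemma big_cfgsS (V : nmodType) n N (f : seq nat -> V) :
  \sum_(c <- cfgs n N.+1) f c = \sum_(a < n) \sum_(c <- cfgs n N) f (nat_of_ord a :: c).
Proof.
rewrite /= big_allpairs_dep -(big_mkord xpredT (fun a => \sum_(c <- cfgs n N) f (a :: c))).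
by rewrite /index_iota subn0.
Qed.

Arguments cfgs : simpl never.

Lemma big_cfgs_rcons (V : nmodType) n N (f : seq nat -> V) :
  \sum_(c <- cfgs n N.+1) f c = \sum_(c <- cfgs n N) \sum_(a < n) f (rcons c a).
Proof.
elim: N f => [|N IH] f.
  by rewrite big_cfgsS /cfgs big_seq1; apply: eq_bigr => a _; rewrite big_seq1.
rewrite big_cfgsS [RHS]big_cfgsS; apply: eq_bigr => b _.
exact: (IH (fun c => f (nat_of_ord b :: c))).
Qed.

Section Markov.
Variables (F : fieldType) (q z : F) (n : nat).
Hypotheses (gq : generic q) (z0 : z != 0) (zn : z ^+ 2 * q ^+ n = q) (n0 : (0 < n)%N).
Let q0 : q != 0. Proof. by case: gq. Qed.

Definition kap (e : bool) : nat -> nat -> nat -> F := if e then kp q z else kn q z.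

Lemma kap_inv e h i j : pairop (kap e) (pairop (kap (~~ e)) h) i j = h i j.
Proof.
by apply: pairop_inv => m' ?; case: e; [apply: kp_kn | apply: kn_kp].
Qed.

Lemma kap_Eop e h i j : pairop (kap e) (Eop q z h) i j = Eop q z (pairop (kap e) h) i j.
Proof.
case: e; first exact: pairop_kp_Eop.
rewrite -[RHS](kap_inv false); apply: eq_pairop => m _ /=.
rewrite pairop_kp_Eop // /Eop; congr (_ * _ + _ * _).
  by rewrite -[LHS](kap_inv true).
by rewrite -[LHS](kap_inv true).
Qed.

(** Raising [j < n] to at least [n] involves the factor with [l = n - 1 - j] of the product, which
    is [1 - z^2 q^(n-1) = 0]. *)
Lemma kp_local (q' z' : F) i j m : q' != 0 -> z' ^+ 2 * q' ^+ n = q' ->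
  (i < n)%N -> (j < n)%N -> kp q' z' i j m != 0 -> (m < n)%N /\ (i + j - m < n)%N.
Proof.
move=> q'0 zn' ni nj; rewrite /kp; case: (leqP j m) => [jm|_ /eqP //].
rewrite /rmx => nz; split; last by lia.
rewrite ltnNge; apply: contraNN nz => nm; apply/eqP.
have lt : (n.-1 - j < m - j)%N by lia.
have V : z' ^+ 2 * q' ^+ j * q' ^+ (n.-1 - j) = 1.
  rewrite -mulrA -exprD subnKC; last by lia.
  apply: (mulfI q'0); rewrite mulr1 -[RHS]zn' -[in RHS](prednK n0) (exprS q'); ring.
by rewrite [qpoch _ _ _](bigD1 (Ordinal lt)) //= V subrr mul0r mulr0.
Qed.

Lemma kap_local e i j m : (i < n)%N -> (j < n)%N -> (m <= i + j)%N -> kap e i j m != 0 ->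
  (m < n)%N /\ (i + j - m < n)%N.
Proof.
case: e => /= ni nj mij; first exact: kp_local.
have znV : z^-1 ^+ 2 * q^-1 ^+ n = q^-1 by rewrite !exprVn -invfM zn.
move/(kp_local (invr_neq0 q0) znV nj ni) => -[h1 h2]; split=> //.
by move: h2; rewrite addnC subKn.
Qed.

Definition opw (u : sword) (f : seq nat -> F) : seq nat -> F :=
  foldr (fun x h => sop (kap x.1) x.2 h) f u.

Definition dirac (c e : seq nat) : F := (e == c)%:R.

Lemma opw_cat u v f : opw (u ++ v) f = opw u (opw v f).
Proof. by rewrite /opw foldr_cat. Qed.

Lemma wfw_cat N u v : wfw N (u ++ v) = wfw N u && wfw N v.
Proof. exact: all_cat. Qed.

Lemma eq_opw N u f h c : wfw N u -> size c = N ->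
  (forall e, size e = N -> f e = h e) -> opw u f c = opw u h c.
Proof.
elim: u c => [|x u IH] c /=; first by move=> _ sc; apply.
by case/andP=> xN uN sc fh; apply: eq_sop => [|e se]; rewrite ?sc // IH // se.
Qed.

Lemma opw_weight N u f c : wfw N u -> size c = N ->
  (forall e, size e = N -> sumn e = sumn c -> f e = 0) -> opw u f c = 0.
Proof.
elim: u c => [|x u IH] c /=; first by move=> _ sc; apply.
case/andP=> xN uN sc f0; rewrite /sop /pairop big1 // => -[m /= mi] _.
have xc : (x.2.+1 < size c)%N by rewrite sc.
rewrite IH ?mulr0 // ?size_put // => e se we; apply: f0 => //.
by have := sumn_put m (nth 0 c x.2 + nth 0 c x.2.+1 - m) xc; rewrite subnKC // we => /addIn ->.
Qed.

Lemma opw_kernel N u f c : wfw N u -> c \in cfgs n N ->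
  opw u f c = \sum_(e <- cfgs n N) opw u (dirac e) c * f e.
Proof.
elim: u c => [|x u IH] c /=.
  move=> _ cX; rewrite (bigD1_seq c) ?uniq_cfgs //= /dirac eqxx mul1r big1 ?addr0 // => e.
  by rewrite eq_sym => /negPf ->; rewrite mul0r.
case/andP=> xN uN; rewrite mem_cfgs => /andP[/eqP sc ac].
have xc : (x.2.+1 < size c)%N by rewrite sc.
rewrite /sop /pairop; under [RHS]eq_bigr => e _ do rewrite mulr_suml.
rewrite exchange_big; apply: eq_bigr => -[m /= mi] _.
have [->|nz] := eqVneq (kap x.1 (nth 0%N c x.2) (nth 0%N c x.2.+1) m) 0.
  by rewrite mul0r big1 // => e _; rewrite !mul0r.
have nth_lt i : (i < size c)%N -> (nth 0%N c i < n)%N by move=> ic; apply: all_nthP ac _ _.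
have [h1 h2] := kap_local (nth_lt _ (ltnW xc)) (nth_lt _ xc) mi nz.
rewrite IH //; first by rewrite mulr_sumr; apply: eq_bigr => e _; rewrite mulrA.
rewrite mem_cfgs size_put // sc eqxx; apply/(all_nthP 0%N) => i.
by rewrite size_put // nth_put => ic; case: ifP => // _; case: ifP => // _; apply: nth_lt.
Qed.

Definition qtr N u : F := \sum_(c <- cfgs n N) q ^- sumn c * opw u (dirac c) c.

(** The factor [q ^- sumn c] does not spoil cyclicity because both words preserve the weight. *)
Lemma qtr_cyclic N u v : wfw N u -> wfw N v -> qtr N (u ++ v) = qtr N (v ++ u).
Proof.
move=> wu wv; rewrite /qtr.
under eq_big_seq => c cX do rewrite opw_cat (opw_kernel _ wu cX) mulr_sumr.
under [RHS]eq_big_seq => c cX do rewrite opw_cat (opw_kernel _ wv cX) mulr_sumr.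
rewrite exchange_big /=; apply: eq_big_seq => e eX; apply: eq_big_seq => c cX.
have [se sc] : size e = N /\ size c = N.
  by move: eX cX; rewrite !mem_cfgs => /andP[/eqP ? _] /andP[/eqP ? _].
have [-> | ne] := eqVneq (sumn c) (sumn e); first by rewrite [X in _ * X]mulrC.
rewrite (@opw_weight N u) ?mul0r ?mulr0 // => d _ wd.
by rewrite /dirac; case: eqP => // de; move: ne; rewrite -wd de eqxx.
Qed.

Lemma opw_Eseq N u f c : wfw N u -> size c = N -> opw u (Eseq q z f) c = Eseq q z (opw u f) c.
Proof.
elim: u c => [|x u IH] c //= /andP[xN uN] sc.
have xc : (x.2.+1 < size c)%N by rewrite sc.
rewrite -sop_Eseq //; last by move=> h i j; apply: kap_Eop.
by apply: eq_sop => // e se; apply: IH => //; rewrite se.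
Qed.

Definition redtr N u a : F := \sum_(c <- cfgs n N) q ^- sumn c * opw u (dirac (a :: c)) (a :: c).

Lemma qtr_redtr N u : qtr N.+1 u = \sum_(a < n) q ^- a * redtr N u a.
Proof.
rewrite /qtr big_cfgsS; apply: eq_bigr => a _; rewrite mulr_sumr; apply: eq_bigr => c _.
by rewrite /= exprD invfM mulrA.
Qed.

Lemma eq_Eseq_cfgs N f h c : c \in cfgs n N ->
  (forall e, e \in cfgs n N -> f e = h e) -> Eseq q z f c = Eseq q z h c.
Proof.
elim: c N f h => [|a c IH] // [|N] f h; first by rewrite mem_cfgs.
rewrite mem_cfgs /= ?eqSS => /and3P[sc an ac] fh.
have cX : c \in cfgs n N by rewrite mem_cfgs sc.
rewrite (IH N _ (fun e => h (a :: e)) cX) => [|e eX]; last first.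
  by apply: fh; move: eX; rewrite !mem_cfgs /= ?eqSS an.
by rewrite fh // mem_cfgs /= ?eqSS sc ac andbT (leq_ltn_trans (leq_pred a)).
Qed.

Lemma Eseq_kernel N f c : c \in cfgs n N ->
  Eseq q z f c = \sum_(e <- cfgs n N) f e * Eseq q z (dirac e) c.
Proof.
move=> cX; rewrite -(Eseq_sum q z (cfgs n N) f dirac).
apply: eq_Eseq_cfgs cX _ => e eX.
rewrite (bigD1_seq e) ?uniq_cfgs //= /dirac eqxx mulr1 big1 ?addr0 // => d.
by rewrite eq_sym => /negPf ->; rewrite mulr0.
Qed.

Lemma Eseq_weight e c : sumn c != (sumn e).+1 -> Eseq q z (dirac e) c = 0.
Proof.
move=> ne; suff gen f : (forall d, (sumn d).+1 = sumn c -> f d = 0) -> Eseq q z f c = 0.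
  apply: gen => d dc; rewrite /dirac; case: eqP => // de.
  by move: ne; rewrite -dc de eqxx.
elim: c f {ne} => [|a c IH] f f0 //=.
rewrite IH ?mulr0 ?addr0 => [|d dc]; last by apply: f0; rewrite /= -dc addnS.
case: a f0 => [|a] f0; first by rewrite expr0 subrr mul0r.
by rewrite f0 ?mulr0.
Qed.

Lemma Eseq_eq0 f c : (forall e, f e = 0) -> Eseq q z f c = 0.
Proof.
elim: c f => [|a c IH] f f0 //=.
by rewrite f0 IH ?mulr0 ?addr0 // => e; apply: f0.
Qed.

(** The partial trace commutes with the raising operator, hence is a scalar. *)
Lemma redtr_const N u a : wfw N.+1 u -> (a.+1 < n)%N -> redtr N u a.+1 = redtr N u a.
Proof.
move=> wu an.
have consX b c : (b < n)%N -> c \in cfgs n N -> b :: c \in cfgs n N.+1.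
  by rewrite !mem_cfgs /= ?eqSS => ->.
have E c : c \in cfgs n N ->
   (1 - q ^+ a.+1) * opw u (dirac (a.+1 :: c)) (a.+1 :: c) +
     z * q ^+ a * \sum_(d <- cfgs n N) Eseq q z (dirac c) d * opw u (dirac (a :: d)) (a.+1 :: c) =
   (1 - q ^+ a.+1) * opw u (dirac (a :: c)) (a :: c) +
     z * q ^+ a.+1 * \sum_(d <- cfgs n N) opw u (dirac (a :: c)) (a.+1 :: d) * Eseq q z (dirac d) c.
  move=> cX; have sc : size c = N by move: cX; rewrite mem_cfgs => /andP[/eqP].
  have := opw_Eseq (dirac (a :: c)) wu (_ : size (a.+1 :: c) = N.+1).
  rewrite /= sc => /(_ erefl); rewrite (Eseq_kernel (fun e => opw u _ (a.+1 :: e)) cX) => <-.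
  rewrite [RHS](opw_kernel _ wu (consX _ _ an cX)) [RHS]big_cfgsS.
  have a1 : (a < n)%N by apply: ltnW.
  have Eb (b : 'I_n) d : d \in cfgs n N -> Eseq q z (dirac (a :: c)) (nat_of_ord b :: d) =
      (1 - q ^+ a.+1) * ((b == Ordinal an) && (d == c))%:R +
      (b == Ordinal a1)%:R * (z * q ^+ a * Eseq q z (dirac c) d).
    move=> dX; rewrite /=; congr (_ + _).
      rewrite /dirac eqseq_cons -val_eqE /=; case: (b : nat) => [|b'] /=.
        by rewrite expr0 subrr mul0r mulr0.
      rewrite ?eqSS; case: eqP => [->|_] //=; by rewrite !mulr0.
    rewrite -val_eqE /=; case: eqP => [->|ba]; rewrite ?mul1r ?mul0r.
      congr (_ * _); apply: eq_Eseq => e _; by rewrite /dirac eqseq_cons eqxx.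
    by rewrite Eseq_eq0 ?mulr0 // => e; rewrite /dirac eqseq_cons; move/eqP/negPf: ba => ->.
  rewrite [RHS](eq_bigr (fun b : 'I_n => (b == Ordinal an)%:R * ((1 - q ^+ a.+1) * opw u (dirac (nat_of_ord b :: c)) (a.+1 :: c)) +
     (b == Ordinal a1)%:R * (z * q ^+ a * \sum_(d <- cfgs n N) Eseq q z (dirac c) d * opw u (dirac (nat_of_ord b :: d)) (a.+1 :: c)))).
    rewrite [RHS]big_split /=; congr (_ + _).
      rewrite (bigD1 (Ordinal an)) //= eqxx mul1r big1 ?addr0 // => b /negPf ->.
      by rewrite mul0r.
    rewrite (bigD1 (Ordinal a1)) //= eqxx mul1r [X in _ = _ + X]big1 ?addr0 // => b /negPf ->.
    by rewrite mul0r.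
  move=> b _.
  rewrite (eq_big_seq (fun d => (b == Ordinal an)%:R * (1 - q ^+ a.+1) * ((d == c)%:R * opw u (dirac (nat_of_ord b :: d)) (a.+1 :: c)) +
     (b == Ordinal a1)%:R * (z * q ^+ a) * (Eseq q z (dirac c) d * opw u (dirac (nat_of_ord b :: d)) (a.+1 :: c)))); last first.
    by move=> d dX; rewrite Eb // -mulnb natrM; ring.
  rewrite big_split /= -!mulr_sumr; congr (_ + _); last by rewrite !mulrA.
  rewrite (bigD1_seq c) ?uniq_cfgs //= eqxx mul1r big1 ?addr0 ?mulrA // => d /negPf ->.
  by rewrite mul0r.
have S1 := eq_big_seq (op := +%R) (idx := 0) _ (fun c cX => congr1 (fun y => q ^- sumn c * y) (E c cX)).
move: S1; under eq_bigr => c _ do rewrite mulrDr mulrCA.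
under [in RHS]eq_bigr => c _ do rewrite mulrDr mulrCA.
rewrite !big_split /= -!mulr_sumr -!/(redtr _ _ _).
have -> : \sum_(c <- cfgs n N) q ^- sumn c * (z * q ^+ a.+1 * \sum_(d <- cfgs n N) opw u (dirac (a :: c)) (a.+1 :: d) * Eseq q z (dirac d) c)
  = \sum_(c <- cfgs n N) q ^- sumn c * (z * q ^+ a * \sum_(d <- cfgs n N) Eseq q z (dirac c) d * opw u (dirac (a :: d)) (a.+1 :: c)).
  under eq_bigr => c _ do rewrite mulrA mulr_sumr.
  under [RHS]eq_bigr => c _ do rewrite mulrA mulr_sumr.
  rewrite exchange_big; apply: eq_bigr => c _; apply: eq_bigr => d _ /=.
  have [dc|/Eseq_weight ->] := eqVneq (sumn d) (sumn c).+1; last by rewrite !(mul0r, mulr0).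
  rewrite dc !exprS; have h : q ^+ sumn c != 0 by rewrite expf_neq0.
  by field; rewrite h q0.
move/addIr/mulfI; apply.
by rewrite subr_eq0 eq_sym; have [_ ->] := gq.
Qed.

Lemma redtr_eq N u a : wfw N.+1 u -> (a < n)%N -> redtr N u a = redtr N u 0.
Proof.
by move=> wu; elim: a => // a IH an; rewrite redtr_const // IH // ltnW.
Qed.

Lemma qdim_neq0 : \sum_(a < n) q ^- a != 0 :> F.
Proof.
suff : (1 - q^-1) * \sum_(a < n) q ^- a != 0 by rewrite mulf_eq0 negb_or => /andP[].
have -> : (1 - q^-1) * (\sum_(a < n) q ^- a) = 1 - q ^- n.
  elim: (n) => [|m IH]; first by rewrite big_ord0 mulr0 expr0 invr1 subrr.
  rewrite big_ord_recr mulrDr IH /= exprS invfM; ring.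
have [_ qn] := genericV gq; rewrite subr_eq0 eq_sym -exprVn -(prednK n0).
exact: qn.
Qed.

Lemma qtr_redtr0 N u : wfw N.+1 u -> qtr N.+1 u = (\sum_(a < n) q ^- a) * redtr N u 0.
Proof.
by move=> wu; rewrite qtr_redtr mulr_suml; apply: eq_bigr => a _; rewrite redtr_eq.
Qed.

(** A letter may involve the open strand, where the reduced trace is not visibly cyclic. Multiplied
    by the quantum dimension, which is nonzero, it becomes the full trace, which is. *)
Lemma redtr_conj N u e i : wfw N.+1 u -> (i.+1 < N.+1)%N ->
  redtr N ((e, i) :: rcons u (~~ e, i)) 0 = redtr N u 0.
Proof.
move=> wu iN.
have w1 : wfw N.+1 [:: (e, i)] by rewrite /= iN.
have w2 : wfw N.+1 [:: (~~ e, i)] by rewrite /= iN.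
have wr : wfw N.+1 (rcons u (~~ e, i)) by rewrite -cats1 wfw_cat wu.
apply: (mulfI qdim_neq0); rewrite -!qtr_redtr0 //; last by rewrite -cat1s wfw_cat w1.
rewrite -cat1s qtr_cyclic // -cats1 -catA; apply: eq_big_seq => c; rewrite mem_cfgs => /andP[/eqP sc _].
congr (_ * _); rewrite opw_cat; apply: (eq_opw wu sc) => d sd /=.
by apply: sop_inv; rewrite ?sd // => h x y; have := kap_inv (~~ e) h x y; rewrite negbK.
Qed.

Lemma opw_rcons N u f d j : wfw N u -> size d = N ->
  opw u f (rcons d j) = opw u (fun e => f (rcons e j)) d.
Proof.
elim: u d => [|x u IH] d //= /andP[xN uN] sd.
have xd : (x.2.+1 < size d)%N by rewrite sd.
have put_rcons m m' : put x.2 m m' (rcons d j) = rcons (put x.2 m m' d) j.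
  apply: nth_inj_size => [|i]; rewrite ?size_put ?size_rcons ?size_put //; first by lia.
  rewrite nth_put !nth_rcons size_put // nth_put.
  by case: (eqVneq i x.2.+1) => [->|_]; [rewrite xd|case: (eqVneq i x.2) => [->|_] //; rewrite ltnW].
rewrite /sop !nth_rcons xd ltnW //; apply: eq_pairop => m _.
by rewrite put_rcons IH ?size_put.
Qed.

(** The new strand meets only the last position; the diagonal entries of its crossing, weighted by
    [q ^- j], sum to [z] by [stab_pos] and [stab_neg]. *)
Lemma redtr_stab N u e : wfw N.+1 u -> redtr N.+1 (rcons u (e, N)) 0 = z * redtr N u 0.
Proof.
move=> wu; rewrite /redtr big_cfgs_rcons mulr_sumr; apply: eq_big_seq => c.
rewrite mem_cfgs => /andP[/eqP sc ac].
set d := 0%N :: c; have sd : size d = N.+1 by rewrite /= sc.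
set i := nth 0%N d N.
have i_lt : (i < n)%N.
  rewrite /i /d; case: (N) sc => [|N'] sc //=.
  by apply: (all_nthP 0%N ac); rewrite sc.
have E j : opw (rcons u (e, N)) (dirac (0%N :: rcons c j)) (0%N :: rcons c j) =
    kap e i j i * opw u (dirac d) d.
  rewrite -rcons_cons -/d -cats1 opw_cat (opw_rcons _ _ wu sd).
  have -> : kap e i j i * opw u (dirac d) d = opw u (fun e' => kap e i j i * dirac d e') d.
    have i0 (f : seq nat -> F) x c' : opw u (fun e' => x * f e') c' = x * opw u f c'.
      elim: (u) c' => [|y v IH] c' //=; rewrite /sop /pairop mulr_sumr.
      by apply: eq_bigr => m _; rewrite IH mulrCA.
    by rewrite i0.
  apply: (eq_opw wu sd) => e' se' /=; rewrite /sop !nth_rcons se' ltnSn ltnn eqxx.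
  set i' := nth 0%N e' N.
  have putE m y : put N m y (rcons e' j) = rcons (set_nth 0%N e' N m) y.
    apply: nth_inj_size => [|k].
      by rewrite size_put ?size_rcons ?size_set_nth se' ?(maxn_idPr _).
    rewrite nth_put !nth_rcons size_set_nth se' (maxn_idPr _) // nth_set_nth /=.
    case: (ltngtP k N.+1) => // kN; rewrite ifF //; lia.
  have i'j : (i' < (i' + j).+1)%N by rewrite ltnS leq_addr.
  rewrite /pairop (bigD1 (Ordinal i'j)) //= big1 ?addr0 => [|m]; last first.
    rewrite -val_eqE /= => mi; rewrite putE /dirac -?[0%N :: rcons c j]/(rcons d j) eqseq_rcons andbC.
    have -> : (i' + j - m == j)%N = false by have := ltn_ord m; lia.
    by rewrite mulr0.
  rewrite putE addKn /dirac -?[0%N :: rcons c j]/(rcons d j) eqseq_rcons eqxx andbT.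
  have -> : set_nth 0%N e' N i' = e'.
    apply: nth_inj_size => [|k]; first by rewrite size_set_nth se' (maxn_idPr _).
    by rewrite nth_set_nth /=; case: eqP => [->|].
  by rewrite /i'; case: eqP => [->|]; rewrite ?mulr0.
under eq_bigr => j _ do rewrite E sumn_rcons addnC exprD invfM -mulrA.
transitivity (\sum_(j < n) z^-1 * q ^- j * kap e i j i * (z * (q ^- sumn d * opw u (dirac d) d))).
  by apply: eq_bigr => j _; rewrite /d /=; field; rewrite z0 !expf_neq0.
rewrite -mulr_suml; have -> : \sum_(j < n) z^-1 * q ^- j * kap e i j i = 1.
  by case: (e); [apply: stab_pos | apply: stab_neg].
by rewrite mul1r.
Qed.

(** At [q = s^2], [z = s/s^n] this is the colored Jones polynomial. *)
Definition jonestr (Nu : nat * sword) : F := z ^- Nu.1.-1 * redtr Nu.1.-1 Nu.2 0.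

Lemma mstep_jonestr x y : mstep x y -> jonestr x = jonestr y.
Proof.
have ext N u v : wfw N u -> (forall c f, size c = N -> opw u f c = opw v f c) ->
    (0 < N)%N -> jonestr (N, u) = jonestr (N, v).
  case: N => // N wu E _; congr (_ * _); apply: eq_big_seq => c.
  by rewrite mem_cfgs => /andP[/eqP sc _]; rewrite E //= sc.
case=> {x y} [N u1 u2 e i wu iN|N u1 u2 e e' i j wu jN ij|N u1 u2 i wu iN|N u e i wu iN|N u e N0 wu].
- have [w1 w2] : wfw N u1 /\ wfw N u2 by move: wu; rewrite wfw_cat => /andP.
  apply/esym/ext => //; last by lia.
  move=> c f sc; rewrite !opw_cat; apply: (eq_opw w1 sc) => d sd /=.
  by apply/esym/sop_inv; [rewrite sd | apply: kap_inv].
- have [w1 w2] : wfw N u1 /\ wfw N u2 by move: wu; rewrite wfw_cat => /andP.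
  have iN : (i.+1 < N)%N by lia.
  apply: ext => [|c f sc|]; last by lia.
    by rewrite wfw_cat w1 /= iN jN.
  rewrite !opw_cat; apply: (eq_opw w1 sc) => d sd /=.
  by apply: sop_far; rewrite ?sd.
- have [w1 w2] : wfw N u1 /\ wfw N u2 by move: wu; rewrite wfw_cat => /andP.
  apply: ext => [|c f sc|]; last by lia.
    by rewrite wfw_cat w1 /= iN ltnW.
  rewrite !opw_cat; apply: (eq_opw w1 sc) => d sd /=.
  by apply: sop_kp_braid; rewrite ?sd.
- by case: N wu iN => // N wu iN; rewrite /jonestr redtr_conj.
case: N N0 wu => // N _ wu; rewrite /jonestr /= redtr_stab // exprS.
have zN : z ^+ N != 0 by rewrite expf_neq0.
by field; rewrite z0 zN.
Qed.

Lemma markov_jonestr x y : markov_equiv x y -> jonestr x = jonestr y.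
Proof. by elim=> [a b /mstep_jonestr|a|a b _ ->|a b c _ -> _ ->]. Qed.

End Markov.

(** * Rationality of the coefficients of h^j *)

Lemma pfun_comp K K' (f : seq nat -> rat) (s : seq nat -> seq nat) : pfun K f ->
  (forall i, (i < K)%N -> pfun K' (fun l => (nth 0%N (s l) i)%:R)) ->
  pfun K' (fun l => f (s l)).
Proof.
move=> pf ps; elim: pf => {f} [c|i iK|f g _ IHf _ IHg|f g _ IHf _ IHg|f g fg _ IH].
- exact: pfun_const.
- exact: ps.
- exact: pfun_add.
- exact: pfun_mul.
- by apply: pfun_ext IH => l; rewrite fg.
Qed.

Lemma pfun_opp K f : pfun K f -> pfun K (fun l => - f l).
Proof.
move=> pf; apply: (pfun_ext _ (pfun_mul (pfun_const K (-1)) pf)) => l.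
by rewrite mulN1r.
Qed.

Lemma pfun_exp K f e : pfun K f -> pfun K (fun l => f l ^+ e).
Proof.
move=> pf; elim: e => [|e IH]; first by apply: (pfun_ext _ (pfun_const K 1)).
by apply: (pfun_ext _ (pfun_mul pf IH)) => l; rewrite exprS.
Qed.

Lemma pfun_sum K (I : Type) (r : seq I) (P : pred I) (F : I -> seq nat -> rat) :
  (forall i, P i -> pfun K (F i)) -> pfun K (fun l => \sum_(i <- r | P i) F i l).
Proof.
move=> pF; elim: r => [|i r IH].
  by apply: (pfun_ext _ (pfun_const K 0)) => l; rewrite big_nil.
case Pi: (P i).
  by apply: (pfun_ext _ (pfun_add (pF i Pi) IH)) => l; rewrite big_cons Pi.
by apply: (pfun_ext _ IH) => l; rewrite big_cons Pi.
Qed.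

Lemma pfun_bin K v d : (v < K)%N -> pfun K (fun l => ('C(nth 0%N l v, d))%:R).
Proof.
move=> vK; elim: d => [|d IH].
  by apply: (pfun_ext _ (pfun_const K 1)) => l; rewrite bin0.
have := pfun_mul IH (pfun_mul (pfun_add (pfun_var vK) (pfun_const K (- d%:R)))
  (pfun_const K (d.+1%:R^-1))).
apply: pfun_ext => l; set x := nth 0%N l v.
have d0 : d.+1%:R != 0 :> rat by rewrite pnatr_eq0.
have := mul_bin_left x d => /(congr1 (fun k => k%:R : rat)); rewrite !natrM => E.
have [xd|dx] := ltnP x d; first by rewrite !bin_small ?mul0r //; lia.
move: d0 E; rewrite natrB //; move: (d.+1%:R : rat) => y y0 E.
by apply: (mulfI y0); rewrite E; field.
Qed.

(** Polynomial functions are closed under indefinite summation: expand in the binomial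
    basis with respect to the summation variable. *)
Section Summation.
Variables (K v : nat).
Hypothesis vK : (v < K)%N.

Inductive bspan : (seq nat -> rat) -> Prop :=
| bspan_mono d a : pfun K a -> (forall l x, a (set_nth 0%N l v x) = a l) ->
    bspan (fun l => a l * ('C(nth 0%N l v, d))%:R)
| bspan_add f g : bspan f -> bspan g -> bspan (fun l => f l + g l)
| bspan_ext f g : f =1 g -> bspan f -> bspan g.

Lemma bspan_indep a f : pfun K a -> (forall l x, a (set_nth 0%N l v x) = a l) ->
  bspan f -> bspan (fun l => a l * f l).
Proof.
move=> pa ia; elim=> {f} [d b pb ib|f g _ IHf _ IHg|f g fg _ IH].
- apply: (bspan_ext _ (bspan_mono d (pfun_mul pa pb) _)) => [l|l x]; first by rewrite mulrA.
  by rewrite ia ib.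
- by apply: (bspan_ext _ (bspan_add IHf IHg)) => l; rewrite mulrDr.
- by apply: (bspan_ext _ IH) => l; rewrite fg.
Qed.

Lemma bspan_var f : bspan f -> bspan (fun l => (nth 0%N l v)%:R * f l).
Proof.
elim=> {f} [d a pa ia|f g _ IHf _ IHg|f g fg _ IH].
- have pd c : pfun K (fun l => c * a l) by apply: pfun_mul pa; apply: pfun_const.
  have id c l x : c * a (set_nth 0%N l v x) = c * a l by rewrite ia.
  have := bspan_add (bspan_mono d (pd d%:R) (id d%:R)) (bspan_mono d.+1 (pd d.+1%:R) (id d.+1%:R)).
  apply: bspan_ext => l; set x := nth 0%N l v.
  have := mul_bin_left x d => /(congr1 (fun k => k%:R : rat)); rewrite !natrM => E.
  have [xd|dx] := ltnP x d; first by rewrite !bin_small ?mulr0 ?addr0 //; lia.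
  have -> : d.+1%:R * a l * ('C(x, d.+1))%:R = a l * (d.+1%:R * ('C(x, d.+1))%:R) by ring.
  by rewrite E natrB //; ring.
- by apply: (bspan_ext _ (bspan_add IHf IHg)) => l; rewrite mulrDr.
- by apply: (bspan_ext _ IH) => l; rewrite fg.
Qed.

Lemma pfun_bspan f : pfun K f -> bspan f.
Proof.
move=> pf; suff gen g : bspan g -> bspan (fun l => f l * g l).
  have b1 : bspan (fun=> 1).
    apply: (bspan_ext _ (bspan_mono 0 (pfun_const K 1) (fun _ _ => erefl))) => l.
    by rewrite bin0 mulr1.
  by apply: (bspan_ext _ (gen _ b1)) => l; rewrite mulr1.
elim: pf g => {f} [c|i iK|f h _ IHf _ IHh|f h _ IHf _ IHh|f h fh _ IH] g bg.
- exact: bspan_indep (pfun_const K c) _ bg.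
- have [->|iv] := eqVneq i v; first exact: bspan_var.
  apply: bspan_indep (pfun_var iK) _ bg => l x.
  by rewrite nth_set_nth /= (negPf iv).
- by apply: (bspan_ext _ (bspan_add (IHf _ bg) (IHh _ bg))) => l; rewrite mulrDl.
- by apply: (bspan_ext _ (IHf _ (IHh _ bg))) => l; rewrite mulrA.
- by apply: (bspan_ext _ (IH _ bg)) => l; rewrite fh.
Qed.

Lemma pfun_summation f : pfun K f ->
  pfun K (fun l => \sum_(x < nth 0%N l v) f (set_nth 0%N l v x)).
Proof.
move=> /pfun_bspan; elim=> {f} [d a pa ia|f g _ IHf _ IHg|f g fg _ IH].
- apply: (pfun_ext _ (pfun_mul pa (pfun_bin d.+1 vK))) => l.
  under eq_bigr => x _ do rewrite ia nth_set_nth /= eqxx.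
  rewrite -mulr_sumr -natr_sum; congr (_ * _%:R).
  elim: (nth 0%N l v) => [|n IHn]; first by rewrite big_ord0.
  by rewrite big_ord_recr binS IHn.
- by apply: (pfun_ext _ (pfun_add IHf IHg)) => l; rewrite big_split.
- by apply: (pfun_ext _ IH) => l; apply: eq_bigr => x _; rewrite fg.
Qed.

End Summation.

Lemma qfact_neq0 (q : rat) n : 1 < q -> qfact q n != 0.
Proof.
move=> q1; apply/prodf_neq0 => i _; rewrite subr_eq0 eq_sym.
by rewrite gt_eqF // exprn_egt1.
Qed.

Lemma gbin_absorb (q : rat) n k : 1 < q ->
  gbin q n.+1 k.+1 * (q ^+ k.+1 - 1) = gbin q n k * (q ^+ n.+1 - 1).
Proof.
move=> q1; have [nk|kn] := ltnP n k; first by rewrite !gbin_small // !mul0r.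
have f0 := mulf_neq0 (qfact_neq0 k q1) (qfact_neq0 (n - k) q1).
apply: (mulIf f0); have E1 := gbin_fact q (n - k) k.
have E2 := gbin_fact q (n - k) k.+1; rewrite addnS subnK // in E1 E2.
rewrite !qfactS in E2.
have -> : gbin q n.+1 k.+1 * (q ^+ k.+1 - 1) * (qfact q k * qfact q (n - k)) =
  - (gbin q n.+1 k.+1 * (qfact q k * (1 - q ^+ k.+1) * qfact q (n - k))) by ring.
by rewrite E2 -E1; ring.
Qed.

(** The coefficients of [h^r] in the Gaussian binomials at [q = exp h]. *)
Definition gmom n k r : rat := lsum (fun a _ => ehalf a r) (gauss n k).

Lemma lsum_ehalfM p p' r :
  lsum (fun a _ => ehalf a r) (lmul p p') =
  \sum_(i < r.+1) lsum (fun a _ => ehalf a i) p * lsum (fun a _ => ehalf a (r - i)) p'.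
Proof. by apply: lsum_lmul => m1 m2 _ _; rewrite ehalfD. Qed.

Lemma ehalf_double c r : ehalf (Posz (2 * c)) r = c%:R ^+ r / r`!%:R.
Proof.
rewrite /ehalf -[(Posz _)%:~R]/((2 * c)%:R) natrM [2%:R * _]mulrC mulfK //.
Qed.

(** Coefficient of order [r + 1] in [gbin_absorb] at [q = exp h]. As [q^c - 1] has no constant term,
    the unknown of order [r + 1] drops out and the one of order [r] is multiplied by [c]. *)
Lemma gmom_rec n k r :
  gmom n.+1 k.+1 r * k.+1%:R +
    \sum_(i < r) gmom n.+1 k.+1 i * (k.+1%:R ^+ (r.+1 - i) / (r.+1 - i)`!%:R) =
  gmom n k r * n.+1%:R +
    \sum_(i < r) gmom n k i * (n.+1%:R ^+ (r.+1 - i) / (r.+1 - i)`!%:R).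
Proof.
pose Q c := ladd (lmono 1 (Posz (2 * c)) 0) (lmono (-1) 0 0).
have QE c i : lsum (fun a _ => ehalf a i) (Q c) = c%:R ^+ i / i`!%:R - (i == 0%N)%:R.
  by rewrite lsum_ladd !lsum_lmono ehalf_double ehalf00 mulrN1z.
have gen g c : lsum (fun a _ => ehalf a r.+1) (lmul g (Q c)) =
   lsum (fun a _ => ehalf a r) g * c%:R + \sum_(i < r)
   lsum (fun a _ => ehalf a i) g * (c%:R ^+ (r.+1 - i) / (r.+1 - i)`!%:R).
  have e1 : (r.+1 - r = 1)%N by lia.
  rewrite lsum_ehalfM !big_ord_recr /= e1 subnn !QE /= !expr0 divr1 subrr mulr0 addr0.
  rewrite expr1 subr0 addrC; congr (_ + _); apply: eq_bigr => -[i ir] _ /=.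
  by rewrite QE subn_eq0 leqNgt ltnW ?subr0.
rewrite /gmom -!gen; apply: lpoly_ext => s t s1 t1.
have s0 : s != 0 by rewrite gt_eqF // (lt_trans ltr01).
have t0 : t != 0 by rewrite gt_eqF // (lt_trans ltr01).
have QlevE c : lev s t (Q c) = (s ^+ 2) ^+ c - 1.
  by rewrite /Q lev_ladd !lev_lmono !expr0z -exprnP exprM; ring.
by rewrite !lev_lmul // !lev_gauss // !QlevE gbin_absorb // exprn_egt1.
Qed.

(** Divided by the ordinary binomial, [gmom_rec] expresses the difference in [k] of the order [r]
    coefficient by lower orders; this is [D]. Summing it from the known value at [k = 0] stays
    polynomial. *)
Lemma gmom_poly r : exists P : nat -> seq nat -> rat, forall i, (i < r)%N ->
  [/\ pfun 2 (P i), forall m k, gmom (m + k) k i = ('C(m + k, k))%:R * P i [:: m; k]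
     & i = 0%N -> forall l, P i l = 1].
Proof.
elim: r => [|r [P HP]]; first by exists (fun _ _ => 0).
pose D (l : seq nat) := \sum_(i < r)
  (P i [:: nth 0%N l 0; nth 0%N l 1] * (nth 0%N l 0 + nth 0%N l 1).+1%:R ^+ (r - i) -
   P i [:: nth 0%N l 0; (nth 0%N l 1).+1] * (nth 0%N l 1).+1%:R ^+ (r - i))
  / (r.+1 - i)`!%:R.
pose Pr (l : seq nat) := (r == 0%N)%:R + \sum_(x < nth 0%N l 1) D (set_nth 0%N l 1 x).
exists (fun i => if (i < r)%N then P i else Pr) => i; rewrite ltnS leq_eqVlt.
case/predU1P=> [->|ir]; last by rewrite ir; apply: HP.
rewrite ltnn; split; last first.
- move=> r0 l; rewrite /Pr big1 ?addr0 => [|x _]; first by rewrite r0.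
  by rewrite /D r0 big_ord0.
- move=> m; elim=> [|k IHk].
    rewrite addn0 bin0 mul1r /Pr /= big_ord0 addr0 /gmom.
    have -> : gauss m 0 = lone by case: m.
    by rewrite /lone lsum_lmono ehalf00 mulr1z.
  have kS0 : k.+1%:R != 0 :> rat by rewrite pnatr_eq0.
  have binE : k.+1%:R * ('C(m + k.+1, k.+1))%:R = (m + k.+1)%:R * ('C(m + k, k))%:R :> rat.
    by rewrite -!natrM addnS mul_bin_diag.
  have := gmom_rec (m + k) k r; rewrite -addnS IHk.
  have -> : \sum_(j < r) gmom (m + k.+1) k.+1 j * (k.+1%:R ^+ (r.+1 - j) / (r.+1 - j)`!%:R) =
     k.+1%:R * ('C(m + k.+1, k.+1))%:R * \sum_(j < r) P j [:: m; k.+1] * k.+1%:R ^+ (r - j) / (r.+1 - j)`!%:R.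
    rewrite mulr_sumr; apply: eq_bigr => -[j jr] _ /=; have [_ -> _] := HP _ jr.
    by rewrite {1}subSn 1?ltnW // exprS; ring.
  have -> : \sum_(j < r) gmom (m + k) k j * ((m + k.+1)%:R ^+ (r.+1 - j) / (r.+1 - j)`!%:R) =
     (m + k.+1)%:R * ('C(m + k, k))%:R * \sum_(j < r) P j [:: m; k] * (m + k.+1)%:R ^+ (r - j) / (r.+1 - j)`!%:R.
    rewrite mulr_sumr; apply: eq_bigr => -[j jr] _ /=; have [_ -> _] := HP _ jr.
    by rewrite {1}subSn 1?ltnW // exprS; ring.
  have -> : Pr [:: m; k.+1] = Pr [:: m; k] + D [:: m; k].
    by rewrite /Pr /= big_ord_recr /= addrA.
  rewrite -binE => /(canRL (addrK _)) E; apply: (mulIf kS0); rewrite E {E}.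
  have -> : D [:: m; k] = \sum_(j < r) P j [:: m; k] * (m + k.+1)%:R ^+ (r - j) / (r.+1 - j)`!%:R
     - \sum_(j < r) P j [:: m; k.+1] * k.+1%:R ^+ (r - j) / (r.+1 - j)`!%:R.
    by rewrite /D -sumrB; apply: eq_bigr => j _ /=; rewrite addnS mulrBl.
  have -> : ('C(m + k, k))%:R * Pr [:: m; k] * (m + k.+1)%:R =
    k.+1%:R * ('C(m + k.+1, k.+1))%:R * Pr [:: m; k] by rewrite binE; ring.
  ring.
- apply: pfun_add (pfun_const _ _) _; apply: pfun_summation => //.
  have v0 : pfun 2 (fun l => (nth 0%N l 0)%:R) by apply: pfun_var.
  have v1 : pfun 2 (fun l => (nth 0%N l 1)%:R) by apply: pfun_var.
  have v1S : pfun 2 (fun l => (nth 0%N l 1).+1%:R).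
    by apply: (pfun_ext _ (pfun_add v1 (pfun_const _ 1))) => l; rewrite natr1.
  have v01 : pfun 2 (fun l => (nth 0%N l 0 + nth 0%N l 1).+1%:R).
    by apply: (pfun_ext _ (pfun_add v0 v1S)) => l; rewrite -natrD addnS.
  apply: pfun_sum => -[j jr] _; have [pP _ _] := HP _ jr.
  apply: pfun_mul (pfun_const _ _); apply: pfun_add.
    by apply: pfun_mul (pfun_exp _ v01); apply: pfun_comp pP _ => -[|[|]].
  apply: pfun_opp; apply: pfun_mul (pfun_exp _ v1S).
  by apply: pfun_comp pP _ => -[|[|]].
Qed.

(** * State sums order by order in h *)

Lemma big_kseqs (V : nmodType) g w c (P : pred (seq nat)) (F : seq nat -> V) :
  \sum_(ks <- kseqs (g :: w) c | P ks) F ks =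
  \sum_(k < (nth 0%N c g).+1) \sum_(ks <- kseqs w (step g c k) | P (nat_of_ord k :: ks)) F (nat_of_ord k :: ks).
Proof.
rewrite kseqsS big_mkcond big_allpairs_dep /= -(big_mkord xpredT (fun k => \sum_(ks <- kseqs w (step g c k) | P (k :: ks)) F (k :: ks))).
by rewrite /index_iota subn0; apply: eq_bigr => k _; rewrite [RHS]big_mkcond.
Qed.

Definition hyf r (a b : int) : {poly rat} := ehalf a r *: 'X^(absz b).

(** The coefficient of [h^r] at [s = exp (h/2)], as a polynomial in [y = 1/t]; only used for
    Laurent polynomials all of whose exponents in [t] are nonpositive. *)
Definition hy r (p : lpoly) : {poly rat} := lsum (hyf r) p.

Lemma abszD_nonpos (a b : int) : a <= 0 -> b <= 0 -> absz (a + b) = (absz a + absz b)%N.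
Proof. by lia. Qed.

Lemma hyM r p p' :
  (forall m, m \in p -> m.2.2 <= 0) -> (forall m, m \in p' -> m.2.2 <= 0) ->
  hy r (lmul p p') = \sum_(i < r.+1) hy i p * hy (r - i) p'.
Proof.
move=> np np'; apply: lsum_lmul => m1 m2 /np b1 /np' b2.
rewrite /hyf ehalfD scaler_suml; apply: eq_bigr => i _.
by rewrite -scalerAl -scalerAr scalerA -exprD abszD_nonpos.
Qed.

(** [Rcoef] with its product expanded by the [q]-binomial theorem; [m] becomes the number of staying
    particles of the second kind. *)
Definition Rexp i j k : lpoly := flatten
  [seq lmul (lmono ((-1) ^+ m)
       (Posz (2 * ((i - k) * j + j * m + 'C(m, 2) + m) + (1 + (i - k) + j))%N)
       (- Posz (1 + (i - k) + j + 2 * m)%N)) (lmul (gauss i k) (gauss k m))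
  | m <- iota 0 k.+1].

Lemma lsum_flatten (R : comNzRingType) (f : int -> int -> R) ps :
  lsum f (flatten ps) = \sum_(p <- ps) lsum f p.
Proof. by rewrite /lsum big_flatten. Qed.

Lemma intr_sign (R : comNzRingType) m : ((-1) ^+ m : int)%:~R = (-1) ^+ m :> R.
Proof. exact: rmorph_sign. Qed.

Lemma lsum_Rcoef (R : comNzRingType) (f : int -> int -> R) i j k :
  lsum f (Rcoef i j k) = lsum f (Rexp i j k).
Proof.
apply: lpoly_ext => s t s1 t1.
have s0 : s != 0 by rewrite gt_eqF // (lt_trans ltr01).
have t0 : t != 0 by rewrite gt_eqF // (lt_trans ltr01).
rewrite lev_Rcoef // /lev lsum_flatten big_map.
rewrite /rmx qbinomial_theorem mulr_sumr.
rewrite -(big_mkord xpredT (fun m => gbin (s ^+ 2) i k * (s ^+ 2) ^+ ((i - k) * j) *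
  (s / t) ^+ (1 + (i - k) + j) * ((-1) ^+ m * (s ^+ 2) ^+ 'C(m, 2) *
  gbin (s ^+ 2) k m * ((s / t) ^+ 2 * (s ^+ 2) ^+ j) ^+ m))).
rewrite /index_iota subn0; apply: eq_bigr => m _.
rewrite -/(lev s t _) !lev_lmul // lev_lmono !lev_gauss // -exprnP -exprnN.
set d := (i - k)%N; set c := 'C(m, 2).
rewrite (exprD s (2 * _)) (exprM s 2) (exprD (s ^+ 2)) (exprD (s ^+ 2)) (exprD (s ^+ 2)).
rewrite (exprD t (1 + d + j)) (exprM t 2) (exprMn (1 + d + j) s) (exprMn m).
rewrite (exprMn 2 s) (exprMn m (s ^+ 2)) !(exprVn t) (exprVn (t ^+ 2)) -(exprM (s ^+ 2) j m).
rewrite intr_sign.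
have h1 : t ^+ (1 + d + j) != 0 by rewrite expf_neq0.
have h2 : (t ^+ 2) ^+ m != 0 by rewrite !expf_neq0.
move: h1 h2 (gbin _ i k) (gbin _ k m) ((s ^+ 2) ^+ (d * j)) ((s ^+ 2) ^+ (j * m))
  ((s ^+ 2) ^+ c) ((s ^+ 2) ^+ m) (s ^+ (1 + d + j)) ((-1) ^+ m).
move: (t ^+ (1 + d + j)) ((t ^+ 2) ^+ m) => y1 y2 h1 h2 g1 g2 x1 x2 x3 x4 x5 x6.
by field; rewrite h1 h2.
Qed.

Lemma lsum_polyC (f : int -> int -> rat) p :
  lsum (fun a b => (f a b)%:P) p = (lsum f p)%:P :> {poly rat}.
Proof. by rewrite /lsum rmorph_sum; apply: eq_bigr => m _; rewrite rmorphMz. Qed.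

Lemma hy_mono_lmul r c e b p : b <= 0 -> (forall m, m \in p -> m.2.2 = 0) ->
  hy r (lmul (lmono c e b) p) =
  (c%:~R * \sum_(i < r.+1) ehalf e i * lsum (fun a _ => ehalf a (r - i)) p) *: 'X^(absz b).
Proof.
move=> b0 p0; rewrite hyM => [|m|m /p0 -> //]; last by rewrite inE => /eqP ->.
rewrite mulr_sumr scaler_suml; apply: eq_bigr => i _.
rewrite {1}/hy lsum_lmono /hyf.
have -> : hy (r - i) p = (lsum (fun a _ => ehalf a (r - i)) p)%:P.
  rewrite -lsum_polyC; apply: lsum_eq => m /p0 ->.
  by rewrite /hyf expr0 alg_polyC.
rewrite -[_ *~ c](@scaler_int rat) mulrC mul_polyC !scalerA; congr (_ *: _); ring.
Qed.

Lemma hy_Rcoef r : exists p, [/\ pfun 4 p, r = 0%N -> forall l, p l = 1 & forall i j k, (k <= i)%N ->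
  hy r (Rcoef i j k) = \sum_(m < k.+1) ('C(i, k) * 'C(k, m))%:R *:
    (p [:: (i - k)%N; j; (k - m)%N; m : nat] *: ('X^(1 + (i - k) + j) * (- 'X^2) ^+ m))].
Proof.
have [P HP] := gmom_poly r.+1.
(* Half the exponent of [s] in [Rexp] as a function of the log; the two Gaussian binomials account
   for the two factors [P] below. *)
pose E (l : seq nat) : rat := (nth 0%N l 0)%:R * (nth 0%N l 1)%:R + (nth 0%N l 1)%:R * (nth 0%N l 3)%:R
  + ('C(nth 0%N l 3, 2))%:R + (nth 0%N l 3)%:R + (1 + (nth 0%N l 0)%:R + (nth 0%N l 1)%:R) / 2.
pose p (l : seq nat) := \sum_(a < r.+1) E l ^+ a / a`!%:R *
  \sum_(x < (r - a).+1) P x [:: nth 0%N l 0; (nth 0%N l 2 + nth 0%N l 3)%N] *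
                        P (r - a - x)%N [:: nth 0%N l 2; nth 0%N l 3].
exists p; split.
  have v i : (i < 4)%N -> pfun 4 (fun l => (nth 0%N l i)%:R) by apply: pfun_var.
  have pE : pfun 4 E.
    apply: pfun_add.
      apply: pfun_add (v 3%N isT); apply: pfun_add; last exact: pfun_bin.
      by apply: pfun_add; apply: pfun_mul; apply: v.
    apply: pfun_mul (pfun_const _ _).
    by apply: pfun_add (v 1%N isT); apply: pfun_add (pfun_const _ _) (v 0%N isT).
  apply: pfun_sum => -[a ar] _; apply: pfun_mul.
    by apply: pfun_mul (pfun_const _ _); apply: pfun_exp.
  apply: pfun_sum => -[x xr] _ /=.
  have [|P1 _ _] := HP x; first by clear -xr ar; lia.
  have [|P2 _ _] := HP (r - a - x)%N; first by clear; lia.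
  apply: pfun_mul.
    apply: (pfun_comp P1) => -[|[|]] //= _; first exact: v.
    by apply: (pfun_ext _ (pfun_add (v 2%N isT) (v 3%N isT))) => l; rewrite natrD.
  by apply: (pfun_comp P2) => -[|[|]] //= _; apply: v.
- move=> r0 l; have [|_ _ P0] := HP 0%N; first by [].
  by rewrite /p r0 big_ord1 big_ord1 expr0 fact0 divr1 !P0 // !mulr1.
move=> i j k ki; rewrite /hy lsum_Rcoef lsum_flatten big_map.
have -> : iota 0 k.+1 = index_iota 0 k.+1 by rewrite /index_iota subn0.
rewrite big_mkord; apply: eq_bigr => -[m mk] _ /=; rewrite ltnS in mk.
rewrite -/(hy r _) hy_mono_lmul //; last first.
  pose Q (u : int * int) := u.2 = 0.
  apply: (@mem_lmul Q Q Q) => [x|x|u v]; rewrite /Q.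
  - by case/gauss_term.
  - by case/gauss_term.
  - by move=> -> ->.
set d := (i - k)%N; set B := (k - m)%N.
have Ei : i = (d + (B + m))%N by rewrite /d /B; lia.
have Ek : k = (B + m)%N by rewrite /B; lia.
have -> : absz (- Posz (1 + d + j + 2 * m)%N) = (1 + d + j + 2 * m)%N by lia.
rewrite -[- 'X^2]mulN1r exprMn -exprM (exprD 'X (1 + d + j)).
have -> : (-1) ^+ m = ((-1) ^+ m)%:P :> {poly rat} by rewrite rmorphXn rmorphN1.
rewrite [X in _ = _ *: (_ *: X)]mulrCA mul_polyC !scalerA; congr (_ *: _).
rewrite intr_sign [LHS]mulrC; congr (_ * _).
rewrite mulr_sumr; apply: eq_bigr => -[a ar] _ /=; rewrite ltnS in ar.
have -> : ehalf (Posz (2 * (d * j + j * m + 'C(m, 2) + m) + (1 + d + j))) a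
   = E [:: d; j; B; m] ^+ a / a`!%:R.
  rewrite /ehalf; set n := (2 * _ + _)%N; suff -> : n%:~R / 2 = E [:: d; j; B; m] by [].
  have -> : n%:~R = n%:R :> rat by [].
  by rewrite /n /E /= !(natrD, natrM); field.
rewrite lsum_ehalfM mulrCA; congr (_ * _); rewrite mulr_sumr.
apply: eq_bigr => -[x xr] _ /=.
have [|_ G1 _] := HP x; first by clear -xr ar; lia.
have [|_ G2 _] := HP (r - a - x)%N; first by clear; lia.
rewrite -/(gmom i k x) -/(gmom k m (r - a - x)) {1 2}Ei {1 2}Ek G1.
by rewrite {1}Ek G2 -Ei -Ek natrM; ring.
Qed.

Lemma finite_choice (T : Type) (Phi : nat -> T -> Prop) :
  (forall r, exists f, Phi r f) -> forall n, exists F, forall r, (r < n)%N -> Phi r (F r).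
Proof.
move=> ex; elim=> [|n [F HF]]; first by have [f _] := ex 0%N; exists (fun=> f).
have [f Hf] := ex n; exists (fun r => if (r < n)%N then F r else f) => r.
by rewrite ltnS leq_eqVlt => /predU1P[->|rn]; rewrite ?ltnn ?rn //; apply: HF.
Qed.

(** The values of the free weights [al], [be], [ga1], [ga2] for the [R]-matrix at [h = 0]. *)
Definition yval (i : nat) : {poly rat} := nth 1 [:: 'X; 'X; 1; - 'X^2] (i %% 4).

Lemma hy_pathw r g w c k ks :
  hy r (pathw (g :: w) c (k :: ks)) =
  \sum_(i < r.+1) hy i (Rcoef (nth 0%N c g) (nth 0%N c g.+1) k) * hy (r - i) (pathw w (step g c k) ks).
Proof.
apply: hyM => m; first by move/Rcoef_term/expo_from_le0.
by move/pathw_term/expo_from_le0.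
Qed.

Lemma hy_lone r : hy r lone = (r == 0%N)%:R.
Proof. by rewrite /hy lsum_lmono /hyf ehalf00 expr0 mulr1z scaler_nat. Qed.

Lemma rsum_sum (V : nmodType) (I : Type) (r : seq I) w c (F : I -> seq nat -> seq nat -> V) :
  rsum w c (fun l e => \sum_(i <- r) F i l e) = \sum_(i <- r) rsum w c (F i).
Proof.
elim: r => [|i r IH].
  rewrite big_nil (@eq_rsum _ _ _ _ (fun _ _ => 0 : V)) => [|l e _]; last by rewrite big_nil.
  by elim: w c => //= g w IH c; rewrite big1 // => k _; rewrite big1 // => m _; rewrite IH mul0rn.
rewrite big_cons -IH -rsumD; apply: eq_rsum => l e _; by rewrite big_cons.
Qed.

(** Orders in [h] add up along the word, so the polynomials of [hy_Rcoef] convolve; the power of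
    ['X] in front collects the factor [y] that each crossing carries even without particles. *)
Lemma hy_pathsum w r : exists Q, [/\ pfun (4 * size w) Q, r = 0%N -> forall l, Q l = 1 & forall c c',
  \sum_(ks <- kseqs w c | pathend w c ks == c') hy r (pathw w c ks) =
  'X^(size w) * rsum w c (fun l e => if e == c' then Q l *: mval yval l else 0)].
Proof.
elim: w r => [|g w IH] r.
  exists (fun=> (r == 0%N)%:R); split=> [|-> //|c c']; first exact: pfun_const.
  rewrite big_mkcond big_seq1 /= hy_lone expr0 mul1r.
  by case: eqP => // _; rewrite scaler_nat.
have [p Hp] := finite_choice hy_Rcoef r.+1.
have [Q HQ] := finite_choice IH r.+1.
pose h4 (l : seq nat) := [:: nth 0%N l 0; nth 0%N l 1; nth 0%N l 2; nth 0%N l 3].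
exists (fun l => \sum_(i < r.+1) p i (h4 l) * Q (r - i)%N (drop 4 l)); split.
  apply: pfun_sum => -[i ir] _ /=; apply: pfun_mul.
    have [pp _ _] := Hp i ir.
    by apply: (pfun_comp pp) => -[|[|[|[|]]]] //= _; apply: pfun_var; rewrite mulnS.
  have ri : (r - i < r.+1)%N by rewrite ltnS leq_subr.
  have [pQ _ _] := HQ _ ri; apply: (pfun_comp pQ) => j jw.
  apply: (pfun_ext _ (@pfun_var (4 * (size w).+1) (4 + j) _)) => [l|]; first by rewrite nth_drop.
  by rewrite mulnS ltn_add2l.
- move=> r0 l; rewrite r0 in Hp HQ *; have [_ p1 _] := Hp 0%N isT; have [_ Q1 _] := HQ 0%N isT.
  by rewrite big_ord1 p1 // Q1 // mulr1.
move=> c c'; rewrite big_kseqs [RHS]/= mulr_sumr; apply: eq_bigr => k _.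
have kc : (k <= nth 0%N c g)%N by rewrite -ltnS.
rewrite (eq_bigl (fun ks => pathend w (step g c k) ks == c')); last first.
  by move=> ks; rewrite pathend_cons.
under eq_bigr => ks _ do rewrite hy_pathw.
rewrite exchange_big mulr_sumr /=.
transitivity (\sum_(i < r.+1) \sum_(m < k.+1)
   'X^((size w).+1) * (rsum w (step g c k) (fun l e => if e == c' then
      (p i [:: (nth 0%N c g - k)%N; nth 0%N c g.+1; (k - m)%N; m : nat] * Q (r - i)%N l) *:
      mval yval [:: (nth 0%N c g - k)%N, nth 0%N c g.+1, (k - m)%N, m : nat & l] else 0)
      *+ ('C(nth 0%N c g, k) * 'C(k, m)))); last first.
  rewrite exchange_big; apply: eq_bigr => m _ /=; rewrite -mulr_sumr; congr (_ * _).
  rewrite sumrMnl; congr (_ *+ _).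
  rewrite -rsum_sum; apply: eq_rsum => l e _; case: ifP => _; last by rewrite big1.
  by rewrite -scaler_suml /= drop0.
apply: eq_bigr => -[i ir] _ /=.
have ri : (r - i < r.+1)%N by rewrite ltnS leq_subr.
have [_ _ HQi] := HQ _ ri; have [_ _ Hpi] := Hp i ir.
rewrite -mulr_sumr HQi Hpi // mulr_suml; apply: eq_bigr => m _.
set pv := p i _; set d := (nth 0%N c g - k)%N; set j := nth 0%N c g.+1.
have -> : rsum w (step g c k) (fun l e => if e == c' then
      (pv * Q (r - i)%N l) *: mval yval [:: d, j, (k - m)%N, m : nat & l] else 0) =
   pv%:P * ('X^(d + j) * (- 'X^2) ^+ m) * rsum w (step g c k) (fun l e =>
      if e == c' then Q (r - i)%N l *: mval yval l else 0).
  rewrite (@rsum_morph _ _ (fun z => pv%:P * ('X^(d + j) * (- 'X^2) ^+ m) * z)) ?mulr0 //; last exact: mulrDr.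
  apply: eq_rsum => l e _; case: ifP => _; last by rewrite mulr0.
  rewrite /= (@eq_mval _ (fun i => yval i.+4) yval) => [|n _]; last first.
    by rewrite /yval -addn4 modnDr.
  have [-> -> -> ->] : [/\ yval 0 = 'X, yval 1 = 'X, yval 2 = 1 & yval 3 = - 'X^2] by [].
  by rewrite expr1n -!mul_polyC polyCM exprD; ring.
rewrite scaler_nat mulrnAl mulrnAr; congr (_ *+ _).
by rewrite -mul_polyC -addnA exprD expr1 (exprS _ (size w)); ring.
Qed.

Lemma big_states (V : nmodType) n w W (F : seq nat -> seq nat -> V) :
  \sum_(St <- states n.+1 w W) F St.1 St.2 =
  \sum_(c <- comps n W) \sum_(ks <- kseqs w (0%N :: c) | pathend w (0%N :: c) ks == 0%N :: c)
     F (0%N :: c) ks.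
Proof.
rewrite /states big_allpairs_dep big_map; apply: eq_bigr => c _.
by rewrite big_filter.
Qed.

(** [contrib] without the factor [t^(N-1)], so that all exponents of [t] are nonpositive. *)
Definition precontrib n (w c ks : seq nat) : lpoly :=
  lmul (lmono 1 (- Posz (n + 2 * sumn c)%N) 0) (pathw w c ks).

Definition statesum n w r W : {poly rat} :=
  \sum_(St <- states n.+1 w W) hy r (precontrib n w St.1 St.2).

Lemma hy_precontrib n w c ks r : hy r (precontrib n w c ks) =
  \sum_(i < r.+1) (ehalf (- Posz (n + 2 * sumn c)%N) i)%:P * hy (r - i) (pathw w c ks).
Proof.
rewrite hyM => [|m|m]; last by move/pathw_term/expo_from_le0.
  by apply: eq_bigr => i _; rewrite {1}/hy lsum_lmono /hyf expr0 mulr1z alg_polyC.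
by rewrite inE => /eqP ->.
Qed.

Definition logval (i : nat) : {poly rat} := if i is i'.+1 then yval i' else 1.

Lemma statesum_logtrace n w r : exists Q, [/\ pfun (4 * size w).+1 Q, r = 0%N -> forall l, Q l = 1 &
  forall W, statesum n w r W = 'X^(size w) * logtrace n w logval Q W].
Proof.
have [Q HQ] := finite_choice (hy_pathsum w) r.+1.
(* Half the exponent of [s] in the closing factor of [precontrib]; the first log entry is the
   weight. *)
pose e (l : seq nat) : rat := - (n%:R + 2 * (nth 0%N l 0)%:R) / 2.
exists (fun l => \sum_(i < r.+1) e l ^+ i / i`!%:R * Q (r - i)%N (behead l)); split.
- apply: pfun_sum => -[i ir] _ /=.
  have ri : (r - i < r.+1)%N by rewrite ltnS leq_subr.
  apply: pfun_mul.
    apply: pfun_mul (pfun_const _ _); apply: pfun_exp; apply: pfun_mul (pfun_const _ _).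
    apply: pfun_opp; apply: pfun_add (pfun_const _ _) _.
    by apply: pfun_mul (pfun_const _ _) _; apply: pfun_var.
  have [pQ _ _] := HQ _ ri; apply: (pfun_comp pQ) => j jw.
  apply: (pfun_ext _ (@pfun_var (4 * size w).+1 j.+1 jw)) => l.
  by rewrite nth_behead.
- move=> r0 l; rewrite r0 in HQ *; have [_ Q1 _] := HQ 0%N isT.
  by rewrite big_ord1 Q1 // mulr1 expr0 fact0 divr1.
move=> W; rewrite /statesum (big_states _ _ _ (fun c ks => hy r (precontrib n w c ks))).
rewrite /logtrace mulr_sumr; apply: eq_big_seq => c; rewrite mem_comps => /andP[_ /eqP sc].
under eq_bigr => ks _ do rewrite hy_precontrib.
rewrite exchange_big /=.
transitivity (\sum_(i < r.+1) 'X^(size w) * rsum w (0%N :: c) (fun l e' =>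
   if e' == 0%N :: c then (e (W :: l) ^+ i / i`!%:R * Q (r - i)%N l) *: mval logval (W :: l) else 0)).
  apply: eq_bigr => -[i ir] _ /=; rewrite -mulr_sumr.
  have ri : (r - i < r.+1)%N by rewrite ltnS leq_subr.
  have [_ _ ->] := HQ _ ri; rewrite mulrCA; congr (_ * _).
  rewrite (@rsum_morph _ _ (fun z => (ehalf (- Posz (n + 2 * sumn (0%N :: c))%N) i)%:P * z)) ?mulr0 //; last exact: mulrDr.
  apply: eq_rsum => l e' _; case: ifP => _; last by rewrite mulr0.
  rewrite mul_polyC scalerA /= expr1n mul1r; congr ((_ * _) *: _).
  rewrite /ehalf /e /= sc; congr (_ ^+ _ / _).
  by rewrite rmorphN /= -[(Posz _)%:~R]/((n + 2 * W)%:R) natrD natrM.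
rewrite -mulr_sumr -rsum_sum; congr (_ * _); apply: eq_rsum => l e' _.
by case: ifP => _; [rewrite -scaler_suml | rewrite big1].
Qed.

(** One [d] serves all orders; its exact action at order 0 will show that it does not vanish when
    the weight variable is set to 1. *)
Theorem statesum_rational n w : all (fun g => g < n)%N w ->
  exists d : {poly {poly rat}},
    (forall W, smul d (statesum n w 0) W = (W == 0%N)%:R * 'X^(size w)) /\
    (forall r, rational_series d (statesum n w r)).
Proof.
move=> w_lt; have [d [d1 dr]] := insertion_rational logval w_lt.
exists d; split=> [W|r].
  have [Q [_ Q1 E]] := statesum_logtrace n w 0.
  rewrite (eq_smul _ (fun V _ => E V)) smulZr mulrC -d1; congr (_ * _).
  by apply: eq_smul => V _; apply: eq_logtrace => l; rewrite Q1.
have [Q [pQ _ E]] := statesum_logtrace n w r.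
have [M [p Ep]] := dr _ pQ; exists M, ('X^(size w) *: p) => W.
by rewrite (eq_smul _ (fun V _ => E V)) smulZr Ep coefZ.
Qed.

(** * Expansions at x = 1 *)

Section Convolution.
Variable R : comNzRingType.
Implicit Types f g h : nat -> R.

Definition cv f g i : R := \sum_(l < i.+1) f l * g (i - l)%N.

Lemma cv_poly f g m i : (i < m)%N ->
  cv f g i = ((\poly_(k < m) f k) * (\poly_(k < m) g k))`_i.
Proof.
move=> im; rewrite coefM; apply: eq_bigr => -[l li] _ /=.
by rewrite !coef_poly !ifT //; lia.
Qed.

Lemma eq_cv f f' g g' i : (forall l, (l <= i)%N -> f l = f' l) ->
  (forall l, (l <= i)%N -> g l = g' l) -> cv f g i = cv f' g' i.
Proof. by move=> ff gg; apply: eq_bigr => -[l li] _ /=; rewrite ff // gg // leq_subr. Qed.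

Lemma cvCA f g h i : cv f (cv g h) i = cv g (cv f h) i.
Proof.
have E a b : cv a (cv b h) i = ((\poly_(k < i.+1) a k) *
    ((\poly_(k < i.+1) b k) * (\poly_(k < i.+1) h k)))`_i.
  rewrite (cv_poly _ _ (ltnSn i)) coefM [RHS]coefM; apply: eq_bigr => -[l li] _ /=.
  congr (_ * _); rewrite coef_poly ifT; last by lia.
  by apply: cv_poly; lia.
by rewrite !E mulrCA.
Qed.

Lemma cvC f g i : cv f g i = cv g f i.
Proof. by rewrite !(cv_poly _ _ (ltnSn i)) mulrC. Qed.

Lemma cvA f g h i : cv (cv f g) h i = cv f (cv g h) i.
Proof.
rewrite cvC cvCA; apply: eq_cv => // l _; exact: cvC.
Qed.

Lemma cv_coef (p q : {poly R}) i : cv (fun e => p`_e) (fun e => q`_e) i = (p * q)`_i.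
Proof. by rewrite coefM. Qed.

Lemma cvB f g h i : cv f (fun l => g l - h l) i = cv f g i - cv f h i.
Proof. by rewrite /cv -sumrB; apply: eq_bigr => l _; rewrite mulrBr. Qed.

End Convolution.

Lemma cv_eq0 (R : idomainType) (f g : nat -> R) a : f a != 0 ->
  (forall i, cv f g i = 0) -> forall i, g i = 0.
Proof.
move=> fa fg0; case: (@ex_minnP (fun a => f a != 0)); first by exists a.
move=> {fa}a fa min i; elim/ltn_ind: i => i IH.
have := fg0 (a + i)%N; rewrite /cv.
have ai : (a < (a + i).+1)%N by rewrite ltnS leq_addr.
rewrite (bigD1 (Ordinal ai)) //= addKn big1 ?addr0 => [|[l lai]]; last first.
  rewrite -val_eqE /= neq_ltn => /orP[la|al].
    by apply/eqP; rewrite mulf_eq0; apply/orP; left; apply/negPn/negP => /min; rewrite leqNgt la.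
  by rewrite IH ?mulr0 //; lia.
by move/eqP; rewrite mulf_eq0 (negPf fa) => /eqP.
Qed.

(** Vandermonde: the moments pair [c] to zero with every polynomial, and one whose roots are all
    nodes but [x k] isolates [c k]. *)
Lemma moments_eq0 (F : fieldType) (I : eqType) (s : seq I) (c x : I -> F) :
  uniq s -> injective x -> (forall i, \sum_(k <- s) c k * x k ^+ i = 0) ->
  forall k, k \in s -> c k = 0.
Proof.
move=> us xinj mom k ks.
have hor (q : {poly F}) : \sum_(l <- s) c l * q.[x l] = 0.
  under eq_bigr => l _ do rewrite horner_coef mulr_sumr.
  rewrite exchange_big big1 // => i _ /=; under eq_bigr => l _ do rewrite mulrCA.
  by rewrite -mulr_sumr mom mulr0.
pose q := \prod_(y <- map x (rem k s)) ('X - y%:P).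
have rq l : root q (x l) = (l \in rem k s) by rewrite root_prod_XsubC mem_map.
have := hor q; rewrite (perm_big _ (perm_to_rem ks)) big_cons /= [X in _ + X]big_seq big1 => [|l].
  by move=> /eqP; rewrite addr0 mulf_eq0 -/(root q (x k)) rq mem_rem_uniq // !inE eqxx orbF => /eqP.
by rewrite -rq => /eqP ->; rewrite mulr0.
Qed.

Lemma half_inj : injective (fun a : int => a%:~R / 2 : rat).
Proof. by move=> a b /(congr1 (fun z => z * 2)); rewrite !divfK // => /intr_inj. Qed.

(** [tay i p] is the coefficient of [u^i] in [p(exp(-u/2))]. *)
Definition tay i (p : {poly rat}) : rat := \sum_(e < size p) p`_e * ehalf (- Posz e) i.

Lemma tay_wide i (p : {poly rat}) m : (size p <= m)%N ->
  tay i p = \sum_(e < m) p`_e * ehalf (- Posz e) i.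
Proof.
move=> pm; rewrite /tay (big_ord_widen m (fun e => p`_e * ehalf (- Posz e) i)) //.
rewrite big_mkcond; apply: eq_bigr => e _ /=; case: ltnP => // /(nth_default 0) ->.
by rewrite mul0r.
Qed.

Lemma tayD i p q : tay i (p + q) = tay i p + tay i q.
Proof.
set m := maxn (size p) (size q).
rewrite !(@tay_wide _ _ m) ?leq_maxl ?leq_maxr ?size_polyD // -big_split.
by apply: eq_bigr => e _; rewrite coefD mulrDl.
Qed.

Lemma tayZ i c p : tay i (c *: p) = c * tay i p.
Proof.
rewrite (@tay_wide _ (c *: p) (size p)) ?size_scale_leq // /tay mulr_sumr.
by apply: eq_bigr => e _; rewrite coefZ mulrA.
Qed.

Lemma tay0 i : tay i 0 = 0.
Proof. by rewrite /tay size_poly0 big_ord0. Qed.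

Lemma tay_sum i (I : Type) (r : seq I) (F : I -> {poly rat}) :
  tay i (\sum_(x <- r) F x) = \sum_(x <- r) tay i (F x).
Proof. exact: (big_morph (tay i) (tayD i) (tay0 i)). Qed.

Lemma tayXn i e : tay i 'X^e = ehalf (- Posz e) i.
Proof.
rewrite (@tay_wide _ _ e.+1) ?size_polyXn // big_ord_recr /= coefXn eqxx mul1r.
by rewrite big1 ?add0r // => l _; rewrite coefXn (ltn_eqF (ltn_ord l)) mul0r.
Qed.

Lemma tayM i p q : tay i (p * q) = cv (tay^~ p) (tay^~ q) i.
Proof.
have -> : p * q = \sum_(a < size p) \sum_(b < size q) (p`_a * q`_b) *: 'X^(a + b).
  rewrite -{1}[p]coefK -{1}[q]coefK !poly_def big_distrlr /=.
  by do 2![apply: eq_bigr => ? _]; rewrite -scalerAl -scalerAr scalerA exprD.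
rewrite tay_sum /cv; under [RHS]eq_bigr => l _ do rewrite /tay big_distrlr /=.
rewrite [RHS]exchange_big /=; apply: eq_bigr => a _.
rewrite [RHS]exchange_big tay_sum /=; apply: eq_bigr => b _.
rewrite tayZ tayXn PoszD opprD ehalfD mulr_sumr; apply: eq_bigr => l _; ring.
Qed.

Lemma tay_inj p : (forall i, tay i p = 0) -> p = 0.
Proof.
move=> t0; apply/polyP => e; rewrite coef0.
have [pe|ep] := leqP (size p) e; first by rewrite nth_default.
have xinj : injective (fun k : nat => (- Posz k)%:~R / 2 : rat).
  by move=> k l /half_inj /eqP; rewrite eqr_opp => /eqP [].
apply: (moments_eq0 (iota_uniq 0 (size p)) xinj (c := fun k => p`_k)); last by rewrite mem_iota.
move=> i; have /(congr1 (fun z => z * i`!%:R)) := t0 i.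
rewrite mul0r mulr_suml => t; apply: etrans t.
have -> : iota 0 (size p) = index_iota 0 (size p) by rewrite /index_iota subn0.
rewrite big_mkord; apply: eq_bigr => k _.
by rewrite /ehalf -mulrA divfK // fact_rat_neq0.
Qed.

(** A rational function is determined by its expansion at [y = 1]. *)
Lemma expansion_transfer (G p1 D P : {poly rat}) (h Z : nat -> rat) : G != 0 ->
  (forall i, cv (fun e => G`_e) h i = p1`_i) ->
  (forall i, cv (tay^~ G) Z i = tay i p1) ->
  (forall i, cv (tay^~ D) Z i = tay i P) ->
  forall i, cv (fun e => D`_e) h i = P`_i.
Proof.
move=> G0 Gh GZ DZ.
have DG : D * p1 = G * P.
  apply/eqP; rewrite -subr_eq0; apply/eqP; apply: tay_inj => i.
  rewrite tayD -scaleN1r tayZ mulN1r !tayM.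
  rewrite (@eq_cv _ _ (tay^~ D) _ (cv (tay^~ G) Z)) //.
  rewrite (@eq_cv _ (tay^~ G) (tay^~ G) (tay^~ P) (cv (tay^~ D) Z)) //.
  by rewrite cvCA subrr.
have lG : G`_(size G).-1 != 0 by rewrite -/(lead_coef G) lead_coef_eq0.
move=> i; apply/eqP; rewrite -subr_eq0; apply/eqP; move: i.
apply: (cv_eq0 (f := fun e => G`_e) lG) => i; rewrite cvB cv_coef cvCA -DG -cv_coef.
by rewrite (@eq_cv _ _ (fun e => D`_e) _ (fun e => p1`_e)) ?subrr.
Qed.

Definition sums_to (V : nmodType) (f : nat -> V) (s : V) : Prop :=
  exists m, forall n, (m <= n)%N -> \sum_(i < n) f i = s.

Lemma sums_to_finite (V : nmodType) (f : nat -> V) m : (forall i, (m <= i)%N -> f i = 0) ->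
  sums_to f (\sum_(i < m) f i).
Proof.
move=> f0; exists m => n mn; rewrite (big_ord_widen n f mn) [RHS]big_mkcond.
by apply: eq_bigr => i _; case: ltnP => // /f0.
Qed.

Lemma sums_to_uniform (V : nmodType) (f : nat -> nat -> V) (s : nat -> V) :
  (forall i, sums_to (f i) (s i)) -> forall r, exists m, forall n i, (m <= n)%N -> (i <= r)%N ->
  \sum_(W < n) f i W = s i.
Proof.
move=> fs; elim=> [|r [m Hm]].
  by have [m Hm] := fs 0%N; exists m => n i mn; rewrite leqn0 => /eqP ->; apply: Hm.
have [m' Hm'] := fs r.+1; exists (maxn m m') => n i; rewrite geq_max => /andP[mn m'n].
by rewrite leq_eqVlt => /predU1P[->|]; [apply: Hm' | apply: Hm].
Qed.

(** The value at [1] of a power series with polynomial coefficients, for any grading [phi]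
    of [{poly rat}] for which the sum of the coefficients makes sense. *)
Lemma smul_specialize (phi : nat -> {poly rat} -> rat) (G p : {poly {poly rat}}) H hs :
  (forall i a b, phi i (a + b) = phi i a + phi i b) ->
  (forall i a b, phi i (a * b) = cv (phi^~ a) (phi^~ b) i) ->
  (forall W, smul G H W = p`_W) ->
  (forall i, sums_to (fun W => phi i (H W)) (hs i)) ->
  forall i, cv (phi^~ G.[1]) hs i = phi i p.[1].
Proof.
move=> phiD phiM GH Hhs i.
have phi0 l : phi l 0 = 0 by apply: (addrI (phi l 0)); rewrite -phiD !addr0.
have phi_sum l n (F : 'I_n -> {poly rat}) : phi l (\sum_k F k) = \sum_k phi l (F k).
  exact: (big_morph (phi l) (phiD l) (phi0 l)).
have horner1 l (q : {poly {poly rat}}) n : (size q <= n)%N ->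
    phi l q.[1] = \sum_(k < n) phi l q`_k.
  move=> qn; rewrite (horner_coef_wide _ qn) phi_sum.
  by apply: eq_bigr => k _; rewrite expr1n mulr1.
have [m Hm] := sums_to_uniform Hhs i.
pose V := (m + size G + size p)%N.
rewrite (@horner1 _ _ V); last by rewrite /V; lia.
under [RHS]eq_bigr => W _ do rewrite -GH /smul phi_sum.
transitivity (\sum_(a < V) \sum_(W < V | (a <= W)%N) phi i (G`_a * H (W - a)%N)); last first.
  rewrite (exchange_big_dep xpredT) //=; apply: eq_bigr => -[W WV] _ /=.
  rewrite -(big_mkord (fun a => a <= W)%N (fun a => phi i (G`_a * H (W - a)%N))).
  by rewrite -(big_mkord xpredT (fun a => phi i (G`_a * H (W - a)%N))) (big_nat_widen _ _ _ _ _ WV).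
transitivity (\sum_(a < V) \sum_(l < i.+1) phi l G`_a * hs (i - l)%N).
  rewrite exchange_big; apply: eq_bigr => l _ /=.
  by rewrite (@horner1 _ _ V) ?mulr_suml //; rewrite /V; lia.
apply: eq_bigr => -[a aV] _ /=.
rewrite -(big_mkord (fun W => a <= W)%N (fun W => phi i (G`_a * H (W - a)%N))).
have -> : \sum_(0 <= W < V | (a <= W)%N) phi i (G`_a * H (W - a)%N) =
    \sum_(a <= W < V) phi i (G`_a * H (W - a)%N) by rewrite [RHS](big_nat_widenl _ 0).
rewrite -{2}[a]add0n big_addn big_mkord.
under [RHS]eq_bigr => W _ do rewrite addnK phiM /cv.
rewrite exchange_big; apply: eq_bigr => l _ /=; rewrite -mulr_sumr.
have [Ga|aG] := leqP (size G) a; first by rewrite nth_default // phi0 !mul0r.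
by rewrite Hm // ?leq_subr //; move: aV; rewrite /V; lia.
Qed.

Lemma lsum_lmono_lmul (R : comNzRingType) (f : int -> int -> R) x y p :
  lsum f (lmul (lmono 1 x y) p) = lsum (fun a b => f (x + a) (y + b)) p.
Proof.
rewrite /lsum /lmul /lmono /= cats0 big_map; apply: eq_bigr => m _ /=.
by rewrite mul1r.
Qed.

(** [bitay i j] extracts the coefficient of [u^i h^j] at [s = exp(h/2)], [t = exp(u/2)]. *)
Definition bitay i j (a b : int) : rat := ehalf b i * ehalf a j.

Lemma lsum_bitay_lmul i j p r : lsum (bitay i j) (lmul p r) =
  \sum_(k : 'I_i.+1 * 'I_j.+1) lsum (bitay k.1 k.2) p * lsum (bitay (i - k.1) (j - k.2)) r.
Proof.
apply: lsum_lmul => m1 m2 _ _; rewrite /bitay !ehalfD big_distrlr pair_bigA /=.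
by apply: eq_bigr => k _; ring.
Qed.

Definition vanish_order d p := forall i j, (i + j < d)%N -> lsum (bitay i j) p = 0.

Lemma vanish_order_lmul d d' p r :
  vanish_order d p -> vanish_order d' r -> vanish_order (d + d') (lmul p r).
Proof.
move=> vp vr i j ij; rewrite lsum_bitay_lmul big1 // => -[[k ki] [l lj]] _ /=.
have [kl|kl] := ltnP (k + l) d; first by rewrite vp // mul0r.
by rewrite vr ?mulr0 //; lia.
Qed.

Lemma vanish_order0 p : vanish_order 0 p.
Proof. by []. Qed.

Lemma vanish_order_lmulr d p r : vanish_order d r -> vanish_order d (lmul p r).
Proof. exact: (vanish_order_lmul (@vanish_order0 p)). Qed.

Lemma vanish_order_lmull d p r : vanish_order d p -> vanish_order d (lmul p r).
Proof. by move=> vp; rewrite -[d]addn0; apply: vanish_order_lmul. Qed.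

(** Each of the [k] factors [1 - x^(-1) q^(j+l)] vanishes at [u = h = 0]. *)
Lemma vanish_order_Rcoef i j k : vanish_order k (Rcoef i j k).
Proof.
rewrite /Rcoef /=; apply: vanish_order_lmulr; apply: vanish_order_lmulr.
apply: vanish_order_lmull; rewrite -{1}[k](size_iota 1).
elim: (iota 1 k) => [|l r IH] //=; rewrite -add1n; apply: vanish_order_lmul IH => -[|i'] [|j'] // _.
by rewrite /lsum !big_cons big_nil /bitay !ehalf0 mulr1 mulrN1z mulr1z addr0 subrr.
Qed.

Lemma vanish_order_pathw w c ks : kval w c ks -> vanish_order (sumn ks) (pathw w c ks).
Proof.
elim: w c ks => [|g w IH] c [|k ks] //= /andP[_ kv].
by apply: vanish_order_lmul (@vanish_order_Rcoef _ _ _) (IH _ _ kv).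
Qed.

Section ClosedBraid.
Variables (n : nat) (w : seq nat).
Hypotheses (wn : all (fun g => g < n)%N w) (kn : is_knot n.+1 w).

(** The weight [W] part of the coefficient of [h^j] of the trace, as a polynomial in [1/t]. *)
Definition hypart j W : {poly rat} := \sum_(St <- states n.+1 w W) hy j (contrib n.+1 w St).

Lemma statesum_hypart j W : statesum n w j W = 'X^n * hypart j W.
Proof.
rewrite /statesum /hypart mulr_sumr; apply: eq_big_seq => St Ss.
rewrite /hy /precontrib /contrib !lsum_lmono_lmul /= /lsum mulr_sumr; apply: eq_big_seq => m mp.
have mc : (1 * m.1, (- Posz (n + 2 * sumn St.1)%N + m.2.1, Posz n + m.2.2)) \in contrib n.+1 w St.
  by rewrite /contrib /lmul /lmono /= cats0; apply/mapP; exists m.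
have [a [b [_ /= nb _]]] := contrib_term wn kn Ss mc.
rewrite /hyf mulrzAr -scalerAr -exprD; congr (_ *: 'X^_ *~ _); lia.
Qed.

Lemma coef_hy j p i : (hy j p)`_i = lsum (fun a b => ehalf a j * (i == absz b)%:R) p.
Proof.
rewrite /hy /lsum coef_sum; apply: eq_bigr => m _.
by rewrite coefMrz /hyf coefZ coefXn.
Qed.

Lemma hypart_coef0 j W i : (i < 2 * W)%N -> (hypart j W)`_i = 0.
Proof.
move=> iW; rewrite /hypart coef_sum big_seq big1 // => St Ss; rewrite coef_hy /lsum big_seq big1 //.
move=> m mc; have [a [b [_ -> _]]] := contrib_term wn kn Ss mc.
by rewrite abszN absz_nat; case: eqP => [?|_]; [lia | rewrite mulr0 mul0rz].
Qed.

Definition hseries j i : rat := \sum_(W < i.+1) (hypart j W)`_i.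

Lemma hseriesP j i : sums_to (fun W => (hypart j W)`_i) (hseries j i).
Proof. by apply: sums_to_finite => W iW; rewrite hypart_coef0 //; lia. Qed.

Lemma tay_hypart i j W :
  tay i (hypart j W) = \sum_(St <- states n.+1 w W) lsum (bitay i j) (contrib n.+1 w St).
Proof.
rewrite /hypart tay_sum; apply: eq_big_seq => St Ss; rewrite /hy /lsum tay_sum.
apply: eq_big_seq => m mc; have [a [b [_ mb _]]] := contrib_term wn kn Ss mc.
by rewrite /hyf -scaler_int scalerA tayZ tayXn /bitay mb abszN absz_nat -[RHS]mulrzl; ring.
Qed.

Definition is_useries (Z : nat -> nat -> rat) :=
  forall j i, sums_to (fun W => tay i (hypart j W)) (Z j i).

(** A state of weight above [C * (i + j)] has more than [i + j] staying particles, so its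
    contribution vanishes beyond the order of [u^i h^j]. *)
Lemma useries_exists : exists Z, is_useries Z.
Proof.
have [C HC] := knot_weight_bound kn.
exists (fun j i => \sum_(W < (C * (i + j)).+1) tay i (hypart j W)) => j i.
apply: sums_to_finite => W CW; rewrite tay_hypart big_seq big1 // => St Ss.
have [c [ks [-> sc sumc kv pe]]] := states_mem Ss.
rewrite /contrib; apply: vanish_order_lmulr (vanish_order_pathw kv) _ _ _ => /=.
have := HC c ks sc kv pe; rewrite sumc => Wk.
rewrite ltnNge; apply/negP => le; have := leq_trans CW Wk.
by rewrite ltnNge leq_mul2l le orbT.
Qed.

(** The series of [h^j]-coefficients expanded at [x = oo] and the one expanded at [x = 1] come
    from the same rational function. *)
Lemma hseries_rational Z j : is_useries Z -> exists G p : {poly rat},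
  [/\ G != 0, forall i, cv (fun e => G`_e) (hseries j) i = p`_i &
      forall i, cv (tay^~ G) (Z j) i = tay i p].
Proof.
move=> ZP; have [d [d0 dr]] := statesum_rational wn.
have coefD i (a b : {poly rat}) : (a + b)`_i = a`_i + b`_i by exact: coefD.
have coefM' i (a b : {poly rat}) : (a * b)`_i = cv (nth 0 a) (nth 0 b) i by exact: coefM.
have hspec (G p : {poly {poly rat}}) r : (forall W, smul G (hypart r) W = p`_W) ->
    forall i, cv (fun e => G.[1]`_e) (hseries r) i = p.[1]`_i.
  move=> Gp; apply: (smul_specialize (phi := fun i a => a`_i) coefD coefM' Gp).
  exact: hseriesP.
have Sh (G : {poly {poly rat}}) r W : smul G (statesum n w r) W = 'X^n * smul G (hypart r) W.
  by rewrite (eq_smul _ (fun V _ => statesum_hypart r V)) smulZr.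
have Xn0 : 'X^n != 0 :> {poly rat} by rewrite expf_neq0 ?polyX_eq0.
have [e we] := knot_size wn kn.
have d1 : d.[1] != 0.
  apply/negP => /eqP d1.
  have : forall W, smul d (hypart 0) W = ('X^(2 * e))%:P`_W.
    move=> W; apply: (mulfI Xn0); rewrite -Sh d0 we coefC exprD.
    by case: eqP => _; rewrite ?mul1r // !mul0r mulr0.
  move=> /hspec /(_ (2 * e)%N); rewrite hornerC coefXn eqxx d1 /cv.
  rewrite big1 => [|l _]; last by rewrite coef0 mul0r.
  by move/eqP; rewrite eq_sym oner_eq0.
have [M [p Ep]] := dr j.
exists ('X^n * (d ^+ M).[1]), p.[1].
have GE : 'X^n * (d ^+ M).[1] = (('X^n)%:P * d ^+ M).[1] by rewrite hornerCM.
have Gp W : smul (('X^n)%:P * d ^+ M) (hypart j) W = p`_W.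
  by rewrite smulM smulC -Sh Ep.
split; first by rewrite mulf_neq0 // horner_exp expf_neq0.
  by rewrite GE; apply: hspec.
rewrite GE; apply: (smul_specialize tayD tayM Gp) => i; exact: ZP.
Qed.

End ClosedBraid.

(** * Colored Jones polynomials from the full state sum *)

Lemma lsum_lmull (R : comNzRingType) (f : int -> int -> R) p r : lsum f (lmul p r) =
  \sum_(m <- r) lsum (fun a b => f (a + m.2.1) (b + m.2.2)) p *~ m.1.
Proof.
rewrite /lsum /lmul big_allpairs_dep exchange_big; apply: eq_bigr => m2 _ /=.
rewrite mulrz_suml; apply: eq_bigr => m1 _; by rewrite mulrzA.
Qed.

Lemma lsum_lmulr (R : comNzRingType) (f : int -> int -> R) p r : lsum f (lmul p r) =
  \sum_(m <- p) lsum (fun a b => f (m.2.1 + a) (m.2.2 + b)) r *~ m.1.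
Proof.
rewrite /lsum /lmul big_allpairs_dep; apply: eq_bigr => m1 _ /=.
rewrite mulrz_suml; apply: eq_bigr => m2 _; by rewrite -mulrzA mulrC.
Qed.

(** The Laurent polynomial vanishes at [t = s^m]. *)
Definition vanish_at m (p : lpoly) : Prop :=
  forall f : int -> rat, lsum (fun a b => f (a + Posz m * b)) p = 0.

Lemma vanish_at_lmull m p r : vanish_at m p -> vanish_at m (lmul p r).
Proof.
move=> vp f; rewrite lsum_lmull big1 // => m2 _.
have := vp (fun a => f (a + (m2.2.1 + Posz m * m2.2.2))) => E.
rewrite -[RHS](mul0rz _ m2.1) -E; congr (_ *~ _); apply: lsum_eq => m1 _.
by congr f; ring.
Qed.

Lemma vanish_at_lmulr m p r : vanish_at m r -> vanish_at m (lmul p r).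
Proof.
move=> vp f; rewrite lsum_lmulr big1 // => m2 _.
have := vp (fun a => f (a + (m2.2.1 + Posz m * m2.2.2))) => E.
rewrite -[RHS](mul0rz _ m2.1) -E; congr (_ *~ _); apply: lsum_eq => m1 _.
by congr f; ring.
Qed.

(** The factor with [l = m - j], present because [m <= j + k], is [1 - x^(-1) q^m]. *)
Lemma vanish_at_Rcoef m i j k : (j < m)%N -> (m <= j + k)%N -> vanish_at m (Rcoef i j k).
Proof.
move=> jm mjk; rewrite /Rcoef /=; apply: vanish_at_lmulr; apply: vanish_at_lmulr.
apply: vanish_at_lmull.
have : (m - j)%N \in iota 1 k by rewrite mem_iota; lia.
elim: (iota 1 k) => // l r IH; rewrite inE => /predU1P[<-|/IH mr] /=; last exact: vanish_at_lmulr.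
apply: vanish_at_lmull => f; rewrite /lsum !big_cons big_nil mulr1z mulrN1z addr0.
apply/eqP; rewrite subr_eq0; apply/eqP; congr f => /=.
have -> : (j + (m - j) = m)%N by lia.
by rewrite PoszM; ring.
Qed.

Lemma opw_posw s t w f c : s != 0 -> t != 0 -> all (fun g => g.+1 < size c)%N w ->
  opw (s ^+ 2) (s / t) (posw w) f c =
  \sum_(ks <- kseqs w c) lev s t (pathw w c ks) * f (pathend w c ks).
Proof.
move=> s0 t0; elim: w c => [|g v IH] c.
  by rewrite /= big_seq1 /lev lsum_lmono mulr1z mulr1 mul1r.
case/andP=> gc vc; rewrite big_kseqs /= {1}/sop /kap pairop_kp; apply: eq_bigr => k _.
rewrite -/(posw v) -/(opw _ _ _ _) -/(step g c k) IH ?size_step // mulr_sumr.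
apply: eq_bigr => ks _.
by rewrite lev_lmul // lev_Rcoef // mulrA pathend_cons.
Qed.

Section ColoredJones.
Variables (n : nat) (w : seq nat).
Hypotheses (wn : all (fun g => g < n)%N w) (kn : is_knot n.+1 w).

Definition low m (St : seq nat * seq nat) : bool :=
  all (all (fun i => i < m)%N) (pathvecs w St.1 St.2).

Lemma low_head m c ks : low m (c, ks) -> all (fun i => i < m)%N c.
Proof. by rewrite /low; case: w ks => [|g v] [|k ks] //= /andP[]. Qed.

Lemma contrib_not_low m W St : (0 < m)%N -> St \in states n.+1 w W -> ~~ low m St ->
  vanish_at m (contrib n.+1 w St).
Proof.
move=> m0 /states_mem[c [ks [-> sc _ kv pe]]] nl; apply: vanish_at_lmulr.
have := closed_low (@vanish_at_lmull m) (@vanish_at_lmulr m) (@vanish_at_Rcoef m) wn kn m0 sc kv pe.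
by case=> // lo; rewrite /low lo in nl.
Qed.

Lemma sumn_lt m c : (0 < size c)%N -> all (fun i => i < m)%N c -> (sumn c < size c * m)%N.
Proof.
case: c => // a c _ /= /andP[am cm]; rewrite mulSn -addSn leq_add //.
by elim: c cm => //= b c IH /andP[bm cm]; rewrite mulSn leq_add ?IH // ltnW.
Qed.

Lemma low_weight m W St : St \in states n.+1 w W -> low m St -> (W < n.+1 * m)%N.
Proof.
move=> /states_mem[c [ks [-> sc sumc kv pe]]] /low_head cm.
by have := sumn_lt (isT : 0 < size (0%N :: c))%N cm; rewrite /= add0n sc sumc.
Qed.

(** At [t = s^m] the states leaving the [m]-dimensional quotient contribute zero, and the others
    have bounded weight; so the truncation in [jones] may be dropped. *)
Lemma lsum_jones m V (f : int -> rat) : (0 < m)%N -> (n.+1 * m <= V)%N ->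
  lsum (fun a _ => f a) (jones n.+1 w m) =
  \sum_(W < V) \sum_(St <- states n.+1 w W) lsum (fun a b => f (a + Posz m * b)) (contrib n.+1 w St).
Proof.
move=> m0 NV; rewrite {1}/lsum /jones big_map -/(lsum (fun a b => f (a + Posz m * b)) _).
rewrite lsum_flatten big_map big_filter big_flatten big_map.
set g := fun W => \sum_(St <- states n.+1 w W) lsum (fun a b => f (a + Posz m * b)) (contrib n.+1 w St).
transitivity (\sum_(W < n.+1 * m) g W).
  rewrite -(big_mkord xpredT g) /index_iota subn0; apply: eq_bigr => W _; rewrite /g.
  rewrite [RHS](bigID (low m)) /= [X in _ = _ + X]big_seq_cond [X in _ = _ + X]big1 ?addr0 //.
  by move=> St /andP[Ss nl]; apply: (contrib_not_low m0 Ss nl).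
rewrite (big_ord_widen V g NV) big_mkcond; apply: eq_bigr => -[W WV] _ /=.
case: ltnP => // mW; rewrite /g big_seq big1 // => St Ss; apply: (contrib_not_low m0 Ss).
by apply/negP => /(low_weight Ss); rewrite ltnNge mW.
Qed.

Lemma lsum_exp_bitay m r p : lsum (fun a b => ehalf (a + Posz m * b) r) p =
  \sum_(i < r.+1) m%:R ^+ i * lsum (bitay i (r - i)) p.
Proof.
under [RHS]eq_bigr => i _ do rewrite -lsum_mull.
rewrite -lsum_sum; apply: lsum_eq => x _; rewrite addrC ehalfD; apply: eq_bigr => i _.
rewrite /bitay [RHS]mulrA; congr (_ * _).
by rewrite /ehalf rmorphM /= -mulrA exprMn -[LHS]mulrA.
Qed.

Lemma hcoef_useries Z : is_useries n w Z -> forall m r, (0 < m)%N ->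
  hcoef (jones n.+1 w m) r = \sum_(i < r.+1) Z (r - i)%N i * m%:R ^+ i.
Proof.
move=> ZP m r m0.
have [V0 HV] := sums_to_uniform (fun i => ZP (r - i)%N i) r.
pose V := (V0 + n.+1 * m)%N.
have -> : hcoef (jones n.+1 w m) r = lsum (fun a _ => ehalf a r) (jones n.+1 w m).
  by apply: eq_bigr => x _; rewrite -[RHS]mulrzl /ehalf [RHS]mulrA.
rewrite (@lsum_jones m V (ehalf^~ r)) ?leq_addl //.
transitivity (\sum_(W < V) \sum_(i < r.+1) m%:R ^+ i * tay i (hypart n w (r - i) W)).
  apply: eq_bigr => W _; under eq_bigr => St _ do rewrite lsum_exp_bitay.
  by rewrite exchange_big; apply: eq_bigr => i _ /=; rewrite (tay_hypart wn kn) mulr_sumr.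
rewrite exchange_big; apply: eq_bigr => i _ /=.
by rewrite -mulr_sumr (HV V) ?leq_addr -1?ltnS // mulrC.
Qed.

Lemma lev_jones m s t : (0 < m)%N -> 1 < s ->
  lev s t (jones n.+1 w m) = jonestr (s ^+ 2) (s / s ^+ m) m (n.+1, posw w).
Proof.
move=> m0 s1; have s0 : s != 0 by rewrite gt_eqF // (lt_trans ltr01).
have sm0 : s ^+ m != 0 by rewrite expf_neq0.
have -> : lev s t (jones n.+1 w m) = lsum (fun a _ => s ^ a) (jones n.+1 w m).
  by apply: lsum_eq => x /mapP[y _ ->] /=; rewrite expr0z mulr1.
have shift p : lsum (fun a b => s ^ (a + Posz m * b)) p = lev s (s ^+ m) p.
  by apply: lsum_eq => x _; rewrite expfzDr // exprnP exprz_exp.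
rewrite (lsum_jones (exprz s) m0 (leqnn _)) /jonestr /redtr /= mulr_sumr.
pose G c := \sum_(ks <- kseqs w (0%N :: c) | pathend w (0%N :: c) ks == 0%N :: c)
  lev s (s ^+ m) (contrib n.+1 w (0%N :: c, ks)).
transitivity (\sum_(W < n.+1 * m) \sum_(c <- comps n W | all (fun i => i < m)%N c) G c).
  apply: eq_bigr => W _.
  transitivity (\sum_(St <- states n.+1 w W) lev s (s ^+ m) (contrib n.+1 w (St.1, St.2))).
    by apply: eq_bigr => -[c ks] _; apply: shift.
  rewrite (big_states _ _ _ (fun c ks => lev s (s ^+ m) (contrib n.+1 w (c, ks)))).
  rewrite [RHS]big_mkcond; apply: eq_big_seq => c cc; case: ifPn => // nc.
  rewrite big_seq_cond big1 // => ks /andP[ksk pe]; rewrite -shift.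
  apply: (@contrib_not_low m W) => //.
    apply/allpairsPdep; exists (0%N :: c), ks; split=> //; first exact: map_f.
    by rewrite mem_filter pe.
  by apply: contra nc => /low_head /andP[].
transitivity (\sum_(c <- cfgs m n) G c).
  transitivity (\sum_(c <- cfgs m n) \sum_(W < n.+1 * m | sumn c == W) G c); last first.
    apply: eq_big_seq => c; rewrite mem_cfgs => /andP[/eqP sc cm].
    have cV : (sumn c < n.+1 * m)%N.
      by have := sumn_lt (isT : 0 < size (0%N :: c))%N; rewrite /= add0n sc; apply; rewrite m0.
    by rewrite (big_pred1 (Ordinal cV)) // => W; rewrite /= eq_sym.
  rewrite (exchange_big_dep xpredT) //=; apply: eq_bigr => W _.
  rewrite -big_filter -[RHS]big_filter; apply: perm_big; apply: uniq_perm.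
  - by rewrite filter_uniq ?uniq_comps.
  - by rewrite filter_uniq ?uniq_cfgs.
  - by move=> c; rewrite !mem_filter mem_comps mem_cfgs; case: (size c == n); rewrite ?andbF // andbC.
apply: eq_big_seq => c; rewrite mem_cfgs => /andP[/eqP sc cm].
rewrite opw_posw ?/= ?sc // !mulr_sumr /G big_mkcond; apply: eq_bigr => ks _.
rewrite /dirac; case: eqP => _; last by rewrite !mulr0.
rewrite mulr1 mulrA lev_lmul // lev_lmono /= add0n; congr (_ * _).
rewrite mul1r -exprnN -exprnP exprMn exprVn exprD -!exprM invfM.
have s1' := expf_neq0 n s0; have s2' := expf_neq0 (2 * sumn c) s0; have s3' := expf_neq0 (m * n) s0.
by field; rewrite s1' s2' s3'.
Qed.

End ColoredJones.

(** * The trace *)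

Lemma hcoef_lsum p r : hcoef p r = lsum (fun a _ => ehalf a r) p.
Proof. by apply: eq_bigr => x _; rewrite -[RHS]mulrzl /ehalf [RHS]mulrA. Qed.

Lemma coef_unique r (c d : nat -> rat) :
  (forall m : nat, (0 < m)%N -> \sum_(i < r.+1) c i * m%:R ^+ i = \sum_(i < r.+1) d i * m%:R ^+ i) ->
  forall i, (i <= r)%N -> c i = d i.
Proof.
move=> cd i ir; apply/eqP; rewrite -subr_eq0.
have P0 : \poly_(i < r.+1) (c i - d i) = 0.
  apply: poly_vanish_geq2 => m m1; rewrite horner_poly.
  under eq_bigr => k _ do rewrite mulrBl.
  by rewrite sumrB cd ?subrr // ltnW.
by have := congr1 (fun P : {poly rat} => P`_i) P0; rewrite coef_poly ltnS ir coef0 => ->.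
Qed.

Lemma generic_rat (q : rat) : 1 < q -> generic q.
Proof.
move=> q1; split; first by rewrite gt_eqF // (lt_trans ltr01).
by move=> k; rewrite gt_eqF // exprn_egt1.
Qed.

Lemma markov_hcoef_jones n w n' w' m r : all (fun g => g < n)%N w -> is_knot n.+1 w ->
  all (fun g => g < n')%N w' -> is_knot n'.+1 w' ->
  markov_equiv (n.+1, posw w) (n'.+1, posw w') -> (0 < m)%N ->
  hcoef (jones n.+1 w m) r = hcoef (jones n'.+1 w' m) r.
Proof.
move=> wn kn wn' kn' mk m0; rewrite !hcoef_lsum; apply: lpoly_ext => s t s1 _.
have s0 : s != 0 by rewrite gt_eqF // (lt_trans ltr01).
rewrite !lev_jones //; apply: markov_jonestr => //.
- by apply: generic_rat; rewrite exprn_egt1.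
- by rewrite mulf_neq0 // invr_eq0 expf_neq0.
- rewrite exprMn exprVn -!exprM mulnC divfK //; exact: expf_neq0.
Qed.

(** At each order in [h] the colored Jones coefficients are polynomial in the dimension [m], and
    agreement for all [m] recovers the double series. *)
Lemma markov_useries n w n' w' Z Z' : all (fun g => g < n)%N w -> is_knot n.+1 w ->
  all (fun g => g < n')%N w' -> is_knot n'.+1 w' ->
  markov_equiv (n.+1, posw w) (n'.+1, posw w') -> is_useries n w Z -> is_useries n' w' Z' ->
  forall j i, Z j i = Z' j i.
Proof.
move=> wn kn wn' kn' mk ZP ZP' j i; rewrite -(addnK i j).
apply: (@coef_unique (j + i) (fun l => Z (j + i - l)%N l) (fun l => Z' (j + i - l)%N l)); rewrite ?leq_addl //.
move=> m m0 /=.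
rewrite -(hcoef_useries wn kn ZP _ m0) -(hcoef_useries wn' kn' ZP' _ m0).
exact: markov_hcoef_jones.
Qed.

(** The common expansion at [y = 1] satisfies the rational equations of both braids;
    [expansion_transfer] carries one of them to [y = 0], where the nonzero denominator cancels. *)
Lemma markov_hseries n w n' w' : all (fun g => g < n)%N w -> is_knot n.+1 w ->
  all (fun g => g < n')%N w' -> is_knot n'.+1 w' ->
  markov_equiv (n.+1, posw w) (n'.+1, posw w') ->
  forall j i, hseries n w j i = hseries n' w' j i.
Proof.
move=> wn kn wn' kn' mk j.
have [Z ZP] := useries_exists wn kn; have [Z' ZP'] := useries_exists wn' kn'.
have [G [p [G0 Gh GZ]]] := hseries_rational wn kn j ZP.
have [G' [p' [G0' Gh' GZ']]] := hseries_rational wn' kn' j ZP'.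
have lG : G'`_(size G').-1 != 0 by rewrite -/(lead_coef G') lead_coef_eq0.
move=> i; apply/eqP; rewrite -subr_eq0; apply/eqP; move: i.
apply: (cv_eq0 (f := fun e => G'`_e) lG) => i; rewrite cvB Gh'.
rewrite (expansion_transfer G0 Gh GZ (D := G') (P := p')) ?subrr // => l.
rewrite -GZ'; apply: eq_cv => // k _; exact: (markov_useries wn kn wn' kn' mk ZP ZP').
Qed.

Lemma MMR_useries n w P D Z : all (fun g => g < n)%N w -> is_knot n.+1 w ->
  is_useries n w Z -> MMR n.+1 w P D -> forall j i,
  cv (Z j) (fun l => xser (xpow D (2 * j).+1) l) i = xser (P j) i / j`!%:R.
Proof.
move=> wn kn ZP [b [b1 b2]] j i.
have bZ k l : b (k + l)%N k = Z l k.
  rewrite -[in Z l k](addKn k l).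
  apply: (@coef_unique (k + l) (fun i => b (k + l)%N i) (fun i => Z (k + l - i)%N i)); rewrite ?leq_addr //.
  by move=> m m0; rewrite /= -b1 // (hcoef_useries wn kn ZP).
rewrite -b2 mulr_suml; apply: eq_bigr => k _; rewrite bZ.
by field; apply: fact_rat_neq0.
Qed.

Definition tracepoly n w B : lpoly :=
  flatten [seq contrib n.+1 w St | St <- flatten [seq states n.+1 w W | W <- iota 0 B]].

(** The cutoff is safe: for a positive knot, weight [W] only reaches exponents of [t] at most
    [- 2 * W]. *)
Definition trace n w (a b : int) : int := \sum_(W < (absz b).+1) blocksum n.+1 w W a b.

Lemma mem_tracepoly n w B m : m \in tracepoly n w B ->
  exists W St, St \in states n.+1 w W /\ m \in contrib n.+1 w St.
Proof.
by case/flattenP => _ /mapP[St /flattenP[_ /mapP[W _ ->] Ss] ->] mc; exists W, St.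
Qed.

Lemma lsum_tracepoly (R : comNzRingType) (f : int -> int -> R) n w B : lsum f (tracepoly n w B) =
  \sum_(W < B) \sum_(St <- states n.+1 w W) lsum f (contrib n.+1 w St).
Proof.
rewrite lsum_flatten big_map big_flatten big_map.
rewrite -(big_mkord xpredT (fun W => \sum_(St <- states n.+1 w W) lsum f (contrib n.+1 w St))).
by rewrite /index_iota subn0.
Qed.

Lemma trace_tracepoly n w a b : trace n w a b = lcoef (tracepoly n w (absz b).+1) a b.
Proof.
rewrite lcoef_lsum lsum_tracepoly; apply: eq_bigr => W _; apply: eq_bigr => St _.
exact: lcoef_lsum.
Qed.

Lemma lcoef_neq0 p a b : lcoef p a b != 0 -> exists2 m, m \in p & m.2 = (a, b).
Proof.
have [/hasP[m mp /eqP E] _|] := boolP (has (fun m => m.2 == (a, b)) p); first by exists m.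
by move=> /hasPn h; rewrite /lcoef big_seq_cond big1 ?eqxx // => m /andP[/h /negPf ->].
Qed.

Lemma lcoef_window p A b (f : int -> rat) : (lbound p < A)%N ->
  \sum_(x <- iota 0 (2 * A)) (lcoef p (Posz x - Posz A) b)%:~R * f (Posz x - Posz A) =
  lsum (fun a b' => f a * (b' == b)%:R) p.
Proof.
move=> pA; have E x : (lcoef p (Posz x - Posz A) b)%:~R * f (Posz x - Posz A) =
    \sum_(m <- p) (m.2.1 == Posz x - Posz A)%:R * (f m.2.1 * (m.2.2 == b)%:R *~ m.1).
  rewrite /lcoef big_mkcond rmorph_sum mulr_suml; apply: eq_bigr => m _ /=.
  have -> : (m.2 == (Posz x - Posz A, b)) = (m.2.1 == Posz x - Posz A) && (m.2.2 == b) by [].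
  case: eqP => [->|_]; last by rewrite !mul0r.
  by case: eqP => _; rewrite /= ?mulr1 ?mul1r ?mulr0 ?mul0rz ?mul0r ?mulr0 // -[RHS]mulrzl.
under eq_bigr => x _ do rewrite E.
rewrite exchange_big /=; apply: eq_big_seq => m /lboundP[mA _].
have {}mA := leq_ltn_trans mA pA; move: (m.2.1) mA => a aA.
have im : absz (a + Posz A)%R \in iota 0 (2 * A) by rewrite mem_iota; lia.
rewrite (bigD1_seq _ im) ?iota_uniq //= big1 => [|x].
  by rewrite (_ : a == _) ?mul1r ?addr0 //; lia.
by move=> /eqP xi; case: eqP => [Em|_]; [lia | rewrite mul0r].
Qed.

Lemma trace_bounded n w b : exists A : int, forall a, A < a -> trace n w a b = 0.
Proof.
exists (Posz (lbound (tracepoly n w (absz b).+1))) => a Aa.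
apply/eqP/negPn/negP; rewrite trace_tracepoly => /lcoef_neq0[m /lboundP[mA _] mE].
by move: mA; rewrite mE /=; lia.
Qed.

Section Trace.
Variables (n : nat) (w : seq nat).
Hypotheses (wn : all (fun g => g < n)%N w) (kn : is_knot n.+1 w).

Lemma trace_IsTrace : IsTrace n.+1 w (trace n w).
Proof.
move=> a b; exists (absz b).+1; split=> // W bW St Ss; apply/eqP/negPn/negP => /lcoef_neq0[m mc mE].
have [a' [b' [_ mb _]]] := contrib_term wn kn Ss mc.
by move: mb bW; rewrite mE /= => ->; lia.
Qed.

Lemma trace_neq0 a b : trace n w a b != 0 -> exists a' b' : nat,
  [/\ a = Posz (2 * a')%N, b = - Posz (2 * b')%N & b' = 0%N -> size w = n].
Proof.
rewrite trace_tracepoly => /lcoef_neq0[m /mem_tracepoly[W [St [Ss mc]]] mE].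
have [a' [b' [ma mb mw]]] := contrib_term wn kn Ss mc.
by exists a', (W + b')%N; rewrite mE in ma mb; split.
Qed.

Lemma trace_InZqx : InZqx (trace n w).
Proof.
split=> [a b /trace_neq0[a' [b' [-> -> _]]]|]; last exact: trace_bounded.
by split; try lia.
Qed.

Lemma trace_hseries j e : e <= 0 -> lsum (fun a b => ehalf a j * (b == 2 * e)%:R)
  (tracepoly n w (absz (2 * e)).+1) = hseries n w j (absz (2 * e)).
Proof.
move=> e0; rewrite lsum_tracepoly; apply: eq_bigr => W _.
rewrite coef_sum; apply: eq_big_seq => St Ss; rewrite coef_hy; apply: lsum_eq => m mc.
have [a [b [_ mb _]]] := contrib_term wn kn Ss mc; congr (_ * _%:R); congr nat_of_bool.
by rewrite mb; apply/eqP/eqP; lia.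
Qed.

Lemma trace_window A j e : e <= 0 -> (lbound (tracepoly n w (absz (2 * e)%R).+1) < A)%N ->
  \sum_(x <- iota 0 (2 * A)) (trace n w (Posz x - Posz A) (2 * e))%:~R * ehalf (Posz x - Posz A) j =
  hseries n w j (absz (2 * e)).
Proof.
move=> e0 lA; rewrite -trace_hseries // -(lcoef_window _ (ehalf^~ j) lA).
by apply: eq_bigr => x _; rewrite trace_tracepoly.
Qed.

Definition hlaurent j (e : int) : rat := if e <= 0 then hseries n w j (absz (2 * e)) else 0.

Lemma hlaurent_HbarCoeff j e : HbarCoeff (trace n w) j e (hlaurent j e).
Proof.
exists (lbound (tracepoly n w (absz (2 * e)).+1)).+1; split.
  move=> a Aa; apply/eqP/negPn/negP; rewrite trace_tracepoly => /lcoef_neq0[m /lboundP[mA _] mE].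
  by move: mA; rewrite mE /= leqNgt Aa.
rewrite /hlaurent; case: ifPn => e0.
  by rewrite -(trace_window _ e0 (ltnSn _)); apply: eq_bigr => x _; rewrite /ehalf mulrA.
rewrite big1 // => x _; set t := trace _ _ _ _.
have [->|] := eqVneq t 0; first by rewrite !mul0r.
by case/trace_neq0 => a' [b' [_ be _]]; lia.
Qed.

End Trace.

(** For a fixed power of [t], the coefficients of [h^j] are, up to factorials, the moments of
    finitely many integers at the distinct nodes [a / 2]; they determine these integers. *)
Lemma markov_trace n w n' w' : all (fun g => g < n)%N w -> is_knot n.+1 w ->
  all (fun g => g < n')%N w' -> is_knot n'.+1 w' ->
  markov_equiv (n.+1, posw w) (n'.+1, posw w') ->
  forall a b, trace n w a b = trace n' w' a b.
Proof.
move=> wn kn wn' kn' mk a b; have [b0|b0] := leP b 0; last first.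
  have z m v : all (fun g => g < m)%N v -> is_knot m.+1 v -> trace m v a b = 0.
    move=> vm kv; apply/eqP/negPn/negP => /(trace_neq0 vm kv)[a' [b' [_ bE _]]].
    by move: b0; rewrite bE; lia.
  by rewrite !z.
have [->|] := eqVneq (trace n w a b) (trace n' w' a b) => // neq; exfalso.
have [e be] : exists e, b = 2 * e.
  have [t0|/(trace_neq0 wn kn)[a' [b' [_ -> _]]]] := eqVneq (trace n w a b) 0; last first.
    by exists (- Posz b'); lia.
  have [t0'|/(trace_neq0 wn' kn')[a' [b' [_ -> _]]]] := eqVneq (trace n' w' a b) 0; last first.
    by exists (- Posz b'); lia.
  by rewrite t0 t0' eqxx in neq.
have e0 : e <= 0 by lia.
(* Wide enough for the window to contain both supports and the exponent [a]. *)
pose A := (lbound (tracepoly n w (absz b).+1) + lbound (tracepoly n' w' (absz b).+1) +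
  absz a).+1.
pose x (k : nat) : rat := (Posz k - Posz A)%:~R / 2.
have xinj : injective x by move=> k l /half_inj; lia.
pose t (k : nat) : int := trace n w (Posz k - Posz A) b - trace n' w' (Posz k - Posz A) b.
have tA : (t (absz (a + Posz A)%R))%:~R = 0 :> rat.
  apply: (moments_eq0 (iota_uniq 0 (2 * A)) xinj (c := fun k => (t k)%:~R)); last first.
    by rewrite mem_iota /A; lia.
  move=> j; apply: (mulIf (invr_neq0 (fact_rat_neq0 j))); rewrite mul0r mulr_suml.
  transitivity (hseries n w j (absz b) - hseries n' w' j (absz b)); last first.
    by rewrite (markov_hseries wn kn wn' kn' mk) subrr.
  rewrite be -(@trace_window _ _ wn kn A) -?(@trace_window _ _ wn' kn' A) -?be ?e0 //; try by rewrite /A; lia.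
  rewrite -sumrB; apply: eq_bigr => k _.
  by rewrite /t /x /ehalf rmorphB /= -mulrA -mulrBl.
move/eqP: tA; rewrite intr_eq0 /t subr_eq0.
have -> : Posz (absz (a + Posz A)%R) - Posz A = a by rewrite /A; lia.
by rewrite (negPf neq).
Qed.

Lemma wfw_posw N w : all (fun g => g.+1 < N)%N w -> wfw N (posw w).
Proof. by rewrite /wfw /posw all_map. Qed.

(** One letter at a time: conjugating by it puts a copy in front, and the copy at the end cancels
    against the inverse. *)
Lemma markov_rot N (u v : seq nat) : all (fun g => g.+1 < N)%N (u ++ v) ->
  markov_equiv (N, posw (u ++ v)) (N, posw (v ++ u)).
Proof.
elim/last_ind: v u => [|v g IH] u; first by rewrite cats0 => _; apply: rst_refl.
rewrite -rcons_cat all_rcons => /andP[gN uvN].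
have E : rcons v g ++ u = v ++ (g :: u) by rewrite cat_rcons.
rewrite E; apply: rst_trans (IH (g :: u) _); last by rewrite /= gN.
rewrite /posw map_rcons /= -/(posw _).
apply: rst_trans (_ : markov_equiv _ (N, (true, g) :: rcons (rcons (posw (u ++ v)) (true, g)) (~~ true, g))) _.
  apply: rst_step; apply: ms_conj => //.
  by rewrite /wfw all_rcons /= gN; apply: wfw_posw.
apply: rst_step.
have -> : (true, g) :: rcons (rcons (posw (u ++ v)) (true, g)) (~~ true, g) =
   ((true, g) :: posw (u ++ v)) ++ [:: (true, g), (~~ true, g) & [::]].
  by rewrite -!cats1 -catA.
rewrite -[X in mstep _ (N, X)]cats0; apply: ms_free => //.
by rewrite cats0 /wfw /= gN; apply: wfw_posw.
Qed.

(** Each generator occurs exactly once, so the highest one can be rotated to the end and removed by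
    a destabilisation. *)
Lemma markov_unknot n w : all (fun g => g < n)%N w -> size w = n ->
  (forall g, (g < n)%N -> g \in w) -> markov_equiv (n.+1, posw w) (1%N, [::]).
Proof.
elim: n w => [|n IH] w wn sw occ; first by rewrite (size0nil sw); apply: rst_refl.
have uw : uniq w.
  apply: (@leq_size_uniq _ (iota 0 n.+1)); rewrite ?iota_uniq ?size_iota ?sw // => g.
  by rewrite mem_iota add0n => /occ.
have nw := occ n (ltnSn n); case/splitPr: nw wn sw occ uw => u v wn sw occ uw.
have uvn g : g \in v ++ u -> g != n.
  apply: contraTneq => ->; move: uw; rewrite mem_cat cat_uniq /= negb_or -!andbA.
  by case/and5P => _ nu _ nv _; rewrite negb_or nv.
have {}wn g : g \in v ++ u -> (g < n)%N.
  move=> gvu; rewrite ltn_neqAle uvn // -ltnS; apply: (allP wn).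
  by move: gvu; rewrite !mem_cat inE orbC => /orP[] ->; rewrite ?orbT.
rewrite -cat_rcons; apply: rst_trans (_ : markov_equiv _ (n.+2, posw (rcons (v ++ u) n))) _.
  rewrite rcons_cat; apply: markov_rot; apply/allP => g; rewrite mem_cat mem_rcons inE -orbA.
  case/predU1P => [->|]; first exact: ltnSn.
  by rewrite orbC -mem_cat => /wn; lia.
apply: rst_trans (_ : markov_equiv _ (n.+1, posw (v ++ u))) _.
  rewrite /posw map_rcons; apply: rst_sym; apply: rst_step.
  by apply: (@ms_stab n.+1 _ true) => //; apply: wfw_posw; apply/allP => g /wn.
apply: IH => [|| g gn]; first by apply/allP.
  by move: sw; rewrite !size_cat /=; lia.
have := occ g (ltnW gn); rewrite !mem_cat inE orbC => /orP[/predU1P[gE|->//]|->]; rewrite ?orbT //.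
by move: gn; rewrite gE ltnn.
Qed.

(** The polynomial [y^(2K) p(y^-2)], when [K] bounds the exponents of [p]. *)
Definition xinv K (p : xpoly) : {poly rat} :=
  \sum_(m <- p) (m.1)%:~R *: 'X^(absz (2 * (K - m.2))).

(** At [y = exp(-u/2)] the polynomial [y^(2K) p(y^-2)] is [exp(-K u) p(exp u)]. *)
Lemma tay_xinv K p i : (forall m, m \in p -> m.2 <= K) ->
  tay i (xinv K p) = cv (fun l => (- K)%:~R ^+ l / l`!%:R) (xser p) i.
Proof.
move=> pK; rewrite /xinv tay_sum /cv /xser.
under [RHS]eq_bigr => l _ do rewrite mulr_sumr.
rewrite exchange_big /=; apply: eq_big_seq => m /pK; rewrite tayZ tayXn; move: (m.2) => e eK.
have -> : - Posz (absz (2 * (K - e))) = (- K + e) * 2 by lia.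
rewrite /ehalf rmorphM /= mulfK // rmorphD /= expD_fact mulr_sumr.
by apply: eq_bigr => l _; ring.
Qed.

Lemma xpoly_bound (p : xpoly) : exists K : nat, forall m, m \in p -> m.2 <= Posz K.
Proof.
elim: p => [|m p [K HK]]; first by exists 0%N.
exists (K + absz m.2)%N => x; rewrite inE => /predU1P[->|/HK]; move: (m.2) (x.2) => y z; lia.
Qed.

Section Expansion.
Variables (n : nat) (w : seq nat).
Hypotheses (wn : all (fun g => g < n)%N w) (kn : is_knot n.+1 w).

(** Multiplication by [x^(-K)], with [K] bounding the exponents on both sides, makes the Laurent
    identity one over polynomials in [y]. The hypothesis gives it at [y = 1], and
    [expansion_transfer] moves it to [y = 0]. *)
Lemma hlaurent_LaurentExp P D j : MMR n.+1 w P D -> LaurentExp (hlaurent n w j) (P j) j D.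
Proof.
move=> mmr; split.
  by exists 0 => e e0; rewrite /hlaurent leNgt e0.
move=> e; set Dj := xpow D (2 * j).+1.
have [Z ZP] := useries_exists wn kn; have [G [p [G0 Gh GZ]]] := hseries_rational wn kn j ZP.
have [K [DK PK]] : exists K : int, (forall m, m \in Dj -> m.2 <= K) /\ (forall m, m \in P j -> m.2 <= K).
  have [K0 DK] := xpoly_bound Dj; have [K1 PK] := xpoly_bound (P j).
  by exists (Posz (K0 + K1)); split=> m => [/DK|/PK]; move: (m.2) => x; lia.
have key : forall i, cv (fun l => (xinv K Dj)`_l) (hseries n w j) i = (j`!%:R^-1 *: xinv K (P j))`_i.
  apply: (expansion_transfer G0 Gh GZ) => i.
  rewrite (@eq_cv _ _ (cv (fun l => (- K)%:~R ^+ l / l`!%:R) (xser Dj)) _ (Z j)) // => [|l _]; last first.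
    exact: tay_xinv.
  rewrite cvA tayZ tay_xinv //.
  rewrite (@eq_cv _ _ (fun l => (- K)%:~R ^+ l / l`!%:R) _ (fun l => xser (P j) l / j`!%:R)) // => [|l _].
    by rewrite mulr_sumr; apply: eq_bigr => l _; ring.
  by rewrite cvC (MMR_useries wn kn ZP mmr).
have [eK|Ke] := leP e K; last first.
  rewrite big_seq big1 => [|m /DK mK]; last first.
    by move: (m.2) mK => x xK; rewrite /hlaurent ifF ?mulr0 //; lia.
  rewrite /xcoef big_seq_cond big1 ?mul0r // => m /andP[/PK mK /eqP me].
  by move: mK Ke; rewrite me; lia.
(* The power [x^e] corresponds to [y^(2(K-e))] after multiplication by [x^(-K)]. *)
have := key (absz (2 * (K - e))); set i := absz _.
rewrite coefZ /xinv coef_sum.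
have -> : \sum_(m <- P j) ((m.1)%:~R *: 'X^(absz (2 * (K - m.2))))`_i = (xcoef (P j) e)%:~R :> rat.
  rewrite /xcoef [in RHS]big_mkcond rmorph_sum; apply: eq_big_seq => m /PK mK.
  move: (m.2) mK => x xK; rewrite coefZ coefXn /i; case: (eqVneq x e) => [->|me]; first by rewrite eqxx mulr1.
  by rewrite (_ : _ == _ = false) ?mulr0 //; apply/eqP; lia.
rewrite mulrC => <-; rewrite /cv; under [RHS]eq_bigr => l _ do rewrite coef_sum mulr_suml.
rewrite exchange_big; apply: eq_big_seq => m /DK mK /=.
under eq_bigr => l _ do rewrite coefZ coefXn -mulrA.
rewrite -mulr_sumr; congr (_ * _); move: (m.2) mK => x xK; rewrite /hlaurent; case: ifPn => em.
  have li : (absz (2 * (K - x))%R < i.+1)%N by rewrite /i; lia.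
  rewrite (bigD1 (Ordinal li)) //= eqxx mul1r big1 ?addr0 => [|l].
    by congr hseries; rewrite /i; lia.
  by rewrite -val_eqE /= => /negPf ->; rewrite mul0r.
rewrite big1 // => -[l li] _ /=; case: eqP => [lE|_]; last by rewrite mul0r.
by move: li; rewrite lE /i; lia.
Qed.

End Expansion.

(** The unknot has trace 1, and [x^(1/2)] would then occur in [Fminus]. For any other knot the
    constant term in [t] is zero, since it requires a word of length [n], whose closure is the
    unknot. *)
Lemma trace_FminusForm n w : all (fun g => g < n)%N w -> is_knot n.+1 w ->
  ~ markov_equiv (n.+1, posw w) (1%N, [::]) -> FminusForm (trace n w).
Proof.
move=> wn kn nt.
have t0 a : trace n w a 0 = 0.
  apply/eqP/negPn/negP => /(trace_neq0 wn kn)[a' [b' [_ b0 sw]]]; apply: nt.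
  by apply: markov_unknot (fun g gn => knot_occurs kn gn) => //; apply: sw; lia.
split=> [a b|b].
  rewrite /Fminus => F0.
  have [Tm|Tn] := eqVneq (trace n w a (b - 1)) 0.
    move: F0; rewrite Tm sub0r oppr_eq0 => /(trace_neq0 wn kn)[a' [b' [-> bE _]]].
    by split; lia.
  have b1 : b != 1 by apply: contraNneq Tn => ->; rewrite subrr t0.
  have [a' [b' [-> bE _]]] := trace_neq0 wn kn Tn.
  by split; lia.
have [A HA] := trace_bounded n w (b - 1); have [A' HA'] := trace_bounded n w (b + 1).
exists (Posz (absz A + absz A')) => a aA; rewrite /Fminus HA ?HA' ?subr0 //; lia.
Qed.

Theorem theorem1p1 (N : nat) (w : seq nat) :
  positive_knot N w ->
  exists T : int -> int -> int,
    [/\ IsTrace N w T,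
        InZqx T,
        (forall (N' : nat) (w' : seq nat), positive_knot N' w' ->
           markov_equiv (N, posw w) (N', posw w') -> IsTrace N' w' T),
        (~ markov_equiv (N, posw w) (1%N, [::]) -> FminusForm T) &
        (forall (P : nat -> xpoly) (D : xpoly),
           IsAlexander N w D -> MMR N w P D ->
           forall j : nat, exists h : int -> rat,
             (forall e, HbarCoeff T j e (h e)) /\ LaurentExp h (P j) j D)].
Proof.
case: N => [[]//|n]; case=> _ wn kn; rewrite /= in wn.
exists (trace n w); split.
- exact: trace_IsTrace.
- exact: trace_InZqx.
- case=> [|n'] w' [// _ wn' kn'] mk a b.
  have [W [W0 E]] := trace_IsTrace wn' kn' a b.
  by exists W; split; rewrite ?(markov_trace wn kn wn' kn' mk).
- exact: trace_FminusForm.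
- move=> P D _ mmr j; exists (hlaurent n w j); split; first exact: hlaurent_HbarCoeff.
  exact: hlaurent_LaurentExp.
Qed.
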